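(* Let $\gamma>0$, let $\hat r_n$ be defined by $\hat r_n^d = \frac{\gamma\log n}{\alpha n}$, and let $\Delta_n$ denote the maximum vertex degree in $G_n(\hat r_n)$. (i) Suppose that $g(r) = o(r^{-c})$ as $r\to\infty$ for some $c>d$. Then almost surely $$\limsup_{n\to\infty} \frac{\Delta_n}{\log n} \le \gamma H_+^{-1}\left(\frac1\gamma\right).$$ (ii) If $g(r) = o(e^{-cr})$ as $r\to\infty$ for some $c>0$, then almost surely $$\lim_{n\to\infty} \frac{\Delta_n}{\log n} = \gamma H_+^{-1}\left(\frac1\gamma\right).$$ (iii) If $g(r) = o(r^{-c})$ as $r\to\infty$ for some $c>3d$, then almost surely $$\liminf_{n\to\infty} \frac{\Delta_n}{\log n} \ge \gamma H_+^{-1}\left(\frac{c-3d}{\gamma(c-d)}\right).$$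
   Context: Let $d \ge 2$ and $S = \left(-\frac12,\frac12\right]^d$, equipped with the toroidal metric $d(x,y) = \inf\{|x-y-z| : z \in \mathbb{Z}^d\}$, where $|\cdot|$ is the Euclidean norm. (The letter $d$ denotes the dimension; $d(\cdot,\cdot)$ denotes the metric.) The connection function $g:[0,\infty)\to[0,1]$ is non-increasing with $0 < \alpha := \int_{\mathbb{R}^d} g(|x|)\,dx < \infty$. On one probability space $(\Omega,\mathcal{F},P)$ let $X_1,X_2,\ldots$ be independent and uniformly distributed on $S$; let $\{N_n\}_{n\ge1}$ be a non-decreasing sequence of random variables with $N_n$ Poisson of mean $n$; and let $\{U_{ij}\}$ be independent uniform random variables on $[0,1]$; these three families are independent of each other. Set $\mathcal{P}_n = \{X_1,\ldots,X_{N_n}\}$, a Poisson point process of intensity $n$ on $S$. For $r>0$, $G_n(r)$ is the (undirected) graph with vertex set $\mathcal{P}_n$ in which $X_i,X_j\in\mathcal{P}_n$, $i<j$, are joined by an edge iff $U_{ij} \le g\left(\frac{d(X_i,X_j)}{r}\right)$. The almost sure statements refer to this coupled family of graphs. The function $H:[0,\infty)\to[0,\infty)$ is defined by $H(0)=1$ and $H(x) = 1-x+x\log x$ for $x>0$; it is strictly decreasing on $[0,1]$, strictly increasing on $[1,\infty)$, and $H(1)=0$. $H_+^{-1}:[0,\infty)\to[1,\infty)$ is the inverse of the restriction of $H$ to $[1,\infty)$. *)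

(* Defs.v *)
From HB Require Import structures.
From mathcomp Require Import all_boot all_order all_algebra finmap.
From mathcomp Require Import all_classical all_reals all_analysis.
Import Order.TTheory GRing.Theory Num.Theory numFieldNormedType.Exports.

Set Implicit Arguments.
Unset Strict Implicit.
Unset Printing Implicit Defensive.

Local Open Scope classical_set_scope.
Local Open Scope ring_scope.

(* Makes the notation [f =o_+oo h] available. *)
Canonical pinfty_filter_on (R : numFieldType) :=
  FilterType (pinfty_nbhs R) _.

(* R^n is [n.-tuple R] with its product sigma-algebra.  The n-dimensional
   Lebesgue measure is the n-fold product of [lebesgue_measure]: a point mass
   for n = 0, and the image of [lebesgue_measure \x lebesgue_tuple n] under
   (x, t) |-> x :: t for n + 1. *)
Section lebesgue_tuple.
Context {R : realType}.

Definition cons_pair n (p : measurableTypeR R * n.-tuple R) : n.+1.-tuple R :=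
  [tuple of p.1 :: p.2].

Lemma measurable_cons_pair n : measurable_fun setT (@cons_pair n).
Proof.
apply: (@measurable_cons _ _ _ R); first exact: measurable_fst.
exact: measurable_snd.
Qed.

Section step.
Context n (mu : {sigma_finite_measure set (n.-tuple R) -> \bar R}).

Definition lebesgue_cons : set (n.+1.-tuple R) -> \bar R :=
  pushforward (lebesgue_measure \x mu)%E (@cons_pair n).

Let lebesgue_cons0 : lebesgue_cons set0 = 0%E.
Proof. by rewrite /lebesgue_cons /pushforward preimage_set0 measure0. Qed.

Let lebesgue_cons_ge0 A : (0 <= lebesgue_cons A)%E.
Proof. by rewrite /lebesgue_cons /pushforward measure_ge0. Qed.

Let measurable_preim A :
  measurable A -> measurable (@cons_pair n @^-1` A).
Proof. by move=> mA; rewrite -[X in measurable X]setTI; exact: measurable_cons_pair. Qed.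

Let lebesgue_cons_sigma_additive : semi_sigma_additive lebesgue_cons.
Proof.
move=> F mF tF mUF; rewrite /lebesgue_cons /pushforward preimage_bigcup.
apply: measure_semi_sigma_additive.
- by move=> i; exact: measurable_preim.
- apply/trivIsetP => /= i j _ _ ij; rewrite -preimage_setI.
  by move/trivIsetP : tF => /(_ _ _ _ _ ij) ->//; rewrite preimage_set0.
- by rewrite -preimage_bigcup; exact: measurable_preim.
Qed.

HB.instance Definition _ := isMeasure.Build _ _ _ lebesgue_cons
  lebesgue_cons0 lebesgue_cons_ge0 lebesgue_cons_sigma_additive.

Let lebesgue_cons_sigma_finite : sigma_finite setT lebesgue_cons.
Proof.
have /sigma_finiteP[F [FT ndF Foo]] := sigma_finiteT (@lebesgue_measure R).
have /sigma_finiteP[G [GT ndG Goo]] := sigma_finiteT mu.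
pose split_tuple (t : n.+1.-tuple R) : measurableTypeR R * n.-tuple R :=
  (thead t, [tuple of behead t]).
have splitK : cancel (@cons_pair n) split_tuple.
  by case=> x t; congr pair; apply/val_inj.
have msplit : measurable_fun setT split_tuple.
  apply: measurable_fun_pair; last exact: measurable_behead.
  exact: (@measurable_tnth _ R).
exists (fun i => split_tuple @^-1` (F i `*` G i)).
  rewrite -preimage_bigcup (_ : \bigcup_i _ = setT) ?preimage_setT//.
  apply/seteqP; split => // -[x t] _.
  have [i _ Fx] : (\bigcup_i F i) x by rewrite -FT.
  have [j _ Gt] : (\bigcup_i G i) t by rewrite -GT.
  exists (maxn i j) => //; split.
  - by move: x Fx; exact/subsetPset/ndF/leq_maxl.
  - by move: t Gt; exact/subsetPset/ndG/leq_maxr.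
move=> i; have [mF Fi] := Foo i; have [mG Gi] := Goo i; split.
  by rewrite -[X in measurable X]setTI; apply: msplit => //; exact: measurableX.
rewrite /lebesgue_cons /pushforward -comp_preimage.
rewrite (_ : split_tuple \o _ = id) ?preimage_id; last exact/funext.
by rewrite product_measure1E// lte_mul_pinfty// ge0_fin_numE.
Qed.

HB.instance Definition _ := Measure_isSigmaFinite.Build _ _ _ lebesgue_cons
  lebesgue_cons_sigma_finite.

End step.

Fixpoint lebesgue_tuple n : {sigma_finite_measure set (n.-tuple R) -> \bar R} :=
  match n with
  | 0 => \d_[tuple]
  | n.+1 => lebesgue_cons (lebesgue_tuple n)
  end.

End lebesgue_tuple.
Arguments lebesgue_tuple : clear implicits.

Section geometry.
Context {R : realType} (d : nat).
Implicit Types x y : d.-tuple R.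

Definition enorm x : R := Num.sqrt (\sum_(k < d) tnth x k ^+ 2).

(* This cell has volume 1, so the uniform law on it is
   A |-> lebesgue_tuple R d (A `&` torus_cell R d). *)
Definition torus_cell : set (d.-tuple R) :=
  [set x | forall k, - 2^-1 < tnth x k <= 2^-1].

Definition torus_dist x y : R :=
  inf [set enorm [tuple tnth x k - tnth y k - (tnth z k)%:~R | k < d]
      | z in [set: d.-tuple int]].

(* Vertices x 0, ..., x (m - 1) are identified with their indices; only the
   marks [u i j] with i < j are used. *)
Definition connection_graph (m : nat) (x : nat -> d.-tuple R)
    (u : nat -> nat -> R) (g : R -> R) (r : R) : rel 'I_m :=
  fun i j => (i != j) &&
    (u (minn i j) (maxn i j) <= g (torus_dist (x i) (x j) / r)).

(* Indexing starts at 0: the points X_1, ..., X_{N_n} of the process are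
   X 0, ..., X (N n - 1). *)
Definition random_graph (Omega : Type) (X : nat -> Omega -> d.-tuple R)
    (N : nat -> Omega -> nat) (U : nat -> nat -> Omega -> R) (g : R -> R)
    (n : nat) (r : R) (w : Omega) : rel 'I_(N n w) :=
  connection_graph (X ^~ w) (fun i j => U i j w) g r.

End geometry.
Arguments torus_cell : clear implicits.
Arguments random_graph {R d Omega} X N U g n r w.

Definition max_degree m (e : rel 'I_m) : nat :=
  \max_(i < m) #|[pred j | e i j]|.

Section rate_function.
Context {R : realType}.

Definition rateH (x : R) : R := if x == 0 then 1 else 1 - x + x * ln x.

(* Inverse of the restriction of [rateH] to [1, +oo). *)
Definition rateH_inv : R -> R := 'pinv_(fun=> 1) `[1, +oo[ rateH.

End rate_function.

Section independence.
Context {dO} {Omega : measurableType dO} {R : realType}.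
Variable P : probability Omega R.

Definition sigma_of d' (T : measurableType d') (X : Omega -> T) :
  set_system Omega := preimage_set_system setT X measurable.

Definition sigma_of_family I d' (T : measurableType d') (D : set I)
  (X : I -> Omega -> T) : set_system Omega :=
  <<s \bigcup_(i in D) sigma_of (X i) >>.

Definition mutually_independent (I : choiceType) (D : set I)
    (F : I -> set_system Omega) : Prop :=
  forall (J : {fset I}) (A : I -> set Omega), [set` J] `<=` D ->
    (forall i, i \in J -> F i (A i)) ->
    P (\bigcap_(i in [set` J]) A i) = (\prod_(i <- J) P (A i))%E.

End independence.

(* Main.v *)
From HB Require Import structures.
Require Import Defs.
From mathcomp Require Import all_boot all_order all_algebra finmap.
From mathcomp Require Import all_classical all_reals all_analysis.
From mathcomp Require Import measurable_realfun ring lra zify.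
Import Order.TTheory GRing.Theory Num.Theory numFieldNormedType.Exports.

Set Implicit Arguments.
Unset Strict Implicit.
Unset Printing Implicit Defensive.

Local Open Scope classical_set_scope.
Local Open Scope ring_scope.

(** The maximum degree obeys a law of large numbers: almost surely [Delta n / ln n]
    tends to [gamma * rateH_inv gamma^-1].  This is (ii), and (i) follows from it.
    So does (iii), because [(c - 3 * d) / (gamma * (c - d))] is at most
    [gamma^-1] and [rateH_inv] is nondecreasing.  The law is [ae_degree_cvg].

    The number of vertices is asymptotic to [n] almost surely, by Chernoff's bound
    for the Poisson law ([ae_poisson_count]), so that graphs with a deterministic
    number of vertices can be studied instead.  There the torus makes degrees
    easy: whatever the position of a vertex, each other vertex is joined to it
    with the same probability, independently ([prob_edge]), so that a degree is
    exactly binomial ([prob_deg_ge]), with a mean of at most about [gamma * ln n].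
    It exceeds [gamma * y * ln n], for [y > 1], with probability
    [n ^ (- gamma * rateH y)] up to lower order.  There are [n] vertices, and the
    threshold is the level at which [gamma * rateH y = 1].

    Above this level, Chernoff's bound and a union bound over the vertices give a
    probability [n ^ (- delta)] that some degree is large ([prob_upper_event]).

    Below it, the expected number of vertices of large degree is a positive power
    of [n], and a second moment argument shows that there is one
    ([prob_no_large_deg]).  The correlations are controlled as follows.  The
    connection function is first truncated at a large distance [K], which only
    removes edges and costs an arbitrarily small fraction of the mean degree
    ([integral_cut]).  A few vertices serve as centres, and their
    neighbours are counted among the others.  Two centres further apart than a
    multiple of [K * r] have no common neighbour, and then their degrees are
    negatively correlated ([prob_deg_ge_pair]); closer pairs are rare, having
    probability of order [ln n / n].  Stirling's formula bounds the binomial tail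
    from below ([btail_ge_expR]).

    The exceptional probabilities [n ^ (- delta)] need not be summable in [n].  They
    are summable along the powers [k ^ M] for [M] large, and between two
    consecutive powers [b] and [b'] the graphs are compared with a single one: the
    degrees are monotone in the number of vertices and in the radius, and both
    change by a factor close to 1 ([upper_event], [lower_event],
    [ae_good_bracket]). *)
(** * Integration over tuples of reals *)

Section lebesgue_affine.
Context {R : realType}.
Local Notation mu := (@lebesgue_measure R).

Lemma measurable_affine (a b : R) :
  measurable_fun [set: measurableTypeR R]
    (fun x : measurableTypeR R => a * x + b : measurableTypeR R).
Proof. exact: measurable_funD. Qed.

Lemma lebesgue_measure_affine (a b : R) (A : set (measurableTypeR R)) :
  0 < a -> measurable A ->
  (mu A = a%:E * mu ((fun x => a * x + b)%R @^-1` A))%E.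
Proof.
move=> a0 mA.
pose phi : measurableTypeR R -> measurableTypeR R := fun x => a * x + b.
have mphi : measurable_fun setT phi := measurable_affine a b.
pose m := (mscale (NngNum (ltW a0)) (pushforward mu phi) :
  {measure set (measurableTypeR R) -> \bar R}).
rewrite (@lebesgue_measure_unique _ (m mphi)) //.
move=> _ [[s t] _ <-] /=.
rewrite /m /mscale /= /pushforward.
have -> : phi @^-1` `]s, t] = `](s - b) / a, (t - b) / a]%classic.
  apply/seteqP; split=> x /=; rewrite !in_itv/= /phi ltr_pdivrMr// ler_pdivlMr//; lra.
rewrite !lebesgue_measure_itv/= !lte_fin ltr_pM2r ?invr_gt0// ltrD2r.
case: ifPn => st; last by rewrite mule0.
by rewrite -!EFinB -EFinM; congr EFin; field; rewrite gt_eqF.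
Qed.

Lemma ge0_integral_affine (a b : R) (f : R -> \bar R) :
  0 < a -> measurable_fun [set: measurableTypeR R] f -> (forall x, 0 <= f x)%E ->
  (\int[mu]_x f x = a%:E * \int[mu]_x f (a * x + b)%R)%E.
Proof.
move=> a0 mf f0.
pose phi : measurableTypeR R -> measurableTypeR R := fun x => a * x + b.
have mphi : measurable_fun setT phi := measurable_affine a b.
pose m := (mscale (NngNum (ltW a0)) (pushforward mu phi) :
  {measure set (measurableTypeR R) -> \bar R}).
rewrite (@eq_measure_integral _ _ _ _ (m mphi)); last first.
  by move=> A mA _; exact: (lebesgue_measure_affine b a0 mA).
rewrite ge0_integral_mscale//=.
by rewrite ge0_integral_pushforward.
Qed.

End lebesgue_affine.

Section lebesgue_tuple_integral.
Context {R : realType}.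
Local Notation mu := (@lebesgue_measure R).
Local Notation cell := (`](- 2^-1), 2^-1]%classic : set R).

Lemma ge0_integral_lebesgue_tupleS n (f : n.+1.-tuple R -> \bar R) :
  measurable_fun setT f -> (forall t, 0 <= f t)%E ->
  (\int[lebesgue_tuple R n.+1]_t f t =
   \int[mu]_x \int[lebesgue_tuple R n]_t f [tuple of x :: t])%E.
Proof.
move=> mf f0.
have mc := @measurable_cons_pair R n.
rewrite /= /lebesgue_cons ge0_integral_pushforward//.
rewrite preimage_setT fubini_tonelli1//=.
exact: (measurableT_comp mf mc).
Qed.

Lemma measurable_fun_tuple_section n (f : n.+1.-tuple R -> \bar R) x :
  measurable_fun setT f ->
  measurable_fun setT (fun t : n.-tuple R => f [tuple of x :: t]).
Proof.
move=> mf; apply: (measurableT_comp mf).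
by apply: (@measurable_cons _ _ _ R).
Qed.

Lemma measurable_fun_tuple_integral n (f : n.+1.-tuple R -> \bar R) :
  measurable_fun setT f -> (forall t, 0 <= f t)%E ->
  measurable_fun [set: measurableTypeR R]
    (fun x => \int[lebesgue_tuple R n]_t f [tuple of x :: t])%E.
Proof.
move=> mf f0.
apply: (@measurable_fun_fubini_tonelli_F _ _ _ _ _ (lebesgue_tuple R n)
   (f \o @cons_pair R n)) => //=.
by apply: measurableT_comp mf _; exact: measurable_cons_pair.
Qed.

Lemma tuple_map_cons n (a : R -> 'I_n.+1 -> R) (x : R) (t : n.-tuple R) :
  [tuple a (tnth [tuple of x :: t] k) k | k < n.+1] =
  [tuple of a x ord0 :: [tuple a (tnth t k) (lift ord0 k) | k < n]].
Proof.
apply: eq_from_tnth => k; rewrite tnth_mktuple.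
case: (unliftP ord0 k) => [j|] ->; last by rewrite tnth0.
by rewrite !tnthS tnth_mktuple.
Qed.

Lemma measurable_fun_tuple_map n (a : R -> 'I_n -> R) :
  (forall k, measurable_fun [set: R] (a ^~ k)) ->
  measurable_fun setT (fun t : n.-tuple R => [tuple a (tnth t k) k | k < n]).
Proof.
move=> ma; apply/measurable_fun_tnthP => i.
rewrite (_ : _ \o _ = (a ^~ i) \o (fun t => tnth t i)); last first.
  by apply/funext => t /=; rewrite tnth_mktuple.
by apply: measurableT_comp (ma i) _; exact: measurable_tnth.
Qed.

Lemma ge0_integral_scale_tuple n (a : R) (f : n.-tuple R -> \bar R) :
  0 < a -> measurable_fun setT f -> (forall t, 0 <= f t)%E ->
  (\int[lebesgue_tuple R n]_t f t =
   (a ^+ n)%:E * \int[lebesgue_tuple R n]_t f [tuple (a * tnth t k)%R | k < n])%E.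
Proof.
move=> a0; elim: n f => [|n IH] f mf f0.
  rewrite expr0 mul1e; apply: eq_integral => t _; congr f.
  by rewrite tuple0; apply/esym; rewrite tuple0.
have mscale k : measurable_fun setT
    (fun t : k.-tuple R => [tuple (a * tnth t i)%R | i < k]).
  by apply: (@measurable_fun_tuple_map k (fun x _ => a * x)) => _; exact: measurable_funM.
rewrite !ge0_integral_lebesgue_tupleS//; last exact: (measurableT_comp mf (mscale _)).
rewrite (ge0_integral_affine 0 a0)//; first last.
  - by move=> x; apply: integral_ge0.
  - exact: measurable_fun_tuple_integral.
rewrite exprS EFinM -muleA; congr (_ * _)%E.
rewrite -ge0_integralZl//; first last.
  - by rewrite lee_fin exprn_ge0// ltW.
  - by move=> x _; apply: integral_ge0.
  - apply: (@measurable_fun_tuple_integral n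
      (fun t => f [tuple (a * tnth t k)%R | k < n.+1])) => //.
    exact: (measurableT_comp mf (mscale _)).
apply: eq_integral => x _; rewrite addr0 IH//; last exact: measurable_fun_tuple_section.
congr (_ * _)%E; apply: eq_integral => t _; congr f.
exact/esym/(@tuple_map_cons _ (fun x _ => a * x)).
Qed.

Lemma torus_cell_cons n (x : R) (t : n.-tuple R) :
  torus_cell R n.+1 [tuple of x :: t] <-> cell x /\ torus_cell R n t.
Proof.
rewrite /torus_cell/=; split=> [h|[hx ht] k].
  split; first by have := h ord0; rewrite tnth0 in_itv.
  by move=> k; have := h (lift ord0 k); rewrite tnthS.
case: (unliftP ord0 k) => [j|] ->; last by rewrite tnth0; rewrite in_itv in hx.
by rewrite tnthS.
Qed.

Lemma measurable_torus_cell n : measurable (torus_cell R n).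
Proof.
rewrite (_ : torus_cell R n = \bigcap_(k in [set: 'I_n]) ((fun t => tnth t k) @^-1` cell)).
  apply: fin_bigcap_measurable => // k _; rewrite -[X in measurable X]setTI.
  exact: measurable_tnth.
apply/seteqP; split=> [t ht k _ /=|t ht k]; first by rewrite in_itv; exact: ht.
by have := ht k Logic.I; rewrite /= in_itv.
Qed.

Lemma ge0_integral_torus_cellS n (f : n.+1.-tuple R -> \bar R) :
  measurable_fun setT f -> (forall t, 0 <= f t)%E ->
  (\int[lebesgue_tuple R n.+1]_(t in torus_cell R n.+1) f t =
   \int[mu]_(x in cell)
     \int[lebesgue_tuple R n]_(t in torus_cell R n) f [tuple of x :: t])%E.
Proof.
move=> mf f0.
rewrite integral_mkcond ge0_integral_lebesgue_tupleS//; first last.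
- by move=> t; rewrite patchE; case: ifP.
- apply/(measurable_restrictT _ _).1 => //; first exact: measurable_torus_cell.
  exact: measurable_funTS.
rewrite [RHS]integral_mkcond; apply: eq_integral => x _.
rewrite patchE; case: ifPn => [/set_mem xI|xI].
  rewrite [RHS]integral_mkcond; apply: eq_integral => t _; rewrite !patchE.
  have [tS|tS] := boolP (t \in _).
    by rewrite mem_set//; apply/torus_cell_cons; split => //; exact: set_mem.
  rewrite memNset// => /torus_cell_cons[_ tS']; move/negP: tS; apply; exact: mem_set.
apply: integral0_eq => t _; rewrite patchE memNset// => /torus_cell_cons[xI' _].
by move/negP : xI; apply; exact: mem_set.
Qed.

(** The part of the interval that the translation pushes out re-enters, by
    periodicity, at the other end. *)
Lemma integral_periodic_shift (f : R -> \bar R) (b : R) :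
  measurable_fun [set: measurableTypeR R] f -> (forall x, 0 <= f x)%E ->
  (forall x (z : int), f (x + z%:~R) = f x) ->
  (\int[mu]_(x in cell) f (x + b)%R = \int[mu]_(x in cell) f x)%E.
Proof.
move=> mf f0 pf.
have shift c (A : set (measurableTypeR R)) : measurable A ->
    (\int[mu]_(x in [set y | A (y + c)%R]) f (x + c)%R = \int[mu]_(x in A) f x)%E.
  move=> mA; rewrite integral_mkcond [RHS]integral_mkcond.
  rewrite [RHS](ge0_integral_affine c ltr01)//; first last.
  - by move=> x; rewrite patchE; case: ifP.
  - by apply/(measurable_restrictT _ _).1 => //; exact: measurable_funTS.
  rewrite mul1e; apply: eq_integral => x _; rewrite !patchE mul1r.
  by congr (if _ then _ else _); apply/idP/idP; rewrite !inE.
wlog [b0 b1] : b / 0 <= b /\ b < 1.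
  move=> H; rewrite -(H (b - (Num.floor b)%:~R)).
    by apply: eq_integral => x _; rewrite -(pf (x + (b - _)) (Num.floor b)) -addrA subrK.
  have := floor_le b; have := floorD1_gt b; rewrite intrD; lra.
have mI (u v : R) : measurable (`]u, v]%classic : set (measurableTypeR R)) by [].
have mF (c : R) D : measurable D ->
   measurable_fun (D : set (measurableTypeR R)) (fun x => f (x + c)%R).
  move=> mD; apply: measurable_funTS; apply: measurableT_comp mf _.
  exact: measurable_funD.
have split u v w (c : R) : u <= v -> v <= w ->
    (\int[mu]_(x in `]u, w]) f (x + c)%R =
     \int[mu]_(x in `]u, v]) f (x + c)%R + \int[mu]_(x in `]v, w]) f (x + c)%R)%E.
  move=> uv vw; rewrite -ge0_integral_setU//=.
  - by rewrite -itv_bndbnd_setU// bnd_simp.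
  - by apply: mF; exact: measurableU.
  - rewrite disj_set2E; apply/eqP/seteqP; split=> x //=; rewrite !in_itv/=; lra.
have move_itv u v c : (\int[mu]_(x in `]u, v]) f (x + c)%R =
    \int[mu]_(x in `](u + c)%R, (v + c)%R]) f x)%E.
  rewrite -(shift c `]u + c, v + c]%classic)//; congr (integral _ _ _).
  by apply/seteqP; split=> x /=; rewrite !in_itv/=; lra.
rewrite (split _ (2^-1 - b)); [|lra|lra].
rewrite !move_itv subrK.
have -> : (\int[mu]_(x in `]2^-1%R, (2^-1 + b)%R]) f x =
           \int[mu]_(x in `](- 2^-1)%R, (- 2^-1 + b)%R]) f x)%E.
  transitivity (\int[mu]_(x in `](- 2^-1)%R, (- 2^-1 + b)%R]) f (x + 1)%R)%E.
    rewrite move_itv; have -> : - 2^-1 + 1 = 2^-1 :> R by lra.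
    by have -> : - 2^-1 + b + 1 = 2^-1 + b :> R by lra.
  by apply: eq_integral => x _; rewrite -(pf x 1).
have := @split (- 2^-1) (- 2^-1 + b) 2^-1 0.
by rewrite !move_itv !addr0 => ->; [rewrite addeC|lra|lra].
Qed.

End lebesgue_tuple_integral.

(** * The geometry of the torus *)

Section torus.
Context {R : realType}.
Local Notation mu := (@lebesgue_measure R).
Local Notation cell := (`](- 2^-1), 2^-1]%classic : set R).

Lemma integral_torus_shift n (f : n.-tuple R -> \bar R) (b : n.-tuple R) :
  measurable_fun setT f -> (forall t, 0 <= f t)%E ->
  (forall t (z : n.-tuple int),
    f [tuple (tnth t k + (tnth z k)%:~R)%R | k < n] = f t) ->
  (\int[lebesgue_tuple R n]_(t in torus_cell R n)
     f [tuple (tnth t k + tnth b k)%R | k < n] =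
   \int[lebesgue_tuple R n]_(t in torus_cell R n) f t)%E.
Proof.
elim: n f b => [|n IH] f b mf f0 pf.
  apply: eq_integral => t _; congr f.
  by rewrite tuple0; apply/esym; rewrite tuple0.
case/tupleP: b => b0 b.
have madd k (c : k.-tuple R) : measurable_fun setT
    (fun t : k.-tuple R => [tuple (tnth t i + tnth c i)%R | i < k]).
  by apply: (@measurable_fun_tuple_map _ k (fun x i => x + tnth c i)) => i;
    exact: measurable_funD.
rewrite !ge0_integral_torus_cellS//; last exact: (measurableT_comp mf (madd _ _)).
have step x : (\int[lebesgue_tuple R n]_(t in torus_cell R n)
     f [tuple (tnth [tuple of x :: t] k + tnth [tuple of b0 :: b] k)%R | k < n.+1] =
   \int[lebesgue_tuple R n]_(t in torus_cell R n) f [tuple of (x + b0)%R :: t])%E.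
  rewrite -(IH (fun t => f [tuple of (x + b0)%R :: t]) b)//.
  - apply: eq_integral => t _; congr f.
    rewrite (@tuple_map_cons _ n (fun x k => x + tnth [tuple of b0 :: b] k)) tnth0.
    by congr [tuple of _ :: _]; apply: eq_from_tnth => k; rewrite !tnth_mktuple tnthS.
  - exact: measurable_fun_tuple_section.
  - move=> t z; rewrite -[RHS](pf _ [tuple of 0 :: z]); congr f.
    rewrite (@tuple_map_cons _ n (fun x k => x + (tnth [tuple of 0 :: z] k)%:~R)).
    rewrite tnth0 addr0.
    by congr [tuple of _ :: _]; apply: eq_from_tnth => k; rewrite !tnth_mktuple tnthS.
under eq_integral do rewrite step.
rewrite (@integral_periodic_shift _
  (fun x => \int[lebesgue_tuple R n]_(t in torus_cell R n) f [tuple of x :: t])%E)//.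
- pose S := [set t : n.+1.-tuple R | torus_cell R n [tuple of behead t]].
  have mS : measurable S.
    rewrite -[S]setTI.
    exact: (@measurable_behead _ R n measurableT _ (@measurable_torus_cell R n)).
  have SE x (t : n.-tuple R) : S [tuple of x :: t] = torus_cell R n t.
    by rewrite /S/=; congr torus_cell; exact: val_inj.
  rewrite (_ : (fun x => _) = (fun x =>
      \int[lebesgue_tuple R n]_t (f \_ S) [tuple of x :: t])%E); last first.
    apply/funext => x; rewrite integral_mkcond; apply: eq_integral => t _.
    by rewrite !patchE; congr (if _ then _ else _); apply/idP/idP; rewrite !inE SE.
  apply: measurable_fun_tuple_integral.
    by apply/(measurable_restrictT _ _).1 => //; exact: measurable_funTS.
  by move=> t; rewrite patchE; case: ifP.
- by move=> x; apply: integral_ge0.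
- move=> x z; apply: eq_integral => t _.
  rewrite -[RHS](pf _ [tuple of z :: [tuple 0 | k < n]]); congr f.
  rewrite (@tuple_map_cons _ n (fun x k => x + (tnth [tuple of z :: [tuple 0 | k < n]] k)%:~R)).
  rewrite tnth0; congr [tuple of _ :: _].
  by apply: eq_from_tnth => k; rewrite !tnth_mktuple tnthS tnth_mktuple addr0.
Qed.

Lemma measurable_tuple_box n (c : R) :
  measurable ([set t | forall k, `|tnth t k| <= c] : set (n.-tuple R)).
Proof.
rewrite (_ : [set t | _] = \bigcap_(k in [set: 'I_n])
   ((fun t => tnth t k) @^-1` `[- c, c]%classic)).
  apply: fin_bigcap_measurable => // k _; rewrite -[X in measurable X]setTI.
  exact: measurable_tnth.
apply/seteqP; split=> [t ht k _ /=|t ht k].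
  by rewrite in_itv/= -ler_norml; exact: ht.
by have := ht k Logic.I; rewrite /= in_itv/= -ler_norml.
Qed.

Lemma lebesgue_tuple_box_lty n (c : R) :
  (lebesgue_tuple R n [set t | forall k, `|tnth t k| <= c]%R < +oo)%E.
Proof.
elim: n => [|n IH].
  by rewrite /= diracE; case: (_ \in _); rewrite ltry.
rewrite /= /lebesgue_cons /pushforward.
have -> : @cons_pair R n @^-1` [set t | forall k, `|tnth t k| <= c] =
    (`[- c, c]%classic `*` [set t | forall k, `|tnth t k| <= c]).
  apply/seteqP; split=> -[x t]; rewrite /cons_pair/= in_itv/= -ler_norml.
    move=> h; split; first by have := h ord0; rewrite tnth0.
    by move=> k; have := h (lift ord0 k); rewrite tnthS.
  move=> [hx ht] k.
  by case: (unliftP ord0 k) => [j|] ->; rewrite ?tnth0 ?tnthS.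
rewrite product_measure1E//=; last exact: measurable_tuple_box.
apply: lte_mul_pinfty => //.
  by rewrite lebesgue_measure_itv/=; case: ifP.
Qed.

Lemma enorm_ge0 n (t : n.-tuple R) : 0 <= enorm t.
Proof. exact: sqrtr_ge0. Qed.

Lemma enormZ n (a : R) (t : n.-tuple R) :
  0 <= a -> enorm [tuple a * tnth t k | k < n] = a * enorm t.
Proof.
move=> a0; rewrite /enorm -[in RHS](ger0_norm a0) -sqrtr_sqr -sqrtrM ?sqr_ge0//.
rewrite mulr_sumr; congr Num.sqrt; apply: eq_bigr => k _.
by rewrite tnth_mktuple exprMn.
Qed.

Lemma le_tnth_enorm n (t : n.-tuple R) k : `|tnth t k| <= enorm t.
Proof.
rewrite -sqrtr_sqr ler_wsqrtr// (bigD1 k)//= lerDl.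
by apply: sumr_ge0 => i _; exact: sqr_ge0.
Qed.

Lemma measurable_sqrt_sum n (a : R -> R) : measurable_fun setT a ->
  measurable_fun setT (fun t : n.-tuple R => Num.sqrt (\sum_(k < n) a (tnth t k) ^+ 2)).
Proof.
move=> ma.
have ms : measurable_fun [set: R] (@Num.sqrt R).
  by apply: nondecreasing_measurable => // x y xy; exact: ler_wsqrtr.
have msum : measurable_fun setT (fun t : n.-tuple R => \sum_(k < n) a (tnth t k) ^+ 2).
  apply: measurable_sum => k; apply: (measurable_funX 2).
  by apply: measurableT_comp ma _; exact: measurable_tnth.
exact: measurableT_comp ms msum.
Qed.

Lemma measurable_enorm n : measurable_fun setT (@enorm R n).
Proof. by apply: (@measurable_sqrt_sum n id); exact: measurable_id. Qed.

(** [Num.floor (a + 2^-1)] is an integer nearest to [a], so this is the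
    distance from [a] to the integers, the metric of the circle R/Z. *)
Definition circle_norm (a : R) : R := `|a - (Num.floor (a + 2^-1))%:~R|.

Lemma circle_norm_le_half a : circle_norm a <= 2^-1.
Proof.
rewrite /circle_norm; have := floor_le (a + 2^-1).
have := floorD1_gt (a + 2^-1); rewrite intrD => h1 h2.
by rewrite ler_norml; apply/andP; split; lra.
Qed.

Lemma circle_norm_le a (z : int) : circle_norm a <= `|a - z%:~R|.
Proof.
rewrite /circle_norm; set f := Num.floor _.
have [->//|/eqP zf] := eqVneq z f.
have h := circle_norm_le_half a; rewrite /circle_norm -/f in h.
apply: (le_trans h).
have : 1 <= `|z%:~R - f%:~R : R|.
  by rewrite -intrB -intr_norm -[1]/(1%:~R) ler_int; lia.
move=> h1; have := ler_distD a z%:~R f%:~R; rewrite (distrC z%:~R a); lra.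
Qed.

Lemma circle_normN a : circle_norm (- a) = circle_norm a.
Proof.
wlog suff : a / circle_norm (- a) <= circle_norm a.
  by move=> H; apply/eqP; rewrite eq_le H/= -{1}(opprK a) H.
apply: (le_trans (circle_norm_le _ (- Num.floor (a + 2^-1)))).
by rewrite intrN -opprD normrN.
Qed.

Lemma circle_normDz a (z : int) : circle_norm (a + z%:~R) = circle_norm a.
Proof.
wlog suff : a z / circle_norm (a + z%:~R) <= circle_norm a.
  move=> H; apply/eqP; rewrite eq_le H/=.
  by have := H (a + z%:~R) (- z); rewrite intrN addrK.
apply: (le_trans (circle_norm_le _ (Num.floor (a + 2^-1) + z))).
by rewrite intrD opprD addrACA subrr addr0.
Qed.

Lemma circle_normD a b : circle_norm (a + b) <= circle_norm a + circle_norm b.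
Proof.
apply: (le_trans (circle_norm_le _ (Num.floor (a + 2^-1) + Num.floor (b + 2^-1)))).
by rewrite intrD opprD addrACA; exact: ler_normD.
Qed.

Lemma circle_norm_cell a : - 2^-1 < a <= 2^-1 -> circle_norm a = `|a|.
Proof.
move=> /andP[a1 a2]; apply/eqP; rewrite eq_le.
have := circle_norm_le a 0; rewrite subr0 => -> /=.
rewrite /circle_norm; set f := Num.floor _.
have := floor_le (a + 2^-1); have := floorD1_gt (a + 2^-1); rewrite -/f intrD => h1 h2.
have [f0|f0|->] := ltgtP f 0; last by rewrite subr0.
- have : f%:~R <= (-1)%:~R :> R by rewrite ler_int; lia.
  rewrite intrN => f1; lra.
- have : 1%:~R <= f%:~R :> R by rewrite ler_int; lia.
  by move=> f1; rewrite ger0_norm ?ler0_norm; lra.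
Qed.

Lemma measurable_circle_norm : measurable_fun setT circle_norm.
Proof.
apply: measurableT_comp => //; apply: measurable_funB => //.
have mfl : measurable_fun [set: R] (fun x : R => (Num.floor x)%:~R : R).
  by apply: nondecreasing_measurable => // x y xy; rewrite ler_int le_floor.
apply: (measurableT_comp mfl); exact: measurable_funD.
Qed.

Definition torus_norm n (t : n.-tuple R) : R :=
  Num.sqrt (\sum_(k < n) circle_norm (tnth t k) ^+ 2).

Lemma measurable_torus_norm n : measurable_fun setT (@torus_norm n).
Proof. exact: measurable_sqrt_sum measurable_circle_norm. Qed.

(** The infimum over the integer lattice is attained coordinatewise, at the
    nearest integer. *)
Lemma torus_distE n (x y : n.-tuple R) :
  torus_dist x y = torus_norm [tuple tnth x k - tnth y k | k < n].
Proof.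
rewrite /torus_dist; set S := (X in inf X).
pose z := [tuple Num.floor (tnth x k - tnth y k + 2^-1) | k < n].
have Sz : S (torus_norm [tuple tnth x k - tnth y k | k < n]).
  exists z => //; rewrite /enorm /torus_norm; congr Num.sqrt.
  by apply: eq_bigr => k _; rewrite !tnth_mktuple /circle_norm real_normK// num_real.
have lbS : lbound S (torus_norm [tuple tnth x k - tnth y k | k < n]).
  move=> _ [t _ <-]; apply: ler_wsqrtr; apply: ler_sum => k _.
  rewrite !tnth_mktuple -[leRHS]real_normK ?num_real//.
  by rewrite lerXn2r ?nnegrE// ?normr_ge0// circle_norm_le.
apply/eqP; rewrite eq_le; apply/andP; split.
  by apply: ge_inf Sz; exists (torus_norm [tuple tnth x k - tnth y k | k < n]).
by apply: lb_le_inf => //; exists (torus_norm [tuple tnth x k - tnth y k | k < n]).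
Qed.

Lemma torus_distC n (x y : n.-tuple R) : torus_dist x y = torus_dist y x.
Proof.
rewrite !torus_distE /torus_norm; congr Num.sqrt; apply: eq_bigr => k _.
by rewrite !tnth_mktuple -circle_normN opprB.
Qed.

Lemma torus_dist_ge0 n (x y : n.-tuple R) : 0 <= torus_dist x y.
Proof. by rewrite torus_distE sqrtr_ge0. Qed.

(** A triangle inequality up to a factor [sqrt n], which comes from
    applying the one of the circle to each coordinate; the factor only changes
    the volume of a ball by a constant. *)
Lemma torus_dist_common n (x y z : n.-tuple R) (a : R) :
  torus_dist x z <= a -> torus_dist y z <= a ->
  torus_dist x y <= Num.sqrt n%:R * (2 * a).
Proof.
move=> xz yz; have a0 : 0 <= a := le_trans (torus_dist_ge0 x z) xz.
have coord (u v : n.-tuple R) k : circle_norm (tnth u k - tnth v k) <= torus_dist u v.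
  rewrite torus_distE -[circle_norm _]normr_id -sqrtr_sqr ler_wsqrtr//.
  rewrite (bigD1 k)//= tnth_mktuple lerDl.
  by apply: sumr_ge0 => i _; exact: sqr_ge0.
have <- : Num.sqrt ((2 * a) ^+ 2) = 2 * a by rewrite sqrtr_sqr ger0_norm ?mulr_ge0.
rewrite torus_distE -sqrtrM ?ler0n//.
rewrite ler_wsqrtr// mulr_natl -[X in _ *+ X]card_ord -sumr_const.
apply: ler_sum => k _; rewrite tnth_mktuple lerXn2r ?nnegrE ?normr_ge0 ?mulr_ge0//.
have -> : tnth x k - tnth y k = (tnth x k - tnth z k) + - (tnth y k - tnth z k) by ring.
apply: (le_trans (circle_normD _ _)); rewrite circle_normN.
have := coord x z k; have := coord y z k; lra.
Qed.

Lemma measurable_torus_dist n d (T : measurableType d) (f h : T -> n.-tuple R) :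
  measurable_fun setT f -> measurable_fun setT h ->
  measurable_fun setT (fun w => torus_dist (f w) (h w)).
Proof.
move=> mf mh.
rewrite (_ : (fun w => _) = @torus_norm n \o
   (fun w => [tuple tnth (f w) k - tnth (h w) k | k < n])); last first.
  by apply/funext => w; rewrite torus_distE.
apply: measurableT_comp (@measurable_torus_norm n) _.
apply/measurable_fun_tnthP => i.
rewrite (_ : _ \o _ = (fun w => tnth (f w) i - tnth (h w) i)); last first.
  by apply/funext => w /=; rewrite tnth_mktuple.
by apply: measurable_funB; apply: (measurableT_comp (measurable_tnth i)).
Qed.

(** The torus is homogeneous: a translation moves [x] to the origin, and inside
    the cell the distance to the origin is the Euclidean norm. *)
Lemma integral_torus_dist n (k : R -> R) (x : n.-tuple R) :
  measurable_fun setT k -> (forall u, 0 <= k u) ->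
  (\int[lebesgue_tuple R n]_(y in torus_cell R n) (k (torus_dist x y))%:E =
   \int[lebesgue_tuple R n]_(y in torus_cell R n) (k (enorm y))%:E)%E.
Proof.
move=> mk k0.
transitivity (\int[lebesgue_tuple R n]_(y in torus_cell R n) (k (torus_norm y))%:E)%E.
  rewrite -(@integral_torus_shift n (fun y => (k (torus_norm y))%:E)
    [tuple - tnth x k | k < n]).
  - apply: eq_integral => y _; rewrite torus_distC torus_distE; congr (k (torus_norm _))%:E.
    by apply: eq_from_tnth => i; rewrite !tnth_mktuple.
  - by apply/measurable_EFinP; apply: measurableT_comp mk _; exact: measurable_torus_norm.
  - by move=> t; rewrite lee_fin.
  - move=> t z; congr (k _)%:E; rewrite /torus_norm; congr Num.sqrt.
    by apply: eq_bigr => i _; rewrite tnth_mktuple circle_normDz.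
apply: eq_integral => y /set_mem yS; congr (k (Num.sqrt _))%:E.
apply: eq_bigr => i _; rewrite circle_norm_cell; last exact: yS.
by rewrite real_normK ?num_real.
Qed.

Lemma integral_enorm_scale n (k : R -> R) (r : R) :
  0 < r -> measurable_fun setT k -> (forall u, 0 <= k u) ->
  (\int[lebesgue_tuple R n]_y (k (enorm y / r))%:E =
   (r ^+ n)%:E * \int[lebesgue_tuple R n]_y (k (enorm y))%:E)%E.
Proof.
move=> r0 mk k0.
rewrite (ge0_integral_scale_tuple r0)//; first last.
- by move=> t; rewrite lee_fin.
- apply/measurable_EFinP; apply: measurableT_comp mk _.
  by apply: measurable_funM => //; exact: measurable_enorm.
congr (_ * _)%E; apply: eq_integral => t _.
by rewrite enormZ ?ltW// mulrAC divff ?mul1r// gt_eqF.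
Qed.

End torus.

(** * Independence of blocks of random variables *)

Section block_independence.
Context {dO} {Omega : measurableType dO} {R : realType}.
Variable P : probability Omega R.
Implicit Types (A B : set Omega) (G : set_system Omega).

Definition indep_events A B := P (A `&` B) = (P A * P B)%E.

(** For fixed [B] both sides of the product rule are finite measures in [A], so
    their agreement extends from a pi-system to the generated sigma-algebra. *)
Lemma indep_generated G B : G `<=` measurable -> measurable B ->
  G setT -> setI_closed G ->
  (forall A, G A -> indep_events A B) -> forall A, <<s G >> A -> indep_events A B.
Proof.
move=> Gm mB GT GI GB A sA; rewrite /indep_events.
have PB0 : 0 <= fine (P B) by rewrite fine_ge0.
pose m1 : {measure set Omega -> \bar R} := mrestr P mB.
pose m2 : {measure set Omega -> \bar R} := mscale (NngNum PB0) P.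
have m2E C : m2 C = (P C * P B)%E.
  by rewrite /m2 /= /mscale/= fineK ?fin_num_measure// muleC.
rewrite -m2E.
apply: (g_sigma_algebra_measure_unique G Gm (fun=> setT) _ _ m1 m2) => //.
- by rewrite bigcup_const//; exists 0%N.
- by move=> C GC; rewrite m2E; exact: GB.
- by move=> _; rewrite /m1/= /mrestr setTI (le_lt_trans (probability_le1 _ _))// ltry.
Qed.

(** The pi-system that generates the sigma-algebra of the block [C]. *)
Definition finite_meets (I : choiceType) (C : set I) (F : I -> set_system Omega) :
    set_system Omega :=
  [set A | exists J : {fset I}, exists2 E : I -> set Omega,
     (forall i, i \in J -> C i /\ F i (E i)) & A = \bigcap_(i in [set` J]) E i].

Lemma finite_meetsI (I : choiceType) (C : set I) (F : I -> set_system Omega) :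
  (forall i, F i setT) -> (forall i, setI_closed (F i)) ->
  setI_closed (finite_meets C F).
Proof.
move=> FT FI _ _ [J [E JE ->]] [J' [E' JE' ->]].
exists (J `|` J')%fset.
pose Ex (K : {fset I}) (D : I -> set Omega) i := if i \in K then D i else setT.
exists (fun i => Ex J E i `&` Ex J' E' i).
  move=> i; rewrite in_fsetU => iJJ; split.
    by case/orP : iJJ => [/JE[]|/JE'[]].
  by apply: FI; rewrite /Ex; case: ifPn => //; [case/JE|case/JE'].
apply/seteqP; split=> [w [h h'] i _|w h].
  by split; rewrite /Ex; case: ifPn => // iJ; [exact: h|exact: h'].
split=> i /= iJ; have /= := h i; rewrite in_fsetU iJ ?orbT => /(_ isT).
  by case; rewrite /Ex iJ.
by case=> _; rewrite /Ex iJ.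
Qed.

Lemma indep_block1 (I : choiceType) (D C : set I) (F : I -> set_system Omega) b B :
  mutually_independent P D F ->
  (forall i, F i `<=` measurable) ->
  (forall i, F i setT) -> (forall i, setI_closed (F i)) ->
  C `<=` D -> D b -> ~ C b -> F b B ->
  forall A, <<s \bigcup_(i in C) F i >> A -> indep_events A B.
Proof.
move=> PF Fm FT FI CD Db Cb FB A sA.
apply: (@indep_generated (finite_meets C F)).
- move=> _ [J [E JE ->]]; apply: fin_bigcap_measurable => // i /JE[_]; exact: Fm.
- exact: Fm FB.
- by exists fset0, (fun=> setT) => //; rewrite bigcapT.
- exact: finite_meetsI.
- move=> _ [J [E JE ->]].
  have bJ : b \notin J by apply/negP => /JE[].
  have JD : [set` J] `<=` D by move=> i /JE[/CD].
  have := PF (b |` J)%fset (fun i => if i == b then B else E i).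
  rewrite big_fsetU1//= eqxx => H; rewrite /indep_events.
  have -> : (\bigcap_(i in [set` J]) E i) `&` B =
      \bigcap_(i in [set` (b |` J)%fset]) (if i == b then B else E i).
    apply/seteqP; split=> [w [h Bw] i /=|w h].
      rewrite in_fset1U; case: eqVneq => // _ /=; exact: h.
    split=> [i /= iJ|]; last by have := h b; rewrite eqxx; apply; rewrite /= in_fset1U eqxx.
    have := h i; rewrite /= in_fset1U iJ orbT => /(_ isT).
    by case: eqP => // ib; move: bJ; rewrite -ib iJ.
  rewrite H.
  + rewrite muleC; congr (_ * _)%E; rewrite (PF J E)//; last by move=> i /JE[].
    rewrite big_seq [RHS]big_seq; apply: eq_bigr => i iJ.
    by case: eqP => // ib; move: bJ; rewrite -ib iJ.
  + by move=> i /=; rewrite in_fset1U => /orP[/eqP->//|/JD].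
  + by move=> i /=; rewrite in_fset1U; case: eqP => [->//|_ /= /JE[]].
- move: A sA; apply: smallest_sub; first exact: smallest_sigma_algebra.
  move=> E [i Ci FE]; apply: sub_sigma_algebra.
  exists [fset i]%fset, (fun=> E) => [j|]; first by rewrite inE => /eqP ->.
  by rewrite set_fset1 bigcap_set1.
Qed.

(** Events [A1 `&` A2], with [A1] in the block of the first family and [A2] in
    that of the second, form a pi-system generating the joint block.  The
    independence of the two families splits off [A2], and then [indep_block1]
    separates [A1] from [B]. *)
Lemma indep_block2 (I1 I2 : choiceType) (D1 C1 : set I1) (D2 C2 : set I2)
    (F1 : I1 -> set_system Omega) (F2 : I2 -> set_system Omega) b B :
  mutually_independent P D1 F1 ->
  (forall i, F1 i `<=` measurable) -> (forall i, F2 i `<=` measurable) ->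
  (forall i, F1 i setT) -> (forall i, setI_closed (F1 i)) ->
  (forall A1 A2, <<s \bigcup_(i in D1) F1 i >> A1 ->
     <<s \bigcup_(i in D2) F2 i >> A2 -> indep_events A1 A2) ->
  C1 `<=` D1 -> C2 `<=` D2 -> D1 b -> ~ C1 b -> F1 b B ->
  forall A, <<s (\bigcup_(i in C1) F1 i) `|` (\bigcup_(i in C2) F2 i) >> A ->
  indep_events A B.
Proof.
move=> PF1 F1m F2m F1T F1I PF12 CD1 CD2 Db Cb FB A sA.
have sub I (C D : set I) (F : I -> set_system Omega) : C `<=` D ->
    <<s \bigcup_(i in C) F i >> `<=` <<s \bigcup_(i in D) F i >>.
  by move=> CD; apply: sub_sigma_algebra2; exact: bigcup_subset.
have meas I (C : set I) (F : I -> set_system Omega) : (forall i, F i `<=` measurable) ->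
    <<s \bigcup_(i in C) F i >> `<=` measurable.
  move=> Fm; apply: smallest_sub; first exact: sigma_algebra_measurable.
  by move=> E [i _ /Fm].
set G1 := \bigcup_(i in C1) F1 i in sA; set G2 := \bigcup_(i in C2) F2 i in sA.
have B1 : <<s \bigcup_(i in D1) F1 i >> B by apply: sub_sigma_algebra; exists b.
apply: (@indep_generated [set A | exists A1, <<s G1 >> A1 /\
    exists A2, <<s G2 >> A2 /\ A = A1 `&` A2]).
- by move=> _ [A1 [sA1 [A2 [sA2 ->]]]]; apply: measurableI; [exact: meas sA1|exact: meas sA2].
- exact: F1m FB.
- exists setT; split; first exact: (@measurableT _ (g_sigma_algebraType G1)).
  exists setT; split; first exact: (@measurableT _ (g_sigma_algebraType G2)).
  by rewrite setIT.
- move=> _ _ [A1 [sA1 [A2 [sA2 ->]]]] [A1' [sA1' [A2' [sA2' ->]]]].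
  exists (A1 `&` A1'); split; first exact: (@measurableI _ (g_sigma_algebraType G1)).
  exists (A2 `&` A2'); split; first exact: (@measurableI _ (g_sigma_algebraType G2)).
  by rewrite setIACA.
- move=> _ [A1 [sA1 [A2 [sA2 ->]]]]; rewrite /indep_events.
  have sA1D := sub _ _ _ _ CD1 _ sA1; have sA2D := sub _ _ _ _ CD2 _ sA2.
  rewrite setIAC (PF12 (A1 `&` B) A2)//; last first.
    exact: (@measurableI _ (g_sigma_algebraType (\bigcup_(i in D1) F1 i))).
  rewrite (@indep_block1 _ D1 C1 F1 b B)// (PF12 A1 A2)//.
  by rewrite -!muleA (muleC (P B)).
- move: A sA; apply: smallest_sub; first exact: smallest_sigma_algebra.
  move=> E [GE|GE]; apply: sub_sigma_algebra.
    exists E; split; first exact: sub_sigma_algebra.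
    exists setT; split; first exact: (@measurableT _ (g_sigma_algebraType G2)).
    by rewrite setIT.
  exists setT; split; first exact: (@measurableT _ (g_sigma_algebraType G1)).
  exists E; split; first exact: sub_sigma_algebra.
  by rewrite setTI.
Qed.

End block_independence.

(** * Averaging out an independent variable *)

Section freezing_product.
Context {dO} {Omega : measurableType dO} {R : realType} (P : probability Omega R).
Context {d1 d2} {T1 : measurableType d1} {T2 : measurableType d2}.
Local Open Scope ereal_scope.

Lemma integral_indep (Z : {RV P >-> T1}) (Y : {RV P >-> T2}) (f : T1 * T2 -> \bar R) :
  (forall B1 B2, measurable B1 -> measurable B2 ->
     indep_events P (Z @^-1` B1) (Y @^-1` B2)) ->
  measurable_fun setT f -> (forall z, 0 <= f z) ->
  \int[P]_w f (Z w, Y w) = \int[P]_w \int[distribution P Y]_y f (Z w, y).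
Proof.
move=> ZY mf f0.
have mZY : measurable_fun setT (fun w => (Z w, Y w)).
  by apply: measurable_fun_pair; exact: measurable_funPT.
pose m := (pushforward P (fun w => (Z w, Y w)) :
  {measure set (T1 * T2) -> \bar R}).
transitivity (\int[m mZY]_z f z).
  by rewrite ge0_integral_pushforward.
rewrite (@eq_measure_integral _ _ _ _ (distribution P Z \x distribution P Y)); last first.
  by move=> A mA _; apply/esym/product_measure_unique.
rewrite fubini_tonelli1// /fubini_F.
rewrite ge0_integral_distribution//.
- exact: measurable_fun_fubini_tonelli_F.
- by move=> z; exact: integral_ge0.
Qed.

End freezing_product.

Section freezing.
Context {dO} {Omega : measurableType dO} {R : realType} (P : probability Omega R).
Context {d1 d2} {T1 : measurableType d1} {T2 : measurableType d2}.
Local Open Scope ereal_scope.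

(** Conditionally on a sigma-algebra independent of [Y], the quantities
    measurable for that sigma-algebra can be treated as constants while [Y] is
    averaged out: the pair of [Z] and the indicator of [A] is one variable
    independent of [Y], to which Fubini's theorem applies. *)
Lemma integral_freeze (G : set_system Omega) (A : set Omega) (Z : {RV P >-> T1})
    (Y : {RV P >-> T2}) (f : T1 * T2 -> \bar R) :
  G `<=` measurable ->
  (forall A B, <<s G >> A -> measurable B -> indep_events P A (Y @^-1` B)) ->
  <<s G >> A ->
  measurable_fun (setT : set (g_sigma_algebraType G)) (Z : g_sigma_algebraType G -> T1) ->
  measurable_fun setT f -> (forall z, 0 <= f z) ->
  \int[P]_(w in A) f (Z w, Y w) =
  \int[P]_(w in A) \int[distribution P Y]_y f (Z w, y).
Proof.
move=> Gm GY sA mZ mf f0.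
have sub : <<s G >> `<=` measurable.
  by apply: smallest_sub => //; exact: sigma_algebra_measurable.
have mA : measurable A := sub _ sA.
pose W w : measurableTypeR R * T1 := ((\1_A w)%R, Z w).
have mW : measurable_fun setT (W : g_sigma_algebraType G -> _).
  exact: measurable_fun_pair.
have mW' : measurable_fun setT W.
  by move=> _ B mB; apply: sub; apply: mW.
pose W_ := isMeasurableFun.Build _ _ _ _ _ mW'.
pose WR : {RV P >-> (measurableTypeR R * T1)%type} := HB.pack W W_.
pose f' (z : (measurableTypeR R * T1) * T2) := (`|z.1.1|)%:E * f (z.1.2, z.2).
have mf' : measurable_fun setT f'.
  apply: emeasurable_funM.
    apply/measurable_EFinP; apply: measurableT_comp => //.
    by apply: (measurableT_comp measurable_fst); exact: measurable_fst.
  apply: (measurableT_comp mf); apply: measurable_fun_pair => //.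
  by apply: (measurableT_comp measurable_snd); exact: measurable_fst.
have f'0 z : 0 <= f' z by rewrite mule_ge0.
have WY B1 B2 : measurable B1 -> measurable B2 ->
    indep_events P (WR @^-1` B1) (Y @^-1` B2).
  move=> mB1 mB2; apply: GY => //.
  by have := mW measurableT _ mB1; rewrite setTI.
have H : \int[P]_w f' (WR w, Y w) = \int[P]_w \int[distribution P Y]_y f' (WR w, y).
  exact: integral_indep.
rewrite integral_mkcond [RHS]integral_mkcond.
rewrite (eq_integral (fun w => f' (WR w, Y w))); last first.
  move=> w _; rewrite patchE /f' /= indicE.
  by case: ifPn => _; rewrite ?normr1 ?mul1e// normr0 mul0e.
rewrite H; apply: eq_integral => w _; rewrite patchE /f' /= indicE.
case: ifPn => _.
  by apply: eq_integral => y _; rewrite normr1 mul1e.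
by rewrite integral0_eq// => y _; rewrite normr0 mul0e.
Qed.

End freezing.

Section uniform_marks.
Context {R : realType}.

Lemma uniform_prob_itv0 (c : R) : 0 <= c <= 1 ->
  uniform_prob (@ltr01 R) `]-oo, c] = c%:E.
Proof.
move=> /andP[c0 c1].
rewrite /uniform_prob integral_uniform_pdf.
rewrite (_ : `]-oo, c]%classic `&` `[0, 1]%classic = `[0, c]%classic); last first.
  by apply/seteqP; split=> x /=; rewrite !in_itv/=; [move=> []|]; lra.
rewrite (eq_integral (cst 1%E)); last first.
  move=> x; rewrite inE/= in_itv/= /uniform_pdf => /andP[x0 xc].
  by rewrite x0 (le_trans xc c1)/= subr0 invr1.
by rewrite integral_cst//= mul1e lebesgue_measure_itv/= lte_fin sube0; case: ltgtP c0 => // <-.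
Qed.

End uniform_marks.

(** * Tails of the binomial law *)

Section binomial_tail.
Context {R : realType}.

(** The probability of at least [s] successes in [M] independent trials, each
    successful with probability [p], by conditioning on one trial.  This is the
    recursion that arises when the vertices of a graph are revealed one at a
    time. *)
Fixpoint btail (p : R) (M s : nat) : R :=
  if s isn't s'.+1 then 1 else
  if M isn't M'.+1 then 0 else p * btail p M' s' + (1 - p) * btail p M' s.

Lemma btail0 p M : btail p M 0 = 1. Proof. by case: M. Qed.

Lemma btail_ge0 p M s : 0 <= p <= 1 -> 0 <= btail p M s.
Proof.
move=> /andP[p0 p1]; elim: M s => [|M IH] [|s] //=.
by rewrite addr_ge0// mulr_ge0// subr_ge0.
Qed.

Lemma btail_le1 p M s : 0 <= p <= 1 -> btail p M s <= 1.
Proof.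
move=> /andP[p0 p1]; elim: M s => [|M IH] [|s] //=.
have := IH s; have := IH s.+1; nra.
Qed.

Lemma btail_nonincr p M s : 0 <= p <= 1 -> btail p M s.+1 <= btail p M s.
Proof.
move=> p01; elim: M s => [|M IH] [|s] //=.
  by have := btail_le1 M.+1 1 p01; rewrite /= btail0.
have := IH s; have := IH s.+1; case/andP: p01; nra.
Qed.

(** Chernoff's bound.  Each trial multiplies the exponential moment by
    [1 + p * (theta - 1)], which is at most its exponential. *)
Lemma btail_le_expR (p theta : R) M s : 0 <= p <= 1 -> 1 <= theta ->
  btail p M s <= theta ^- s * expR (M%:R * p * (theta - 1)).
Proof.
move=> /andP[p0 p1] t1.
have t0 : 0 < theta by lra.
have m0 : 0 <= p * (theta - 1) by rewrite mulr_ge0// subr_ge0.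
elim: M s => [|M IH] [|s] /=.
- by rewrite expr0 invr1 !mul0r expR0 mulr1.
- by rewrite mulr_ge0// ?expR_ge0// invr_ge0 exprn_ge0// ltW.
- by rewrite expr0 invr1 mul1r -mulrA -[leLHS]expR0 ler_expR mulr_ge0.
have e0 := expR_ge0 (M%:R * p * (theta - 1)).
apply: (@le_trans _ _ (p * (theta ^- s * expR (M%:R * p * (theta - 1))) +
   (1 - p) * (theta ^- s.+1 * expR (M%:R * p * (theta - 1))))).
  by rewrite lerD// ler_wpM2l// subr_ge0.
have -> : p * (theta ^- s * expR (M%:R * p * (theta - 1))) +
   (1 - p) * (theta ^- s.+1 * expR (M%:R * p * (theta - 1))) =
   theta ^- s.+1 * (expR (M%:R * p * (theta - 1)) * (1 + p * (theta - 1))).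
  rewrite exprS; field; rewrite ?expf_neq0 ?gt_eqF//.
rewrite ler_wpM2l ?invr_ge0 ?exprn_ge0 ?(ltW t0)//.
have -> : M.+1%:R * p * (theta - 1) = M%:R * p * (theta - 1) + p * (theta - 1).
  by rewrite -natr1; ring.
by rewrite expRD ler_wpM2l// expR_ge1Dx.
Qed.

(** The tail contains the event of exactly [s] successes; the induction is
    Pascal's rule. *)
Lemma btail_ge_binomial (p : R) M s : 0 <= p <= 1 ->
  'C(M, s)%:R * p ^+ s * (1 - p) ^+ (M - s) <= btail p M s.
Proof.
move=> /andP[p0 p1]; have q0 : 0 <= 1 - p by rewrite subr_ge0.
elim: M s => [|M IH] [|s].
- by rewrite bin0 !expr0 !mulr1.
- by rewrite bin0n /= !mul0r.
- by rewrite bin0 expr0 !mul1r btail0 subn0 exprn_ile1// gerBl.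
rewrite binS natrD /= subSS.
have h1 : p * ('C(M, s)%:R * p ^+ s * (1 - p) ^+ (M - s)) <= p * btail p M s.
  by rewrite ler_wpM2l.
have h2 : 'C(M, s.+1)%:R * p ^+ s.+1 * (1 - p) ^+ (M - s) <= (1 - p) * btail p M s.+1.
  have [Ms|sM] := leqP M s.
    by rewrite bin_small ?ltnS// mulr0n !mul0r mulr_ge0// btail_ge0// p0.
  have -> : (M - s = (M - s.+1).+1)%N by lia.
  by rewrite [(1 - p) ^+ _]exprS mulrCA ler_wpM2l.
have := lerD h1 h2; apply: le_trans; rewrite le_eqVlt; apply/orP; left; apply/eqP.
by rewrite exprS; ring.
Qed.

Lemma exp_subn_le_ffact M s : ((M - s) ^ s <= M ^_ s)%N.
Proof.
elim: s M => [|s IH] M; first by rewrite expn0 ffactn0.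
case: M => [|M]; first by rewrite sub0n exp0n.
rewrite subSS expnS ffactSS; apply: leq_mul; last exact: IH.
by rewrite (leq_trans (leq_subr _ _)).
Qed.

(** Stirling's formula up to a factor of order [sqrt s], which disappears at the
    logarithmic scale. *)
Lemma fact_le_stirling s : (0 < s)%N ->
  s`!%:R <= s%:R ^+ s.+1 * expR (1 - s%:R) :> R.
Proof.
case: s => // s _; elim: s => [|s IH].
  by rewrite factS fact0 muln1 expr1n subrr expR0 mulr1.
rewrite factS natrM.
have s0 : 0 < s.+1%:R :> R by rewrite ltr0n.
have s20 : 0 < s.+2%:R :> R by rewrite ltr0n.
apply: (@le_trans _ _ (s.+2%:R * (s.+1%:R ^+ s.+2 * expR (1 - s.+1%:R)))).
  by rewrite ler_wpM2l// ltW.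
rewrite [in leRHS]exprS -mulrA ler_pM2l//.
have -> : 1 - s.+2%:R = (1 - s.+1%:R) - 1 :> R by rewrite -(natr1 s.+1); ring.
rewrite [expR (1 - _ - 1)]expRD [leRHS]mulrCA [leLHS]mulrC ler_pM2l ?expR_gt0//.
(* The ratio of consecutive bounds is (1 + 1/n)^(n+1) >= e. *)
have h : expR (s.+2%:R^-1) * s.+1%:R <= s.+2%:R :> R.
  have h1 : 1 - s.+2%:R^-1 <= expR (- s.+2%:R^-1) :> R by rewrite expR_ge1Dx.
  have h2 : s.+1%:R = s.+2%:R * (1 - s.+2%:R^-1) :> R.
    by rewrite mulrBr mulr1 divff ?gt_eqF// -(natr1 s.+1); ring.
  rewrite h2 mulrCA -[leRHS]mulr1 ler_pM2l//.
  have := ler_wpM2l (expR_ge0 (s.+2%:R^-1)) h1.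
  by rewrite -expRD subrr expR0.
have h3 : (expR (s.+2%:R^-1) * s.+1%:R) ^+ s.+2 <= s.+2%:R ^+ s.+2 :> R.
  rewrite lerXn2r ?nnegrE ?mulr_ge0 ?expR_ge0//; exact: ltW.
rewrite exprMn -expRM_natl divff ?gt_eqF// in h3.
rewrite -(ler_pM2l (expR_gt0 1)) [leRHS]mulrCA -expRD subrr expR0 mulr1.
exact: h3.
Qed.

(** The tail is at least one binomial probability, and by Stirling's formula
    that is close to a Poisson probability.  Here [rho] is a lower bound for the
    ratio of the mean to [s], so that the exponent is close to minus the mean
    times [rateH] of the inverse ratio. *)
Lemma btail_ge_expR (p rho : R) M s : 0 <= p < 1 -> (0 < s)%N -> (s <= M)%N -> 0 < rho ->
  rho * s%:R <= (M%:R - s%:R) * p ->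
  expR (s%:R * ln rho + s%:R - 1 - ln s%:R - M%:R * p / (1 - p)) <= btail p M s.
Proof.
move=> /andP[p0 p1] s0 sM r0 hr.
have sR : 0 < s%:R :> R by rewrite ltr0n.
have q0 : 0 < 1 - p by rewrite subr_gt0.
have p01 : 0 <= p <= 1 by rewrite p0 ltW.
apply: le_trans (btail_ge_binomial M s p01).
have fs : 0 < s`!%:R :> R by rewrite ltr0n fact_gt0.
have hC : (M%:R - s%:R) ^+ s / s`!%:R <= 'C(M, s)%:R :> R.
  rewrite ler_pdivrMr// -natrM bin_ffact -natrB// -natrX ler_nat.
  exact: exp_subn_le_ffact.
have hq : expR (- (M%:R * p / (1 - p))) <= (1 - p) ^+ (M - s).
  apply: (@le_trans _ _ ((1 - p) ^+ M)).
    have -> : - (M%:R * p / (1 - p)) = M%:R * - (p / (1 - p)) by ring.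
    rewrite expRM_natl lerXn2r ?nnegrE ?expR_ge0 ?(ltW q0)//.
    rewrite expRN -[leRHS]invrK lef_pV2 ?posrE ?invr_gt0 ?expR_gt0//.
    apply: le_trans (expR_ge1Dx _).
    by rewrite le_eqVlt; apply/orP; left; apply/eqP; field; rewrite gt_eqF.
  by rewrite ler_wiXn2l ?(ltW q0) ?gerBl// leq_subr.
have hp : (rho * s%:R) ^+ s <= ((M%:R - s%:R) * p) ^+ s.
  by rewrite lerXn2r ?nnegrE ?mulr_ge0 ?subr_ge0 ?ler_nat// ltW.
apply: (@le_trans _ _ (((rho * s%:R) ^+ s / s`!%:R) * expR (- (M%:R * p / (1 - p))))).
  rewrite expRD; apply: ler_wpM2r; first exact: expR_ge0.
  apply: (@le_trans _ _ ((rho * s%:R) ^+ s / (s%:R ^+ s.+1 * expR (1 - s%:R)))).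
    rewrite le_eqVlt; apply/orP; left; apply/eqP.
    have -> : s%:R * ln rho + s%:R - 1 - ln s%:R = s%:R * ln rho - (1 - s%:R) - ln s%:R by ring.
    rewrite !expRB expRM_natl !lnK ?posrE// exprMn exprS.
    by field; rewrite ?expf_neq0 ?gt_eqF ?expR_gt0.
  rewrite ler_wpM2l ?exprn_ge0 ?mulr_ge0 ?(ltW r0)//.
  rewrite lef_pV2 ?posrE//; last by rewrite mulr_gt0 ?exprn_gt0 ?expR_gt0.
  exact: fact_le_stirling.
apply: ler_pM => //; first by rewrite divr_ge0 ?exprn_ge0 ?mulr_ge0 ?(ltW r0)// ltW.
apply: (@le_trans _ _ (((M%:R - s%:R) * p) ^+ s / s`!%:R)).
  by rewrite ler_pM2r ?invr_gt0.
by rewrite exprMn mulrAC ler_wpM2r// exprn_ge0.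
Qed.

End binomial_tail.

(** * The rate function and its inverse *)

Section rate_function.
Context {R : realType}.
Implicit Types x y v : R.

Lemma rateHE x : 0 < x -> rateH x = 1 - x + x * ln x.
Proof. by move=> x0; rewrite /rateH gt_eqF. Qed.

(** This is [1 + t < exp t] at [t = - ln x]. *)
Lemma rateH_gt0 x : 0 < x -> x != 1 -> 0 < rateH x.
Proof.
move=> x0 x1; rewrite rateHE//.
have l0 : - ln x != 0 by rewrite oppr_eq0 ln_eq0.
have := expR_gt1Dx l0; rewrite expRN lnK ?posrE// => h.
have := h; rewrite -(ltr_pM2l x0) divff ?gt_eqF//; lra.
Qed.

(** By [1 + t < exp t] at [t = ln (x / y)], the tangent of [rateH] at [x] lies
    below its graph, and its slope there is [ln x]. *)
Lemma rateH_increasing x y : 1 <= x -> x < y -> rateH x < rateH y.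
Proof.
move=> x1 xy; have x0 : 0 < x by lra. have y0 : 0 < y by lra.
rewrite !rateHE//.
have xy0 : 0 < x / y by rewrite divr_gt0.
have l0 : ln (x / y) != 0.
  by rewrite ln_eq0// lt_eqF// ltr_pdivrMr// mul1r.
have := expR_gt1Dx l0; rewrite lnK ?posrE// ln_div ?posrE// => h.
have {h} : y * (1 + (ln x - ln y)) < x.
  by move: h; rewrite -(ltr_pM2l y0) mulrCA divff ?gt_eqF// mulr1.
have := ln_ge0 x1; nra.
Qed.

Lemma rateH1 : rateH 1 = 0 :> R.
Proof. by rewrite rateHE// ln1 mulr0 addr0 subrr. Qed.

Lemma rateH_surj v : 0 <= v -> exists2 x, 1 <= x & rateH x = v.
Proof.
move=> v0; pose B := expR 2 + v.
have e2 := expR_ge1Dx (2 : R).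
have B1 : 1 <= B by rewrite /B; lra.
have B0 : 0 < B by lra.
have lnB : 2 <= ln B.
  by rewrite -[leLHS]expRK ler_ln ?posrE ?expR_gt0// /B lerDl.
have HB : v <= rateH B.
  by rewrite rateHE//; have := ler_wpM2l (ltW B0) lnB; rewrite /B in B0 B1 lnB *; lra.
have [||c] := @IVT R (fun x => 1 - x + x * ln x) 1 B v B1.
- apply/continuous_in_subspaceT => x; rewrite inE/= in_itv/= => /andP[x1 _].
  have cln : {for x, continuous (@ln R)} by apply: continuous_ln; lra.
  apply: (@continuousD _ _ _ (fun x : R => 1 - x) (fun x => x * ln x)).
    by apply: continuousB; [exact: cvg_cst|exact: cvg_id].
  by apply: (@continuousM _ _ (fun x : R => x) (@ln R)); first exact: cvg_id.
- rewrite -!rateHE// rateH1 ge_min v0/= le_max HB orbT//.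
- by rewrite in_itv/= => /andP[c1 _] <-; exists c => //; rewrite rateHE//; lra.
Qed.

Lemma rateH_invP v : 0 <= v -> 1 <= rateH_inv v /\ rateH (rateH_inv v) = v.
Proof.
move=> v0; have [x x1 <-] := rateH_surj v0.
have inj : {in `[1, +oo[%classic &, injective (@rateH R)}.
  move=> a b; rewrite !inE/= !in_itv/= !andbT => a1 b1 ab.
  have [ab'|ab'|//] := ltgtP a b.
    by have := rateH_increasing a1 ab'; rewrite ab ltxx.
  by have := rateH_increasing b1 ab'; rewrite ab ltxx.
rewrite /rateH_inv pinvKV// inE/= in_itv/= andbT//.
Qed.

Lemma rateH_inv_le v w : 0 <= v -> v <= w -> rateH_inv v <= rateH_inv w.
Proof.
move=> v0 vw; have [v1 vE] := rateH_invP v0.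
have [w1 wE] := rateH_invP (le_trans v0 vw).
rewrite leNgt; apply/negP => /(rateH_increasing w1); rewrite vE wE; lra.
Qed.

End rate_function.

(** * Almost sure statements from summable probabilities *)

Section borel_cantelli.
Context {R : realType} {dO : measure_display} {Omega : measurableType dO}.
Context (P : probability Omega R).

Lemma sum_inv_sqr_le n : \sum_(0 <= k < n) (k.+1%:R ^+ 2)^-1 <= 2 :> R.
Proof.
case: n => [|n]; first by rewrite big_geq.
suff : \sum_(0 <= k < n.+1) (k.+1%:R ^+ 2)^-1 <= 2 - n.+1%:R^-1 :> R.
  by move=> /le_trans; apply; rewrite gerBl.
elim: n => [|n IH]; first by rewrite big_nat1 expr1n invr1; lra.
rewrite big_nat_recr//=; apply: (le_trans (lerD IH (lexx _))).
have n0 : 0 < n.+1%:R :> R by rewrite ltr0n.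
have n20 : 0 < n.+2%:R :> R by rewrite ltr0n.
rewrite -subr_ge0.
have -> : 2 - n.+2%:R^-1 - (2 - n.+1%:R^-1 + (n.+2%:R ^+ 2)^-1) =
    (n.+1%:R * n.+2%:R ^+ 2)^-1 :> R.
  by rewrite -(natr1 n.+1) in n20 *; field; rewrite !gt_eqF.
by rewrite invr_ge0 mulr_ge0// exprn_ge0// ltW.
Qed.

(** Borel-Cantelli, for events of probability O(1/n^2). *)
Lemma ae_eventually_not (A : nat -> set Omega) (C : R) (n0 : nat) :
  (forall n, measurable (A n)) -> 0 <= C ->
  (forall n, (n0 <= n)%N -> (P (A n) <= (C / n.+1%:R ^+ 2)%:E)%E) ->
  {ae P, forall w, \forall n \near \oo, ~ A n w}.
Proof.
move=> mA C0 PA.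
pose B n := A (n + n0)%N.
have mB n : measurable (B n) by exact: mA.
have PB : (\sum_(n <oo) P (B n) < +oo)%E.
  apply: (@le_lt_trans _ _ (C * 2)%:E); last by rewrite ltry.
  apply: lime_le; first by apply: is_cvg_nneseries.
  apply: nearW => n; apply: (@le_trans _ _ (\sum_(0 <= k < n) (C / k.+1%:R ^+ 2)%:E)%E).
    apply: lee_sum => k _; apply: (le_trans (PA _ (leq_addl _ _))).
    rewrite lee_fin ler_wpM2l// lef_pV2 ?posrE ?exprn_gt0 ?ltr0n//.
    by rewrite lerXn2r ?nnegrE ?ler0n// ler_nat ltnS leq_addr.
  by rewrite sumEFin lee_fin -mulr_sumr ler_wpM2l// sum_inv_sqr_le.
have := lim_sup_set_cvg0 mB PB.
have mL : measurable (lim_sup_set B).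
  apply: bigcapT_measurable => n; apply: bigcup_measurable => k _; exact: mB.
move=> L0; exists (lim_sup_set B); split=> // w /= nA.
move=> n _ /=.
apply: contrapT => h; apply: nA.
exists (n + n0)%N => // m /= nm Am; apply: h.
exists (m - n0)%N => /=; first by rewrite leq_subRL; lia.
by rewrite /B subnK//; lia.
Qed.

End borel_cantelli.

Section poisson_concentration.
Context {R : realType} {dO : measure_display} {Omega : measurableType dO}.
Context (P : probability Omega R).
Context (N : nat -> {RV P >-> nat}).
Hypothesis N_poisson : forall n k, (0 < n)%N ->
  distribution P (N n) [set k] = (poisson_pmf n%:R k)%:E.

Lemma poisson_prob1 (r : R) k : 0 < r -> poisson_prob r 0 [set k] = (poisson_pmf r k)%:E.
Proof.
move=> r0; rewrite /poisson_prob r0 esum_set1// lee_fin.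
exact: poisson_pmf_ge0.
Qed.

Lemma measure_nat_series (m : {measure set nat -> \bar R}) (A : set nat) :
  m A = (\sum_(k <oo | k \in A) m [set k])%E.
Proof.
rewrite -measure_bigcup//; last by move=> i j _ _ [k [/= <- <-]].
by rewrite (bigcup_imset1 A id) image_id.
Qed.

(** Change of intensity from [n] to [theta * n]; on the counts in [A] the
    density is at most [exp (- n * rateH theta)], which is Chernoff's bound.
    The condition on [A] covers the upper tail for [theta > 1] and the lower
    one for [theta < 1]. *)
Lemma prob_poisson_chernoff n (theta : R) (A : set nat) : (0 < n)%N -> 0 < theta ->
  (forall k, A k -> theta * n%:R * ln theta <= k%:R * ln theta) ->
  (distribution P (N n) A <= (expR (- (n%:R * rateH theta)))%:E)%E.
Proof.
move=> n0 t0 hA.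
have nR : 0 < n%:R :> R by rewrite ltr0n.
have tn : 0 < theta * n%:R by rewrite mulr_gt0.
rewrite (measure_nat_series (distribution P (N n))).
apply: (@le_trans _ _ (\sum_(k <oo | k \in A)
   (expR (- (n%:R * rateH theta)))%:E * poisson_prob (theta * n%:R) 0 [set k])%E).
  apply: lee_nneseries => k; first by move=> *; exact: measure_ge0.
  move=> /set_mem/hA hk; rewrite [leLHS](N_poisson k n0).
  rewrite [X in (_ * X)%E](poisson_prob1 k tn) -EFinM lee_fin.
  rewrite /poisson_pmf nR tn rateHE// exprMn.
  have -> : theta ^+ k = expR (k%:R * ln theta) by rewrite expRM_natl lnK ?posrE.
  set c := n%:R ^+ k; set f := k`!%:R^-1.
  have -> : expR (- (n%:R * (1 - theta + theta * ln theta))) *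
    (expR (k%:R * ln theta) * c * f * expR (- (theta * n%:R))) =
    c * f * (expR (- (n%:R * (1 - theta + theta * ln theta))) *
     expR (k%:R * ln theta) * expR (- (theta * n%:R))) by ring.
  rewrite -!expRD ler_wpM2l ?mulr_ge0 ?exprn_ge0 ?invr_ge0//.
  by rewrite ler_expR; lra.
rewrite nneseriesZl; last by move=> *; exact: measure_ge0.
rewrite -(measure_nat_series (poisson_prob (theta * n%:R) 0)).
rewrite -[leRHS]mule1 lee_wpmul2l ?lee_fin ?expR_ge0//.
exact: probability_le1.
Qed.

Lemma expRN_le_inv_sqr (x : R) : 0 < x -> expR (- x) <= 2 / x ^+ 2.
Proof.
move=> x0; rewrite expRN -[leRHS]invrK lef_pV2 ?posrE ?expR_gt0 ?invr_gt0 ?divr_gt0 ?exprn_gt0//.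
rewrite invf_div.
have := @expR_ge1Dxn R x 1 (ltW x0); rewrite (_ : 2`! = 2%N)//.
by apply: le_trans; rewrite lerDr.
Qed.

Lemma ae_poisson_dev (theta : R) (A : nat -> set nat) : 0 < theta -> theta != 1 ->
  (forall n k, A n k -> theta * n%:R * ln theta <= k%:R * ln theta) ->
  {ae P, forall w, \forall n \near \oo, ~ A n (N n w)}.
Proof.
move=> t0 t1 hA; have H0 := rateH_gt0 t0 t1.
apply: (@ae_eventually_not _ _ _ P (fun n => N n @^-1` A n) (8 / rateH theta ^+ 2) 1).
- move=> n; rewrite -[X in measurable X]setTI; exact: measurable_funPT.
- by rewrite divr_ge0// exprn_ge0// ltW.
- move=> n n0; apply: (le_trans (prob_poisson_chernoff n0 t0 (hA n))).
  rewrite lee_fin; have nR : 0 < n%:R :> R by rewrite ltr0n.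
  apply: (le_trans (expRN_le_inv_sqr _)); first exact: mulr_gt0.
  have nn : n.+1%:R <= 2 * n%:R :> R by rewrite -natrM ler_nat; lia.
  have n1 : 0 < n.+1%:R :> R by rewrite ltr0n.
  rewrite exprMn ler_pdivlMr ?exprn_gt0//.
  have -> : 2 / (n%:R ^+ 2 * rateH theta ^+ 2) * n.+1%:R ^+ 2 =
    2 * (n.+1%:R / n%:R) ^+ 2 / rateH theta ^+ 2 by field; rewrite ?gt_eqF.
  rewrite ler_pM2r ?invr_gt0 ?exprn_gt0//.
  have h : n.+1%:R / n%:R <= 2 :> R by rewrite ler_pdivrMr.
  have h0 : 0 <= n.+1%:R / n%:R :> R by rewrite divr_ge0.
  nra.
Qed.

Lemma ae_poisson_count (eps : R) : 0 < eps -> eps < 1 ->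
  {ae P, forall w, \forall n \near \oo,
     (1 - eps) * n%:R <= (N n w)%:R <= (1 + eps) * n%:R}.
Proof.
move=> e0 e1.
have p1 : 0 < 1 + eps by lra. have p2 : 0 < 1 - eps by lra.
have h1 := @ae_poisson_dev (1 + eps) (fun n => [set k | (1 + eps) * n%:R < k%:R]) p1.
have h2 := @ae_poisson_dev (1 - eps) (fun n => [set k | k%:R < (1 - eps) * n%:R]) p2.
have {}h1 := h1 (ltac:(rewrite gt_eqF; lra)).
have {}h2 := h2 (ltac:(rewrite lt_eqF; lra)).
have l1 : 0 <= ln (1 + eps) by apply: ln_ge0; lra.
have l2 : ln (1 - eps) <= 0 by apply: ln_le0; lra.
have {}h1 := h1 (fun n k hk => ler_wpM2r l1 (ltW hk)).
have {}h2 := h2 (fun n k hk => ler_wnM2r l2 (ltW hk)).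
move: h1 h2; apply: filterS2 => w h1 h2.
move: h1 h2; apply: filterS2 => n h1 h2.
by rewrite !leNgt; apply/andP; split; apply/negP.
Qed.

End poisson_concentration.

Section bracketing.
Context {R : realType} {dO : measure_display} {Omega : measurableType dO}.
Context (P : probability Omega R).

(** Along the powers [k ^ M], with [M] large, a polynomially small probability
    is summable, while consecutive powers are asymptotically equivalent: almost
    surely, every large [n] lies in a short interval whose bad event fails. *)
Lemma ae_good_bracket (Bad : nat -> nat -> set Omega) (delta C eps : R) (b0 : nat) :
  0 < delta -> 0 <= C -> 0 < eps ->
  (forall b b', measurable (Bad b b')) ->
  (forall b b', (b0 <= b)%N -> (b <= b')%N -> b'%:R <= (1 + eps) * b%:R ->
     (P (Bad b b') <= (C * expR (- (delta * ln b%:R)))%:E)%E) ->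
  {ae P, forall w, \forall n \near \oo, exists b b',
     [/\ (b0 <= b)%N, (b <= n <= b')%N, b'%:R <= (1 + eps) * b%:R & ~ Bad b b' w]}.
Proof.
move=> d0 C0 e0 mB PB.
pose M := (Num.truncn (2 / delta)).+1.
have hM : 2 <= M%:R * delta.
  by rewrite -ler_pdivrMr//; apply: ltW; rewrite /M; exact: truncnS_gt.
pose b k := (k.+1 ^ M)%N.
have bk k : (k < b k)%N by rewrite /b -[X in (X <= _)%N]expn1 leq_pexp2l.
have b_le k l : (k <= l)%N -> (b k <= b l)%N by move=> kl; rewrite /b leq_exp2r.
have l0 : 0 < ln (1 + eps) by apply: ln_gt0; lra.
pose k1 := Num.truncn (M%:R / ln (1 + eps)).
have ratio k : (k1 <= k)%N -> (b k.+1)%:R <= (1 + eps) * (b k)%:R.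
  move=> kk; rewrite /b !natrX.
  have k0 : 0 < k.+1%:R :> R by rewrite ltr0n.
  rewrite -ler_pdivrMr ?exprn_gt0// -expr_div_n.
  have -> : k.+2%:R / k.+1%:R = 1 + k.+1%:R^-1 :> R.
    by rewrite -(natr1 k.+1); field; rewrite gt_eqF.
  apply: (@le_trans _ _ (expR (M%:R * k.+1%:R^-1))).
    rewrite expRM_natl lerXn2r ?nnegrE ?expR_ge0 ?expR_ge1Dx//.
  rewrite -[leRHS]lnK ?posrE; last by lra.
  rewrite ler_expR ler_pdivrMr// mulrC -ler_pdivrMr//.
  apply/ltW/(lt_le_trans (truncnS_gt _)).
  by rewrite ler_nat ltnS.
have := @ae_eventually_not _ _ _ P (fun k => Bad (b k) (b k.+1)) C (maxn k1 b0) _ C0 _.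
move=> H; have {H} : {ae P, forall w, \forall k \near \oo, ~ Bad (b k) (b k.+1) w}.
  apply: H => // k; rewrite geq_max => /andP[k1k b0k].
  apply: (le_trans (PB _ _ _ _ (ratio _ k1k))).
  - exact: leq_trans b0k (ltnW (bk _)).
  - exact: b_le.
  rewrite lee_fin ler_wpM2l// /b natrX lnXn ?ltr0n// -[_ *+ M]mulr_natl.
  have lk : 0 <= ln k.+1%:R :> R by rewrite ln_ge0// ler1n.
  apply: (@le_trans _ _ (expR (- (2%:R * ln k.+1%:R)))).
    rewrite ler_expR lerN2 mulrA (mulrC delta).
    by rewrite ler_wpM2r.
  by rewrite expRN expRM_natl lnK ?posrE ?ltr0n.
apply: filterS => w [K _ hK].
exists (b (maxn K (maxn k1 b0))) => // n /= bn.
have ex : exists k, (b k <= n)%N by exists (maxn K (maxn k1 b0)).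
have ub k : (b k <= n)%N -> (k <= n)%N by move=> /(leq_trans (bk k))/ltnW.
case: (ex_maxnP ex ub) => k bkn kmax.
have := kmax _ bn; rewrite !geq_max => /and3P[Kk k1k b0k].
exists (b k), (b k.+1); split.
- exact: leq_trans b0k (ltnW (bk _)).
- rewrite bkn /= leqNgt; apply/negP => /ltnW /kmax; rewrite ltnn//.
- exact: ratio.
- exact: hK.
Qed.

End bracketing.

(** * Binomial tails at a logarithmic mean *)

Section tail_estimates.
Context {R : realType}.
Implicit Types (gamma y delta eps p : R) (b m s M : nat).

Lemma ln_le_linear (C eta : R) : 0 < eta ->
  exists2 L, 1 <= L & forall x, L <= x -> ln x + C <= eta * x.
Proof.
move=> e0; exists (Num.max 1 (2 / eta * (C + ln (2 / eta)))); first by rewrite le_max lexx.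
move=> x; rewrite ge_max => /andP[x1 xL].
have x0 : 0 < x by lra.
have e2 : 0 < 2 / eta by rewrite divr_gt0.
have h : ln (x / (2 / eta)) <= x / (2 / eta) by rewrite ltW// ln_sublinear// divr_gt0.
rewrite ln_div ?posrE// invf_div in h.
have h2 : C + ln (2 / eta) <= x * (eta / 2).
  rewrite -(ler_pM2l e2).
  by have -> : 2 / eta * (x * (eta / 2)) = x by field; rewrite gt_eqF.
lra.
Qed.

Lemma large_ln (L : R) : exists b0 : nat, forall b, (b0 <= b)%N -> L <= ln b%:R.
Proof.
exists (Num.truncn (expR L)).+1 => b hb.
have b0 : 0 < b%:R :> R by rewrite ltr0n; lia.
rewrite -[leLHS]expRK ler_ln ?posrE ?expR_gt0//.
by apply/ltW/(lt_le_trans (truncnS_gt _)); rewrite ler_nat.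
Qed.

Lemma ln_bracket b b' eps : (0 < b)%N -> (b <= b')%N -> 0 < eps ->
  b'%:R <= (1 + eps) * b%:R -> ln (b%:R : R) <= ln b'%:R <= ln b%:R + eps.
Proof.
move=> b0 bb' e0 hb'.
have bR : 0 < b%:R :> R by rewrite ltr0n.
have b'R : 0 < b'%:R :> R by rewrite ltr0n; lia.
have e1 : 0 < 1 + eps by lra.
apply/andP; split; first by rewrite ler_ln ?posrE// ler_nat.
apply: (@le_trans _ _ (ln ((1 + eps) * b%:R))).
  by rewrite ler_ln ?posrE// mulr_gt0.
rewrite lnM ?posrE// addrC lerD2l le_ln1Dx//; lra.
Qed.

(** There are about [b] vertices, each of mean degree about [gamma * ln b], and
    Chernoff's bound with [theta = y] makes the union bound of order
    [b ^ (1 - gamma * rateH y)].  Half of this negative exponent is [delta]; the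
    other half absorbs the relative errors, which are multiples of [eps]. *)
Lemma upper_tail_estimate gamma y : 0 < gamma -> 1 < y -> 1 < gamma * rateH y ->
  exists delta eps b0, [/\ 0 < delta, 0 < eps, eps < 1 &
    forall b b' m s p, (b0 <= b)%N -> (b <= b')%N -> b'%:R <= (1 + eps) * b%:R ->
    m%:R <= (1 + eps) * b'%:R -> 0 <= p <= 1 -> p <= gamma * ln b'%:R / b%:R ->
    gamma * y * ln b%:R <= s%:R ->
    m%:R * btail p m.-1 s <= 4 * expR (- (delta * ln b%:R))].
Proof.
move=> g0 y1 gH.
pose delta := (gamma * rateH y - 1) / 2.
have d0 : 0 < delta by rewrite /delta; lra.
pose A := 7 * gamma * (y - 1).
have A0 : 0 < A by rewrite !mulr_gt0//; lra.
pose eps := delta / (A + 2 * delta).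
have Ad : 0 < A + 2 * delta by lra.
have e0 : 0 < eps by rewrite divr_gt0.
have e1 : eps <= 2^-1 by rewrite /eps ler_pdivrMr//; lra.
have eA : A * eps <= delta by rewrite /eps mulrA ler_pdivrMr//; nra.
have [b0 hb0] := large_ln 1.
exists delta, eps, (maxn 1 b0); split=> //; first by lra.
move=> b b' m s p; rewrite geq_max => /andP[b1 /hb0 l1] bb' b'b mb' p01 pb sb.
have bR : 0 < b%:R :> R by rewrite ltr0n.
have /andP[lb lb'] := ln_bracket b1 bb' e0 b'b.
set l := ln b%:R in l1 sb lb lb' *.
have y0 : 0 < y by lra.
have ly : 0 <= ln y by rewrite ln_ge0// ltW.
have bE : b%:R = expR l by rewrite lnK ?posrE.
have mb : m%:R <= 4 * b%:R :> R.
  apply: (le_trans mb'); apply: (@le_trans _ _ (2 * (2 * b%:R))); last by lra.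
  apply: ler_pM => //; [lra|lra|].
  by apply: (le_trans b'b); rewrite ler_pM2r//; lra.
have mp : m%:R * p <= (1 + 7 * eps) * gamma * l.
  apply: (@le_trans _ _ (((1 + eps) * ((1 + eps) * b%:R)) * (gamma * ((1 + eps) * l) / b%:R))).
    apply: ler_pM => //; first by case/andP: p01.
      by apply: le_trans mb' _; rewrite ler_wpM2l//; lra.
    apply: (le_trans pb); rewrite ler_pM2r ?invr_gt0// ler_pM2l//; nra.
  have -> : (1 + eps) * ((1 + eps) * b%:R) * (gamma * ((1 + eps) * l) / b%:R) =
    (1 + eps) ^+ 3 * (gamma * l) by field; rewrite gt_eqF.
  rewrite -mulrA ler_wpM2r ?mulr_ge0 ?(ltW g0)//; first by lra.
  have : eps ^+ 2 <= eps by rewrite expr2; nra.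
  have : eps ^+ 3 <= eps by rewrite exprS expr2; nra.
  have -> : (1 + eps) ^+ 3 = 1 + 3 * eps + 3 * eps ^+ 2 + eps ^+ 3 by ring.
  lra.
have mp' : m.-1%:R * p * (y - 1) <= (1 + 7 * eps) * gamma * l * (y - 1).
  rewrite ler_wpM2r ?subr_ge0 ?(ltW y1)//; apply: le_trans mp.
  by rewrite ler_wpM2r ?ler_nat ?leq_pred//; case/andP: p01.
have ys : y ^- s <= expR (- (gamma * y * l * ln y)).
  have -> : y ^- s = expR (- (s%:R * ln y)) by rewrite expRN expRM_natl lnK ?posrE.
  by rewrite ler_expR lerN2 ler_wpM2r.
apply: (@le_trans _ _ (4 * expR l *
   (expR (- (gamma * y * l * ln y)) * expR ((1 + 7 * eps) * gamma * l * (y - 1))))).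
  apply: ler_pM => //; [exact: btail_ge0|by rewrite -bE|].
  apply: (le_trans (btail_le_expR _ _ p01 (ltW y1))).
  apply: ler_pM => //; rewrite ?expR_ge0 ?ler_expR//.
  by rewrite invr_ge0 exprn_ge0// ltW.
rewrite -mulrA -!expRD ler_pM2l// ler_expR.
have := eA; rewrite /A /delta rateHE// in gH *.
move=> h.
have : l * (7 * gamma * (y - 1) * eps) <= l * ((gamma * (1 - y + y * ln y) - 1) / 2).
  by rewrite ler_wpM2l//; lra.
lra.
Qed.

Lemma ln_1B8_ge eps : 0 <= eps -> eps <= 16^-1 -> - (16 * eps) <= ln (1 - 8 * eps).
Proof.
move=> e0 e1; have h8 : 0 < 1 - 8 * eps by lra.
rewrite -lerN2 -lnV ?posrE// opprK.
have -> : (1 - 8 * eps)^-1 = 1 + 8 * eps / (1 - 8 * eps) by field; rewrite gt_eqF.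
apply: le_trans (le_ln1Dx _) _.
  by apply: (@lt_le_trans _ _ 0); [lra|rewrite divr_ge0//; lra].
by rewrite ler_pdivrMr//; nra.
Qed.

Lemma correction_le eps : 0 <= eps ->
  (1 - 8 * eps) * (1 + 2 * eps) * (1 + eps) <= (1 - 3 * eps) * (1 - eps).
Proof.
move=> e0; have q2 : 0 <= eps ^+ 2 by exact: sqr_ge0.
have q3 : 0 <= eps ^+ 3 by exact: exprn_ge0.
rewrite -subr_ge0.
have -> : (1 - 3 * eps) * (1 - eps) - (1 - 8 * eps) * (1 + 2 * eps) * (1 + eps) =
   eps + 25 * eps ^+ 2 + 16 * eps ^+ 3 by ring.
lra.
Qed.

(** The tail at [s], about [gamma * y * ln b], of a binomial law of mean about
    [gamma * ln b] is of order [b ^ (- gamma * rateH y)], and [gamma * rateH y]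
    is [1 - 4 * delta]; a margin of [2 * delta] is left for the relative errors,
    which are multiples of [eps]. *)
Lemma lower_tail_estimate gamma y : 0 < gamma -> 1 < y -> gamma * rateH y < 1 ->
  exists delta eps b0, [/\ 0 < delta, 0 < eps, eps < 1 / 4 &
    forall b b' M s p, (b0 <= b)%N -> (b <= b')%N -> b'%:R <= (1 + eps) * b%:R ->
    (1 - 2 * eps) * b%:R - 1 <= M%:R -> M%:R <= b%:R :> R ->
    (1 - eps) * (gamma * ln b%:R / b'%:R) <= p -> p <= gamma * ln b%:R / b'%:R ->
    gamma * y * ln b'%:R <= s%:R -> s%:R <= gamma * y * ln b'%:R + 1 ->
    expR (- ((1 - 2 * delta) * ln b%:R)) <= btail p M s].
Proof.
move=> g0 y1 gH.
have y0 : 0 < y by lra.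
have ly : 0 < ln y by rewrite ln_gt0.
have gy0 : 0 < gamma * y by rewrite mulr_gt0.
have gyl0 : 0 < gamma * y * ln y by rewrite mulr_gt0.
rewrite rateHE// in gH.
have [delta dE] : exists delta, 4 * delta = 1 - gamma * (1 - y + y * ln y).
  by exists ((1 - gamma * (1 - y + y * ln y)) / 4); field.
have d0 : 0 < delta by lra.
pose A := 32 * gamma * y + 2 * gamma * y * ln y + 2 + 2 * gamma.
have [eps [e0 e1 eA]] : exists eps, [/\ 0 < eps, eps <= 16^-1 & A * eps <= 2 * delta].
  have A0 : 0 < A by rewrite /A; lra.
  have Ad : 0 < A + 16 * delta by lra.
  exists (delta / (A + 16 * delta)); split; first by rewrite divr_gt0.
    by rewrite ler_pdivrMr//; lra.
  by rewrite mulrA ler_pdivrMr//; nra.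
rewrite /A in eA => {A}.
(* Thresholds: [s] is logarithmic in [b], so [s + 1 <= eps * b],
   [p <= eps] and [ln s <= eps * ln b] eventually. *)
have [L1 L11 hL1] := @ln_le_linear (ln (gamma * y * 2 + 1)) eps e0.
have [L2 L21 hL2] := @ln_le_linear 0 (eps / (gamma * y * 2 + 2 + gamma))
   (ltac:(rewrite divr_gt0//; lra)).
have [b0 hb0] := large_ln (L1 + (1 / eps + (eps * (gamma * y) + 1) / (eps * (gamma * y)))).
have [b2 hb2] : exists b2 : nat, forall b, (b2 <= b)%N -> L2 <= b%:R.
  exists (Num.truncn L2).+1 => b hb.
  by apply/ltW/(lt_le_trans (truncnS_gt _)); rewrite ler_nat.
exists delta, eps, (maxn 1 (maxn b0 b2)); split=> //; first by lra.
move=> b b' M s p; rewrite !geq_max => /and3P[b1 /hb0 lL /hb2 bL].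
move=> bb' b'b Mb MB p1 p2 s1 s2.
have bR : 0 < b%:R :> R by rewrite ltr0n.
have b'R : 0 < b'%:R :> R by rewrite ltr0n (leq_trans b1).
have bb'R : b%:R <= b'%:R :> R by rewrite ler_nat.
have pe1 : 0 < 1 + eps by rewrite addr_gt0.
have /andP[lb lb'] := ln_bracket b1 bb' e0 b'b.
set l := ln b%:R in lL p1 p2 lb lb' *.
have egy : 0 < eps * (gamma * y) by rewrite mulr_gt0.
have t1 : 0 < 1 / eps by rewrite divr_gt0.
have t2 : 0 < (eps * (gamma * y) + 1) / (eps * (gamma * y)) by rewrite divr_gt0// addr_gt0.
have lL1 : L1 <= l by clear - lL t1 t2; lra.
have l1 : 1 <= l by exact: le_trans lL1.
have l0 : 0 < l by exact: lt_le_trans l1.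
have el1 : 1 <= eps * l.
  have : 1 / eps <= l by clear - lL t2 L11; lra.
  by rewrite ler_pdivrMr// mulrC.
have el2 : eps * (gamma * y) + 1 <= l * (eps * (gamma * y)).
  by rewrite -ler_pdivrMr//; clear - lL t1 L11; lra.
have gle : 0 < eps * (gamma * y * l) := mulr_gt0 e0 (mulr_gt0 gy0 l0).
have ee : eps * eps <= eps / 16 by rewrite ler_pM2l.
have glb : gamma * y * ln b'%:R <= gamma * y * (l + eps) by rewrite ler_pM2l.
have sl : s%:R <= (1 + 2 * eps) * (gamma * y * l) by clear - s2 glb el2 gle; lra.
have gye : gamma * y * eps <= gamma * y * l by rewrite ler_pM2l//; clear - e1 l1; lra.
have sl2 : s%:R <= (gamma * y * 2 + 1) * l by clear - s2 glb gye l1; lra.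
have gy2 : 0 < gamma * y * 2 + 1 by clear - gy0; lra.
have s0 : (0 < s)%N.
  rewrite -(ltr0n R); apply: lt_le_trans s1; rewrite mulr_gt0//.
  by apply: lt_le_trans lb.
have sR : 0 < s%:R :> R by rewrite ltr0n.
have lns : ln s%:R <= eps * l.
  apply: (@le_trans _ _ (ln ((gamma * y * 2 + 1) * l))).
    by rewrite ler_ln ?posrE// mulr_gt0.
  rewrite lnM ?posrE//.
  by rewrite addrC; exact: hL1.
have lb2 : (gamma * y * 2 + 2 + gamma) * l <= eps * b%:R.
  have := hL2 _ bL; rewrite addr0 -/l mulrAC ler_pdivlMr; last by clear - gy0 g0; lra.
  by rewrite mulrC.
have gl0 : 0 < gamma * l by rewrite mulr_gt0.
have seb : s%:R + 1 <= eps * b%:R by clear - sl2 lb2 gl0 l1; lra.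
have eb : eps * b%:R <= 16^-1 * b%:R by rewrite ler_pM2r.
have peps : p <= eps.
  apply: (le_trans p2); rewrite ler_pdivrMr//.
  apply: (@le_trans _ _ (eps * b%:R)); last by rewrite ler_pM2l.
  by apply: le_trans lb2; rewrite ler_pM2r//; clear - gy0; lra.
have p0 : 0 <= p.
  apply: le_trans p1; rewrite mulr_ge0//; first by clear - e1; lra.
  by rewrite divr_ge0 ?mulr_ge0// ltW.
have sM : (s <= M)%N by rewrite -(ler_nat R); clear - Mb seb eb bR; lra.
pose rho := (1 - 8 * eps) / y.
have rho0 : 0 < rho by rewrite /rho divr_gt0//; clear - e1; lra.
have Msb : (1 - 3 * eps) * b%:R <= M%:R - s%:R by clear - Mb seb; lra.
have m1 : 0 < 1 - eps by clear - e1; lra.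
have m3 : 0 <= 1 - 3 * eps by clear - e1; lra.
have pl : (1 - eps) * (gamma * l) / ((1 + eps) * b%:R) <= p.
  apply: le_trans p1; rewrite -mulrA ler_pM2l//.
  by rewrite ler_pM2l ?mulr_gt0// lef_pV2 ?posrE// mulr_gt0.
have rhos : rho * s%:R <= (M%:R - s%:R) * p.
  apply: (@le_trans _ _ (((1 - 3 * eps) * b%:R) *
      ((1 - eps) * (gamma * l) / ((1 + eps) * b%:R)))); last first.
    apply: ler_pM => //; first by rewrite mulr_ge0// ltW.
    by rewrite divr_ge0 ?mulr_ge0 ?(ltW m1) ?(ltW g0) ?(ltW l0) ?(ltW pe1) ?(ltW bR).
  apply: (@le_trans _ _ (rho * ((1 + 2 * eps) * (gamma * y * l)))).
    by rewrite ler_pM2l.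
  have -> : rho * ((1 + 2 * eps) * (gamma * y * l)) = (1 - 8 * eps) * (1 + 2 * eps) * (gamma * l).
    by rewrite /rho; field; rewrite gt_eqF.
  have -> : (1 - 3 * eps) * b%:R * ((1 - eps) * (gamma * l) / ((1 + eps) * b%:R)) =
     ((1 - 3 * eps) * (1 - eps) / (1 + eps)) * (gamma * l).
    by field; rewrite (gt_eqF bR) (gt_eqF pe1).
  by rewrite ler_pM2r// ler_pdivlMr// correction_le// ltW.
have p1' : 0 <= p < 1 by rewrite p0; clear - peps e1; lra.
apply: le_trans (btail_ge_expR p1' s0 sM rho0 rhos).
rewrite ler_expR.
have lrho : - (16 * eps) - ln y <= ln rho.
  rewrite /rho ln_div ?posrE//; last by clear - e1; lra.
  by rewrite lerD2r ln_1B8_ge// ltW.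
have t3 : - ((1 + 2 * eps) * (gamma * y * l) * (16 * eps + ln y)) <= s%:R * ln rho.
  apply: (@le_trans _ _ (s%:R * (- (16 * eps) - ln y))); last by rewrite ler_pM2l.
  have -> : s%:R * (- (16 * eps) - ln y) = - (s%:R * (16 * eps + ln y)) by ring.
  by rewrite lerN2 ler_wpM2r//; clear - e0 ly; lra.
have t4 : M%:R * p / (1 - p) <= (1 + 2 * eps) * (gamma * l).
  rewrite ler_pdivrMr; last by clear - peps e1; lra.
  apply: (@le_trans _ _ (gamma * l)).
    apply: (@le_trans _ _ (b'%:R * (gamma * l / b'%:R))).
      by apply: ler_pM => //; exact: le_trans MB bb'R.
    by rewrite mulrC divfK// gt_eqF.
  rewrite mulrAC -[leLHS]mul1r ler_pM2r//.
  have h1p : (1 + 2 * eps) * (1 - eps) <= (1 + 2 * eps) * (1 - p).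
    by rewrite ler_wpM2l ?lerB// addr_ge0// mulr_ge0// ltW.
  clear -e0 e1 ee h1p; lra.
have s3 : gamma * y * l <= s%:R by apply: le_trans s1; rewrite ler_pM2l.
have key := ler_wpM2l (ltW l0) eA.
have dEl : l * (4 * delta) = l * (1 - gamma * (1 - y + y * ln y)) by rewrite dE.
have e2 := ler_wpM2l (ltW (mulr_gt0 gy0 l0)) ee.
clear - s3 t3 t4 lns el1 key dEl e2 gle; lra.
Qed.

End tail_estimates.

(** * Union bound and second moment *)

Definition prob {dO} {Omega : measurableType dO} {R : realType}
    (P : probability Omega R) (A : set Omega) : R := fine (P A).

Section real_probability.
Context {dO} {Omega : measurableType dO} {R : realType} {P : probability Omega R}.
Local Notation Pr := (prob P).

Lemma prob_ge0 A : 0 <= Pr A.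
Proof. by rewrite fine_ge0. Qed.

Lemma probE A : measurable A -> P A = (Pr A)%:E.
Proof. by move=> mA; rewrite /prob fineK// fin_num_measure. Qed.

Lemma prob_le1 A : measurable A -> Pr A <= 1.
Proof. by move=> mA; rewrite -lee_fin -probE// probability_le1. Qed.

Lemma prob_setT : Pr setT = 1.
Proof. by rewrite /prob probability_setT. Qed.

Lemma le_prob A B : measurable A -> measurable B -> A `<=` B -> Pr A <= Pr B.
Proof. by move=> mA mB AB; rewrite -lee_fin -!probE// le_measure// inE. Qed.

Lemma prob_split A B : measurable A -> measurable B ->
  Pr A = Pr (A `&` B) + Pr (A `\` B).
Proof.
move=> mA mB; have mI := measurableI _ _ mA mB; have mD := measurableD mA mB.
apply/EFin_inj; rewrite EFinD -!probE// -measureU//; first by rewrite setUIDK.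
by apply/seteqP; split=> w // [[_ Bw] [_ /(_ Bw)]].
Qed.

Lemma probU_le A B : measurable A -> measurable B -> Pr (A `|` B) <= Pr A + Pr B.
Proof.
move=> mA mB; rewrite (prob_split (B := A) (measurableU _ _ mA mB))//.
have -> : (A `|` B) `&` A = A by apply/setIidr; left.
rewrite lerD2l le_prob//; first by apply: measurableD => //; exact: measurableU.
by move=> w [[]].
Qed.

Lemma prob_eq0_sub A B : measurable A -> measurable B -> A `<=` B -> Pr B = 0 -> Pr A = 0.
Proof.
move=> mA mB AB B0; apply/eqP; rewrite eq_le prob_ge0 andbT -B0.
exact: le_prob.
Qed.

Lemma prob_bigcup_le n (E : nat -> set Omega) (c : R) :
  (forall i, measurable (E i)) -> (forall i, (i < n)%N -> Pr (E i) <= c) ->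
  Pr (\bigcup_(i < n) E i) <= n%:R * c.
Proof.
move=> mE Ec; rewrite bigcup_mkord.
elim: n Ec => [|n IH] Ec; first by rewrite big_ord0 mul0r /prob measure0.
rewrite big_ord_recr/= -natr1 mulrDl mul1r.
apply: le_trans (probU_le _ (mE n)) _; first exact: bigsetU_measurable.
by rewrite lerD ?Ec// IH// => i /ltnW; exact: Ec.
Qed.

(** Chebyshev's bound for the number [S] of events that occur, whose mean is
    [m = q * pi]: integrate [m ^ 2 * 1_(S = 0) + 2 * m * S <= m ^ 2 + S ^ 2].
    Written additively, it involves only integrals of nonnegative functions. *)
Lemma second_moment q (E : 'I_q -> set Omega) (pi : R) :
  (forall i, measurable (E i)) -> 0 <= pi -> (forall i, Pr (E i) = pi) ->
  (q%:R * pi) ^+ 2 * Pr (\bigcap_i ~` E i) + (q%:R * pi) ^+ 2 <=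
  \sum_i \sum_j Pr (E i `&` E j).
Proof.
move=> mE pi0 pE.
pose F := \bigcap_i ~` E i.
have mF : measurable F by apply: fin_bigcap_measurable => // i _; exact: measurableC.
have intE A : measurable A -> (\int[P]_w (\1_A w)%:E = (Pr A)%:E)%E.
  by move=> mA; rewrite integral_indic// setIT; exact: probE.
have meas1 A : measurable A -> measurable_fun (setT : set Omega) (fun w : Omega => (\1_A w : R)%:E).
  by move=> mA; apply/measurable_EFinP; exact: measurable_indic.
set m := q%:R * pi; have m0 : 0 <= m by rewrite mulr_ge0.
pose lhs w : \bar R := ((m ^+ 2)%:E * (\1_F w)%:E + (2 * m)%:E * \sum_i (\1_(E i) w)%:E)%E.
pose rhs w : \bar R := ((m ^+ 2)%:E + \sum_i \sum_j (\1_(E i `&` E j) w)%:E)%E.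
have ind0 A w : (0 <= (\1_A w : R)%:E)%E by rewrite lee_fin.
have le_lr : (\int[P]_w lhs w <= \int[P]_w rhs w)%E.
  apply: ge0_le_integral => //.
  - by move=> w _; rewrite adde_ge0// mule_ge0 ?lee_fin ?sqr_ge0 ?mulr_ge0// sume_ge0.
  - apply: emeasurable_funD; first by apply: measurable_funeM; exact: meas1.
    by apply: measurable_funeM; apply: emeasurable_sum => i; exact: meas1.
  - apply: emeasurable_funD => //.
    apply: emeasurable_sum => i; apply: emeasurable_sum => j; apply: meas1.
    exact: measurableI.
  - move=> w _; rewrite /lhs /rhs sumEFin.
    under [in leRHS]eq_bigr do rewrite sumEFin.
    rewrite sumEFin -!EFinM -!EFinD lee_fin.
    set S := \sum_i \1_(E i) w.
    have -> : \sum_i \sum_j \1_(E i `&` E j) w = S ^+ 2 :> R.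
      rewrite expr2 mulr_suml; apply: eq_bigr => i _; rewrite mulr_sumr.
      by apply: eq_bigr => j _; rewrite indicI.
    have [Fw|Fw] := pselect (F w).
      have -> : S = 0.
        rewrite /S big1// => i _; rewrite indicE memNset//; exact: (Fw i Logic.I).
      by rewrite indicE mem_set// mulr0 expr0n/= !addr0 mulr1.
    rewrite indicE memNset// mulr0 add0r -subr_ge0.
    by have -> : m ^+ 2 + S ^+ 2 - 2 * m * S = (m - S) ^+ 2; [ring|exact: sqr_ge0].
have intl : (\int[P]_w lhs w = (m ^+ 2 * Pr F + 2 * m * m)%:E)%E.
  rewrite ge0_integralD//; first last.
  - by apply: measurable_funeM; apply: emeasurable_sum => i; exact: meas1.
  - by move=> w _; rewrite mule_ge0 ?lee_fin ?mulr_ge0// sume_ge0.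
  - by apply: measurable_funeM; exact: meas1.
  - by move=> w _; rewrite mule_ge0 ?lee_fin ?sqr_ge0.
  rewrite ge0_integralZl//; [|exact: meas1|by rewrite lee_fin sqr_ge0].
  rewrite ge0_integralZl//; first last.
  - by rewrite lee_fin mulr_ge0.
  - by move=> w _; rewrite sume_ge0.
  - by apply: emeasurable_sum => i; exact: meas1.
  rewrite ge0_integral_sum//; last by move=> i; exact: meas1.
  rewrite intE//.
  under eq_bigr do rewrite intE// pE.
  by rewrite sumEFin sumr_const card_ord -[pi *+ q]mulr_natl -!EFinM -EFinD.
have intr : (\int[P]_w rhs w = (m ^+ 2 + \sum_i \sum_j Pr (E i `&` E j))%:E)%E.
  rewrite ge0_integralD//; first last.
  - apply: emeasurable_sum => i; apply: emeasurable_sum => j; apply: meas1.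
    exact: measurableI.
  - by move=> w _; apply: sume_ge0 => i _; apply: sume_ge0.
  - by move=> w _; rewrite lee_fin sqr_ge0.
  rewrite integral_cst// [X in (_ * X)%E](probability_setT P) mule1 ge0_integral_sum//; first last.
  - by move=> i w _; apply: sume_ge0.
  - by move=> i; apply: emeasurable_sum => j; apply: meas1; exact: measurableI.
  rewrite (eq_bigr (fun i => (\sum_j Pr (E i `&` E j))%:E)); first by rewrite sumEFin -EFinD.
  move=> i _; rewrite ge0_integral_sum//; last by move=> j; apply: meas1; exact: measurableI.
  by rewrite -sumEFin; apply: eq_bigr => j _; rewrite intE//; exact: measurableI.
move: le_lr; rewrite intl intr lee_fin -/F; lra.
Qed.

End real_probability.

(** * Connection kernels and their truncations *)

Section kernels.
Context {R : realType}.
Implicit Types (k : R -> R) (r c : R).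

(** Kernels are total functions, monotone on the negative numbers too, so that
    they are measurable and can be rescaled freely. *)
Definition kernel_like (k : R -> R) := nonincreasing_fun k /\ forall u, 0 <= k u <= 1.

Lemma measurable_kernel k : kernel_like k -> measurable_fun setT k.
Proof. by move=> [k1 _]; exact: nonincreasing_measurable. Qed.

Lemma kernel_like_rescale k r : 0 <= r -> kernel_like k -> kernel_like (fun u => k (u / r)).
Proof.
move=> r0 [k1 k2]; split=> [u v uv|u]; last exact: k2.
by apply: k1; rewrite ler_wpM2r// invr_ge0.
Qed.

(** With this kernel an edge means closeness, so that statements on edges also
    estimate the probability that two vertices are close. *)
Definition ball_kernel (c u : R) : R := if u <= c then 1 else 0.

Lemma ball_kernel_like c : kernel_like (ball_kernel c).
Proof.
split=> [u v uv|u]; rewrite /ball_kernel; last by case: ifP; rewrite ?lexx ?ler01.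
have [vc|vc] := leP v c; first by rewrite (le_trans uv vc).
by case: ifP.
Qed.

(** The probability that a given point of the torus is joined to an independent
    uniform one, when the kernel is applied to their distance. *)
Definition mean_kernel d (k : R -> R) : R :=
  fine (\int[lebesgue_tuple R d]_(y in torus_cell R d) (k (enorm y))%:E).

Lemma lebesgue_torus_cell d : lebesgue_tuple R d (torus_cell R d) = 1%E.
Proof.
elim: d => [|d IH].
  have h : torus_cell R 0 [tuple] by case.
  by rewrite /= diracE mem_set.
have mS n : measurable (torus_cell R n) := @measurable_torus_cell R n.
transitivity (\int[lebesgue_tuple R d.+1]_(t in torus_cell R d.+1) cst 1 t)%E.
  by rewrite (integral_cst _ (mS _)) mul1e.
rewrite ge0_integral_torus_cellS//.
rewrite (eq_integral (cst 1%E)); last first.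
  by move=> x _; rewrite (integral_cst _ (mS _)) mul1e; exact: IH.
rewrite integral_cst//= mul1e lebesgue_measure_itv/= lte_fin.
by rewrite ifT; [rewrite -EFinD; congr EFin|]; lra.
Qed.

Lemma integral_kernel_fin d k : kernel_like k ->
  (\int[lebesgue_tuple R d]_(y in torus_cell R d) (k (enorm y))%:E)%E \is a fin_num.
Proof.
move=> kk; have [_ k01] := kk; rewrite ge0_fin_numE; last first.
  by apply: integral_ge0 => y _; rewrite lee_fin; case/andP: (k01 (enorm y)).
apply: (@le_lt_trans _ _ (\int[lebesgue_tuple R d]_(y in torus_cell R d) 1)%E).
  apply: ge0_le_integral => //.
  - exact: measurable_torus_cell.
  - by move=> y _; rewrite lee_fin; case/andP: (k01 (enorm y)).
  - apply/measurable_EFinP/measurable_funTS.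
    by apply: measurableT_comp (measurable_kernel kk) _; exact: measurable_enorm.
  - by move=> y _; rewrite lee_fin; case/andP: (k01 (enorm y)).
rewrite integral_cst; last exact: measurable_torus_cell.
by rewrite mul1e [X in (X < _)%E]lebesgue_torus_cell ltry.
Qed.

Lemma mean_kernel_rescale_le d k (r I : R) : 0 < r -> kernel_like k ->
  (\int[lebesgue_tuple R d]_y (k (enorm y))%:E = I%:E)%E ->
  mean_kernel d (fun u => k (u / r)) <= r ^+ d * I.
Proof.
move=> r0 kk kI; have kkr := kernel_like_rescale (ltW r0) kk.
have [_ k01] := kk.
rewrite -lee_fin EFinM -kI -integral_enorm_scale//; last 2 first.
- exact: measurable_kernel.
- by move=> u; case/andP: (k01 u).
rewrite /mean_kernel fineK; last exact: integral_kernel_fin kkr.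
apply: ge0_subset_integral => //.
- exact: measurable_torus_cell.
- apply/measurable_EFinP; apply: (measurableT_comp (measurable_kernel kkr)).
  exact: measurable_enorm.
- by move=> y _; rewrite lee_fin; case/andP: (k01 (enorm y / r)).
Qed.

(** At a small scale the support of the kernel fits in the cell, so that the
    torus cannot be told from the whole space. *)
Lemma mean_kernel_rescale d k (r K I : R) : 0 < r -> kernel_like k ->
  (\int[lebesgue_tuple R d]_y (k (enorm y))%:E = I%:E)%E ->
  (forall u, K < u -> k u = 0) -> K * r < 2^-1 ->
  mean_kernel d (fun u => k (u / r)) = r ^+ d * I.
Proof.
move=> r0 kk kI kK Kr; have [_ k01] := kk.
apply/EFin_inj; rewrite EFinM -kI -integral_enorm_scale//; last 2 first.
- exact: measurable_kernel.
- by move=> u; case/andP: (k01 u).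
rewrite /mean_kernel fineK; last exact: integral_kernel_fin (kernel_like_rescale (ltW r0) kk).
rewrite integral_mkcond; apply: eq_integral => y _; rewrite patchE.
case: ifPn => // yS; rewrite kK//.
rewrite ltNge; apply/negP => yK; move/negP: yS; apply; apply: mem_set => i.
have h : `|tnth y i| < 2^-1.
  apply: le_lt_trans (le_tnth_enorm y i) _; apply: le_lt_trans Kr.
  by rewrite -ler_pdivrMr.
by move: h; rewrite ltr_norml => /andP[-> /ltW].
Qed.

Lemma ball_kernel_integral d c : exists V, 0 <= V /\
  (\int[lebesgue_tuple R d]_y (ball_kernel c (enorm y))%:E = V%:E)%E.
Proof.
have mk := measurable_kernel (ball_kernel_like c).
set I := integral _ _ _.
have I0 : (0 <= I)%E.
  by apply: integral_ge0 => y _; rewrite lee_fin /ball_kernel; case: ifP.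
have mB : measurable [set y : d.-tuple R | enorm y <= c].
  have := measurable_enorm (n := d) measurableT (measurable_itv `]-oo, c]).
  by rewrite setTI; congr measurable; apply/seteqP; split=> y; rewrite /= in_itv.
have Ioo : (I < +oo)%E.
  apply: le_lt_trans (lebesgue_tuple_box_lty d c).
  have -> : I = lebesgue_tuple R d [set y | enorm y <= c].
    transitivity (\int[lebesgue_tuple R d]_y (\1_[set y | enorm y <= c] y)%:E)%E; last first.
      by rewrite integral_indic// setIT.
    apply: eq_integral => y _.
    rewrite indicE /ball_kernel; congr (_%:E).
    by case: ifPn => h; [rewrite mem_set|rewrite memNset//; exact/negP].
  rewrite le_measure ?inE//; first exact: measurable_tuple_box.
  by move=> y yc k; exact: le_trans (le_tnth_enorm y k) yc.
exists (fine I); split; first exact: fine_ge0.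
by rewrite fineK// ge0_fin_numE.
Qed.

(** The radius whose [d]-th power is [z]; at [z = gamma * ln n / (alpha * n)] it
    is the one of the theorem. *)
Definition radius d (z : R) : R := z `^ (d%:R^-1).

Lemma radius_ge0 d z : 0 <= radius d z. Proof. exact: powR_ge0. Qed.

Lemma radius_gt0 d z : 0 < z -> 0 < radius d z. Proof. exact: powR_gt0. Qed.

Lemma radiusX d z : (0 < d)%N -> 0 <= z -> radius d z ^+ d = z.
Proof.
move=> d0 z0; rewrite -powR_mulrn ?radius_ge0// -powRrM mulVf ?powRr1//.
by rewrite pnatr_eq0 -lt0n.
Qed.

Definition clamp (g : R -> R) (u : R) : R := g (Num.max u 0).

(** The truncated kernel gives fewer edges and has bounded support, so that
    vertices far apart have no common neighbour. *)
Definition cut (g : R -> R) (K u : R) : R := if u <= K then clamp g u else 0.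

Section connection_function.
Context (d : nat) (g : R -> R) (alpha : R).
Hypothesis g_range : forall r : R, 0 <= r -> 0 <= g r <= 1.
Hypothesis g_noninc : forall r s : R, 0 <= r -> r <= s -> g s <= g r.
Hypothesis alpha_gt0 : 0 < alpha.
Hypothesis alphaE : (\int[lebesgue_tuple R d]_x (g (enorm x))%:E)%E = alpha%:E.

Lemma kernel_like_clamp : kernel_like (clamp g).
Proof.
split=> [u v uv|u]; last by apply: g_range; rewrite le_max lexx orbT.
apply: g_noninc; first by rewrite le_max lexx orbT.
by rewrite ge_max !le_max lexx uv/= orbT.
Qed.

Lemma kernel_like_cut K : kernel_like (cut g K).
Proof.
have [c1 c2] := kernel_like_clamp.
split=> [u v uv|u]; rewrite /cut; last by case: ifP => // _; rewrite lexx ler01.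
have [vK|vK] := leP v K; first by rewrite (le_trans uv vK) c1.
by case: ifP => // _; case/andP: (c2 u).
Qed.

Lemma integral_clamp : (\int[lebesgue_tuple R d]_y (clamp g (enorm y))%:E = alpha%:E)%E.
Proof.
rewrite -alphaE; apply: eq_integral => y _; rewrite /clamp.
by have /max_idPl -> := enorm_ge0 y.
Qed.

(** By monotone convergence, the truncation loses an arbitrarily small fraction
    of the mean degree. *)
Lemma integral_cut (eps : R) : 0 < eps -> exists K I,
  [/\ 0 <= K, (\int[lebesgue_tuple R d]_y (cut g K (enorm y))%:E = I%:E)%E,
      (1 - eps) * alpha < I & I <= alpha].
Proof.
move=> e0; have [c1 c2] := kernel_like_clamp.
pose F (n : nat) (y : d.-tuple R) : \bar R := (cut g n%:R (enorm y))%:E.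
have mF n : measurable_fun setT (F n).
  apply/measurable_EFinP.
  by apply: (measurableT_comp (measurable_kernel (kernel_like_cut _))); exact: measurable_enorm.
have F0 n y : (0 <= F n y)%E.
  by rewrite lee_fin; case: (kernel_like_cut n%:R) => _ /(_ (enorm y))/andP[].
have ndF y : nondecreasing_seq (F ^~ y).
  move=> m n mn; rewrite /F lee_fin /cut.
  have mnR : m%:R <= n%:R :> R by rewrite ler_nat.
  case: ifPn => [h|_]; first by rewrite (le_trans h mnR).
  by case: ifP => // _; case/andP: (c2 (enorm y)).
have Fcvg : (\int[lebesgue_tuple R d]_y F n y @[n --> \oo] --> alpha%:E)%E.
  rewrite -integral_clamp.
  have -> : (\int[lebesgue_tuple R d]_y (clamp g (enorm y))%:E =
      \int[lebesgue_tuple R d]_y limn (F ^~ y))%E.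
    apply: eq_integral => y _; apply/esym/cvg_lim => //.
    apply: cvg_near_cst; exists (Num.truncn (enorm y)).+1 => // n /= hn.
    rewrite /F /cut ifT//; apply/ltW/(lt_le_trans (truncnS_gt _)).
    by rewrite ler_nat.
  by apply: cvg_monotone_convergence => // y _; exact: ndF.
have IF_le n : (\int[lebesgue_tuple R d]_y F n y <= alpha%:E)%E.
  rewrite -integral_clamp; apply: ge0_le_integral => //.
  - apply/measurable_EFinP; apply: (measurableT_comp (measurable_kernel kernel_like_clamp)).
    exact: measurable_enorm.
  - by move=> y _; rewrite lee_fin /cut; case: ifP => // _; case/andP: (c2 (enorm y)).
have IF_ge n : (0 <= \int[lebesgue_tuple R d]_y F n y)%E by exact: integral_ge0.
have [n hn] : exists n, (((1 - eps) * alpha)%:E < \int[lebesgue_tuple R d]_y F n y)%E.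
  apply: contrapT => /forallNP h.
  have : (alpha%:E <= ((1 - eps) * alpha)%:E)%E.
    rewrite -(cvg_lim _ Fcvg)//; apply: lime_le; first by apply/cvg_ex; exists alpha%:E.
    by apply: nearW => n; rewrite leNgt; apply/negP; exact: h.
  by rewrite lee_fin; have := mulr_gt0 e0 alpha_gt0; lra.
have fn : (\int[lebesgue_tuple R d]_y F n y)%E \is a fin_num.
  by rewrite ge0_fin_numE// (le_lt_trans (IF_le n))// ltry.
exists n%:R, (fine (\int[lebesgue_tuple R d]_y F n y)%E); split => //.
- by rewrite fineK.
- by rewrite -lte_fin fineK.
- by rewrite -lee_fin fineK.
Qed.

End connection_function.

End kernels.

(** * Degrees among a fixed number of vertices *)

Section connection_model.
Context {R : realType} {d : nat} {dO : measure_display} {Omega : measurableType dO}.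
Context (P : probability Omega R).
Context (X : nat -> {RV P >-> d.-tuple R}) (U : nat -> nat -> {RV P >-> R}).
Hypothesis X_unif : forall i (A : set (d.-tuple R)), measurable A ->
  distribution P (X i) A = lebesgue_tuple R d (A `&` torus_cell R d).
Hypothesis X_indep : mutually_independent P [set: nat] (fun i => sigma_of (X i)).
Hypothesis U_unif : forall i j, (i < j)%N -> forall A : set R, measurable A ->
  distribution P (U i j) A = uniform_prob (@ltr01 R) A.
Hypothesis U_indep : mutually_independent P [set ij : nat * nat | (ij.1 < ij.2)%N]
  (fun ij => sigma_of (U ij.1 ij.2)).
Hypothesis XU_indep : forall A B, sigma_of_family [set: nat] X A ->
  sigma_of_family [set ij | (ij.1 < ij.2)%N] (fun ij : nat * nat => U ij.1 ij.2) B ->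
  indep_events P A B.

Local Notation Pr := (prob P).

Lemma sigma_of_measurable d' (T : measurableType d') (Y : {RV P >-> T}) :
  sigma_of Y `<=` measurable.
Proof. by move=> _ [B mB <-]; exact: measurable_funPT. Qed.

Lemma sigma_ofT d' (T : measurableType d') (Y : Omega -> T) : sigma_of Y setT.
Proof. by exists setT => //; rewrite setTI preimage_setT. Qed.

Lemma sigma_ofI d' (T : measurableType d') (Y : Omega -> T) : setI_closed (sigma_of Y).
Proof.
move=> _ _ [A mA <-] [B mB <-]; exists (A `&` B); first exact: measurableI.
by rewrite !setTI preimage_setI.
Qed.

(** The events that involve only the positions of the vertices in [C1] and the
    marks of the pairs in [C2]. *)
Definition block (C1 : set nat) (C2 : set (nat * nat)) : set_system Omega :=
  (\bigcup_(i in C1) sigma_of (X i)) `|`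
  (\bigcup_(ij in C2) sigma_of (U ij.1 ij.2)).

Lemma block_measurable C1 C2 : block C1 C2 `<=` measurable.
Proof. by move=> A [[i _]|[ij _]]; exact: sigma_of_measurable. Qed.

Lemma sub_block (C1 D1 : set nat) (C2 D2 : set (nat * nat)) :
  C1 `<=` D1 -> C2 `<=` D2 -> <<s block C1 C2 >> `<=` <<s block D1 D2 >>.
Proof.
move=> CD1 CD2; apply: sub_sigma_algebra2; apply: setUSS;
  exact: bigcup_subset.
Qed.

Lemma block_indepX C1 C2 j A B : C2 `<=` [set ij | (ij.1 < ij.2)%N] -> ~ C1 j ->
  <<s block C1 C2 >> A -> measurable B -> indep_events P A (X j @^-1` B).
Proof.
move=> C2D C1j sA mB.
apply: (@indep_block2 _ _ _ P _ _ [set: nat] C1 [set ij | (ij.1 < ij.2)%N] C2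
  (fun i => sigma_of (X i)) (fun ij => sigma_of (U ij.1 ij.2)) j) => //.
- by move=> i; exact: sigma_of_measurable.
- by move=> i; exact: sigma_of_measurable.
- by move=> i; exact: sigma_ofT.
- by move=> i; exact: sigma_ofI.
- by exists B => //; rewrite setTI.
Qed.

Lemma block_indepU C1 C2 i j A B : C2 `<=` [set ij | (ij.1 < ij.2)%N] ->
  (i < j)%N -> ~ C2 (i, j) ->
  <<s block C1 C2 >> A -> measurable B -> indep_events P A (U i j @^-1` B).
Proof.
move=> C2D ij C2ij sA mB.
apply: (@indep_block2 _ _ _ P _ _ [set ij | (ij.1 < ij.2)%N] C2 [set: nat] C1
  (fun ij => sigma_of (U ij.1 ij.2)) (fun i => sigma_of (X i)) (i, j)) => //.
- by move=> k; exact: sigma_of_measurable.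
- by move=> k; exact: sigma_of_measurable.
- by move=> k; exact: sigma_ofT.
- by move=> k; exact: sigma_ofI.
- by move=> A1 A2 sA1 sA2; rewrite /indep_events setIC muleC; exact: XU_indep.
- by exists B => //; rewrite setTI.
- by rewrite setUC.
Qed.

Lemma measurable_block_X C1 C2 i : C1 i ->
  measurable_fun (setT : set (g_sigma_algebraType (block C1 C2)))
    (X i : g_sigma_algebraType (block C1 C2) -> d.-tuple R).
Proof.
move=> C1i _ B mB; apply: sub_sigma_algebra; left; exists i => //.
by exists B.
Qed.

Lemma measurable_block_U C1 C2 i j : C2 (i, j) ->
  measurable_fun (setT : set (g_sigma_algebraType (block C1 C2)))
    (U i j : g_sigma_algebraType (block C1 C2) -> R).
Proof.
move=> C2ij _ B mB; apply: sub_sigma_algebra; right; exists (i, j) => //.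
by exists B.
Qed.

Definition edge (k : R -> R) i j : set Omega :=
  [set w | U (minn i j) (maxn i j) w <= k (torus_dist (X i w) (X j w))].

Lemma edge_block C1 C2 k i j : kernel_like k -> C1 i -> C1 j ->
  C2 (minn i j, maxn i j) -> <<s block C1 C2 >> (edge k i j).
Proof.
move=> kk C1i C1j C2ij.
have mD : measurable_fun (setT : set (g_sigma_algebraType (block C1 C2)))
  (fun w : g_sigma_algebraType (block C1 C2) => k (torus_dist (X i w) (X j w))).
  apply: (measurableT_comp (measurable_kernel kk)).
  by apply: measurable_torus_dist; exact: measurable_block_X.
have := measurable_fun_ler (measurable_block_U (C1 := C1) C2ij) mD.
move=> /(_ measurableT [set true] Logic.I); rewrite setTI.
by congr <<s _ >>; apply/seteqP; split.
Qed.

Lemma integral_distributionX j (f : d.-tuple R -> \bar R) :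
  measurable_fun setT f -> (forall y, 0 <= f y)%E ->
  (\int[distribution P (X j)]_y f y =
   \int[lebesgue_tuple R d]_(y in torus_cell R d) f y)%E.
Proof.
move=> mf f0.
rewrite (@eq_measure_integral _ _ _ _ (distribution P (X j)) (lebesgue_tuple R d)); last first.
  by move=> A mA AS; apply/esym; rewrite -[LHS]/(distribution P (X j) A) X_unif// setIidl.
have mS := @measurable_torus_cell R d.
rewrite (@ge0_negligible_integral _ _ _ _ setT (~` torus_cell R d))//.
- by rewrite setTD setCK.
- exact: measurableC.
- have := X_unif j (measurableC mS); rewrite setICl measure0; exact.
Qed.

(** Averaging over the mark of the pair turns the edge into the kernel at the
    distance, and averaging over the position of [j] turns this into a constant,
    wherever [i] is, because the torus is homogeneous.  Each newly revealed
    vertex is therefore joined to [i] by an independent trial. *)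
Lemma prob_edge C1 C2 k i j A : kernel_like k ->
  C2 `<=` [set ij | (ij.1 < ij.2)%N] -> C1 i -> ~ C1 j ->
  ~ C2 (minn i j, maxn i j) -> <<s block C1 C2 >> A ->
  Pr (A `&` edge k i j) = mean_kernel d k * Pr A.
Proof.
move=> kk C2D C1i C1j C2ij sA.
have [_ k01] := kk.
have mk := measurable_kernel kk.
have ij : (minn i j < maxn i j)%N.
  have : i <> j by move=> ij; apply: C1j; rewrite -ij.
  by lia.
have mA : measurable A.
  by move: A sA; apply: smallest_sub; [exact: sigma_algebra_measurable|exact: block_measurable].
pose C1' := C1 `|` [set j].
have sA' : <<s block C1' C2 >> A by move: A sA mA => A + _; apply: sub_block => // ?; left.
have mdist (C : set nat) : C i -> C j ->
   measurable_fun (setT : set (g_sigma_algebraType (block C C2)))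
  (fun w : g_sigma_algebraType (block C C2) => k (torus_dist (X i w) (X j w))).
  move=> Ci Cj; apply: (measurableT_comp mk).
  by apply: measurable_torus_dist; exact: measurable_block_X.
have mK : measurable_fun setT (fun w : Omega => k (torus_dist (X i w) (X j w))).
  apply: (measurableT_comp mk); apply: measurable_torus_dist; exact: measurable_funPT.
pose K_ := isMeasurableFun.Build _ _ _ _ _ mK.
pose K : {RV P >-> R} := HB.pack (fun w : Omega => k (torus_dist (X i w) (X j w))) K_.
have mE : measurable (edge k i j).
  have := @edge_block setT setT k i j kk Logic.I Logic.I Logic.I.
  by apply: smallest_sub; [exact: sigma_algebra_measurable|exact: block_measurable].
pose f (z : R * R) : \bar R := (if z.2 <= z.1 then 1 else 0)%:E.
have mf : measurable_fun setT f.
  apply/measurable_EFinP; apply: measurable_fun_if => //.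
  by apply: measurable_fun_ler; [exact: measurable_snd|exact: measurable_fst].
have f0 z : (0 <= f z)%E by rewrite /f; case: ifP; rewrite lee_fin.
have step1 : (P (A `&` edge k i j) =
    \int[P]_(w in A) f (K w, U (minn i j) (maxn i j) w))%E.
  transitivity (\int[P]_(w in A) (\1_(edge k i j) w)%:E)%E.
    by rewrite integral_indic// setIC.
  apply: eq_integral => w _; rewrite /f indicE /=; congr (_%:E).
  by case: ifPn => h; [rewrite mem_set|rewrite memNset//; exact/negP].
have indepU B1 B : <<s block C1' C2 >> B1 -> measurable B ->
    indep_events P B1 (U (minn i j) (maxn i j) @^-1` B).
  exact: block_indepU.
have mK' : measurable_fun (setT : set (g_sigma_algebraType (block C1' C2)))
    (K : g_sigma_algebraType (block C1' C2) -> R).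
  by apply: mdist; [left|right].
have step2 : (P (A `&` edge k i j) =
    \int[P]_(w in A) (k (torus_dist (X i w) (X j w)))%:E)%E.
  rewrite step1 (@integral_freeze _ _ _ P _ _ _ _ (block C1' C2))//; last first.
    exact: block_measurable.
  apply: eq_integral => w _.
  transitivity (\int[distribution P (U (minn i j) (maxn i j))]_u (\1_`]-oo, K w] u)%:E)%E.
    apply: eq_integral => u _; rewrite /f indicE mem_setE/= in_itv/=.
    by case: ifP.
  rewrite integral_indic//= setIT.
  rewrite -[LHS]/(distribution P (U (minn i j) (maxn i j)) `]-oo, K w]%classic).
  by rewrite U_unif//; exact: uniform_prob_itv0 (k01 _).
pose f2 (z : d.-tuple R * d.-tuple R) := (k (torus_dist z.1 z.2))%:E.
have mf2 : measurable_fun setT f2.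
  apply/measurable_EFinP; apply: (measurableT_comp mk).
  by apply: measurable_torus_dist; [exact: measurable_fst|exact: measurable_snd].
have f20 z : (0 <= f2 z)%E by rewrite lee_fin; case/andP: (k01 (torus_dist z.1 z.2)).
have indepX B1 B : <<s block C1 C2 >> B1 -> measurable B -> indep_events P B1 (X j @^-1` B).
  exact: block_indepX.
rewrite /prob step2 (@integral_freeze _ _ _ P _ _ _ _ (block C1 C2) A (X i) (X j) f2)//; first last.
- exact: measurable_block_X.
- exact: block_measurable.
rewrite (eq_integral (cst (mean_kernel d k)%:E)); last first.
  move=> w _; rewrite integral_distributionX//.
  - rewrite (@integral_torus_dist _ d k)//; last by move=> u; case/andP: (k01 u).
    by rewrite fineK// integral_kernel_fin.
  - apply/measurable_EFinP; apply: (measurableT_comp mk).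
    by apply: measurable_torus_dist => //; exact: measurable_id.
by rewrite integral_cst// fineM// fin_num_measure.
Qed.

Lemma block_sub_measurable C1 C2 : <<s block C1 C2 >> `<=` measurable.
Proof.
by apply: smallest_sub; [exact: sigma_algebra_measurable|exact: block_measurable].
Qed.

Lemma measurable_edge k i j : kernel_like k -> measurable (edge k i j).
Proof.
move=> kk; apply: (@block_sub_measurable setT setT).
exact: edge_block.
Qed.

(** The neighbours are counted along a list of vertices, to be able to reveal
    them one at a time. *)
Definition deg (k : R -> R) i (J : seq nat) (w : Omega) : nat :=
  count (fun j => U (minn i j) (maxn i j) w <= k (torus_dist (X i w) (X j w))) J.

Definition deg_ge k i J s : set Omega := [set w | (s <= deg k i J w)%N].

Lemma deg_ge0 k i J : deg_ge k i J 0 = setT.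
Proof. by apply/seteqP; split. Qed.

Lemma deg_ge_nil k i s : deg_ge k i [::] s.+1 = set0.
Proof. by apply/seteqP; split. Qed.

Lemma deg_ge_cons k i j J s : deg_ge k i (j :: J) s.+1 =
  (edge k i j `&` deg_ge k i J s) `|` deg_ge k i J s.+1.
Proof.
apply/seteqP; split=> w; rewrite /deg_ge /deg /edge /=; case: (_ <= _) => /=.
- by rewrite add1n ltnS => h; left.
- by rewrite add0n; right.
- by rewrite add1n ltnS => -[[]//|]; exact: ltnW.
- by rewrite add0n => -[[]|].
Qed.

Lemma deg_ge_block C1 C2 k i J s : kernel_like k -> C1 i ->
  {in J, forall j, C1 j /\ C2 (minn i j, maxn i j)} ->
  <<s block C1 C2 >> (deg_ge k i J s).
Proof.
move=> kk C1i; elim: J s => [|j J IH] [|s] h; rewrite ?deg_ge0 ?deg_ge_nil.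
- exact: (@measurableT _ (g_sigma_algebraType (block C1 C2))).
- exact: (@measurable0 _ (g_sigma_algebraType (block C1 C2))).
- exact: (@measurableT _ (g_sigma_algebraType (block C1 C2))).
have hJ : {in J, forall j, C1 j /\ C2 (minn i j, maxn i j)}.
  by move=> l lJ; apply: h; rewrite inE lJ orbT.
have [C1j C2j] := h j (mem_head _ _).
rewrite deg_ge_cons.
apply: (@measurableU _ (g_sigma_algebraType (block C1 C2))); last exact: IH.
apply: (@measurableI _ (g_sigma_algebraType (block C1 C2))); last exact: IH.
exact: edge_block.
Qed.

Lemma measurable_deg_ge k i J s : kernel_like k -> measurable (deg_ge k i J s).
Proof. by move=> kk; apply: (@block_sub_measurable setT setT); exact: deg_ge_block. Qed.

Lemma mean_kernel_itv (k : R -> R) : kernel_like k -> 0 <= mean_kernel d k <= 1.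
Proof.
move=> kk; have := @prob_edge [set 0%N] set0 k 0 1 setT kk.
have := @measurable_edge k 0 1 kk => mE.
rewrite setTI -!/(Pr _) prob_setT mulr1 => <-//.
- by rewrite prob_ge0 prob_le1.
- exact: (@measurableT _ (g_sigma_algebraType (block _ _))).
Qed.

Lemma minn_maxn_inj i j l : (minn i j, maxn i j) = (minn i l, maxn i l) -> j = l.
Proof. by case=> h1 h2; lia. Qed.

(** Revealing the vertices of [J] one at a time gives independent trials, by
    [prob_edge]; the resulting recursion is that of [btail]. *)
Lemma prob_deg_ge C1 C2 k i J A s : kernel_like k ->
  C2 `<=` [set ij | (ij.1 < ij.2)%N] -> C1 i ->
  uniq J -> {in J, forall j, ~ C1 j /\ ~ C2 (minn i j, maxn i j)} ->
  <<s block C1 C2 >> A ->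
  Pr (A `&` deg_ge k i J s) = btail (mean_kernel d k) (size J) s * Pr A.
Proof.
move=> kk C2D C1i uJ hJ sA.
have mA := block_sub_measurable sA.
elim: J s uJ hJ => [|j J IH] [|s] uJ hJ.
- by rewrite deg_ge0 setIT btail0 mul1r.
- by rewrite deg_ge_nil setI0 /prob measure0 /= mul0r.
- by rewrite deg_ge0 setIT btail0 mul1r.
have /andP[jJ uJ'] := uJ.
have hJ' : {in J, forall j, ~ C1 j /\ ~ C2 (minn i j, maxn i j)}.
  by move=> l lJ; apply: hJ; rewrite inE lJ orbT.
have [C1j C2j] := hJ j (mem_head _ _).
pose D1 := C1 `|` [set l | l \in J].
pose D2 := C2 `|` [set (minn i l, maxn i l) | l in [set l | l \in J]].
have D2D : D2 `<=` [set ij | (ij.1 < ij.2)%N].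
  move=> _ [/C2D//|[l lJ <-]] /=.
  have [C1l _] := hJ' l lJ.
  have : i <> l by move=> il; apply: C1l; rewrite -il.
  by lia.
have D1j : ~ D1 j by case=> // jJ'; move: jJ; rewrite jJ'.
have D2j : ~ D2 (minn i j, maxn i j).
  by case=> // -[l lJ /minn_maxn_inj lj]; move: jJ; rewrite -lj lJ.
have sAD t : <<s block D1 D2 >> (A `&` deg_ge k i J t).
  apply: (@measurableI _ (g_sigma_algebraType (block D1 D2))).
    by apply: sub_block sA => ?; left.
  apply: deg_ge_block => //; first by left.
  by move=> l lJ; split; [right|right; exists l].
have mAD t : measurable (A `&` deg_ge k i J t) := block_sub_measurable (sAD t).
have mE := measurable_edge i j kk.
have pe t : Pr (A `&` deg_ge k i J t `&` edge k i j) =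
    mean_kernel d k * Pr (A `&` deg_ge k i J t).
  by apply: prob_edge (sAD t) => //; left.
rewrite deg_ge_cons.
have mW : measurable (A `&` (edge k i j `&` deg_ge k i J s `|` deg_ge k i J s.+1)).
  apply: measurableI => //; apply: measurableU; last exact: measurable_deg_ge.
  by apply: measurableI => //; exact: measurable_deg_ge.
have sub w : deg_ge k i J s.+1 w -> deg_ge k i J s w by exact: ltnW.
rewrite (prob_split mW mE).
have -> : A `&` (edge k i j `&` deg_ge k i J s `|` deg_ge k i J s.+1) `&` edge k i j =
    A `&` deg_ge k i J s `&` edge k i j.
  apply/seteqP; split=> [w [[Aw [[Ew Dw]|Dw]] Ew']|w [[Aw Dw] Ew]].
  - by split.
  - by split=> //; split=> //; exact: sub.
  - by split=> //; split=> //; left.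
have -> : (A `&` (edge k i j `&` deg_ge k i J s `|` deg_ge k i J s.+1)) `\` edge k i j =
    (A `&` deg_ge k i J s.+1) `\` edge k i j.
  apply/seteqP; split=> [w [[Aw [[Ew Dw]|Dw]] Ew']|w [[Aw Dw] Ew]] //.
  by split=> //; split=> //; right.
have := prob_split (P := P) (mAD s.+1) mE.
rewrite !pe !IH// /= => H; lra.
Qed.

(** Negative correlation of two neighbour counts.  When no fresh vertex can be
    joined to both [i] and [i'], each one falls into one of three disjoint cases
    with probabilities [p], [p] and [1 - 2 * p].  Compared with independent
    trials, the recursion for the joint tail lacks the case of probability
    [p ^ 2] in which both counts grow, and the difference,
    [p ^ 2 * (a' - a) * (b' - b)], is nonnegative. *)
Lemma prob_deg_ge_pair C1 C2 k i i' J A s t : kernel_like k -> 2 * mean_kernel d k <= 1 ->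
  C2 `<=` [set ij | (ij.1 < ij.2)%N] -> C1 i -> C1 i' -> uniq J ->
  {in J, forall j, [/\ ~ C1 j, ~ C2 (minn i j, maxn i j) & ~ C2 (minn i' j, maxn i' j)]} ->
  i <> i' ->
  <<s block C1 C2 >> A ->
  {in J, forall j, Pr (A `&` (edge k i j `&` edge k i' j)) = 0} ->
  Pr (A `&` (deg_ge k i J s `&` deg_ge k i' J t)) <=
  btail (mean_kernel d k) (size J) s * btail (mean_kernel d k) (size J) t * Pr A.
Proof.
move=> kk p2 C2D C1i C1i' uJ hJ ii' sA disjA.
have mA := block_sub_measurable sA.
have p01 := mean_kernel_itv kk.
elim: J s t uJ hJ disjA => [|j J IH] [|s] [|t] uJ hJ disjA.
1-4: rewrite ?deg_ge0 ?deg_ge_nil ?setIT ?setI0 ?set0I ?setI0 ?btail0 ?mul1r//=;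
  rewrite /prob ?measure0/= ?mul0r ?mulr0 ?mul0r//.
all: rewrite ?deg_ge0 ?setTI ?setIT ?btail0 ?mul1r ?mulr1//.
- rewrite (@prob_deg_ge C1 C2)// => l lJ; by have [] := hJ l lJ.
- rewrite (@prob_deg_ge C1 C2)// => l lJ; by have [] := hJ l lJ.
have /andP[jJ uJ'] := uJ.
have sJ l : l \in J -> l \in j :: J by move=> lJ; rewrite inE lJ orbT.
have hJ' : {in J, forall j, [/\ ~ C1 j, ~ C2 (minn i j, maxn i j) & ~ C2 (minn i' j, maxn i' j)]}.
  by move=> l /sJ; exact: hJ.
have disjA' : {in J, forall j, Pr (A `&` (edge k i j `&` edge k i' j)) = 0}.
  by move=> l /sJ; exact: disjA.
have [C1j C2j C2j'] := hJ j (mem_head _ _).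
pose D1 := C1 `|` [set l | l \in J].
pose D2 := C2 `|` ([set (minn i l, maxn i l) | l in [set l | l \in J]] `|`
                   [set (minn i' l, maxn i' l) | l in [set l | l \in J]]).
have D2D : D2 `<=` [set ij | (ij.1 < ij.2)%N].
  move=> _ [/C2D//|[] [l lJ <-]] /=; have [C1l _ _] := hJ' l lJ.
    have : i <> l by move=> il; apply: C1l; rewrite -il.
    by lia.
  have : i' <> l by move=> il; apply: C1l; rewrite -il.
  by lia.
have D1j : ~ D1 j by case=> // jJ'; move: jJ; rewrite jJ'.
have jl l : l \in J -> l <> j by move=> lJ lj; move: jJ; rewrite -lj lJ.
have neq u : C1 u -> u <> j by move=> + uj; rewrite uj.
have ij := neq _ C1i; have i'j := neq _ C1i'.
have D2j : ~ D2 (minn i j, maxn i j).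
  case=> // -[] [l lJ []] h1 h2; have lj := jl l lJ; first by lia.
  have [C1l _ _] := hJ' l lJ.
  have il : i <> l by move=> il; apply: C1l; rewrite -il.
  by lia.
have D2j' : ~ D2 (minn i' j, maxn i' j).
  case=> // -[] [l lJ []] h1 h2; have lj := jl l lJ; last by lia.
  have [C1l _ _] := hJ' l lJ.
  have il : i' <> l by move=> il; apply: C1l; rewrite -il.
  by lia.
pose B s t := A `&` (deg_ge k i J s `&` deg_ge k i' J t).
have sB s' t' : <<s block D1 D2 >> (B s' t').
  apply: (@measurableI _ (g_sigma_algebraType (block D1 D2))).
    by apply: sub_block sA => ?; left.
  apply: (@measurableI _ (g_sigma_algebraType (block D1 D2))).
    apply: deg_ge_block => //; first by left.
    by move=> l lJ; split; [right|right; left; exists l].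
  apply: deg_ge_block => //; first by left.
  by move=> l lJ; split; [right|right; right; exists l].
have mB s' t' : measurable (B s' t') := block_sub_measurable (sB s' t').
have mE := measurable_edge i j kk; have mE' := measurable_edge i' j kk.
have pe s' t' : Pr (B s' t' `&` edge k i j) = mean_kernel d k * Pr (B s' t').
  by apply: prob_edge (sB s' t') => //; left.
have pe' s' t' : Pr (B s' t' `&` edge k i' j) = mean_kernel d k * Pr (B s' t').
  by apply: prob_edge (sB s' t') => //; left.
have subd u s' w : deg_ge k u J s'.+1 w -> deg_ge k u J s' w by exact: ltnW.
set W := A `&` _.
have mW : measurable W.
  by apply: measurableI => //; apply: measurableI; exact: measurable_deg_ge.
have mEE := measurableI _ _ mE mE'.
have mN := measurableI _ _ mA mEE.
have mX := mB s t.+1; have mY := mB s.+1 t; have mZ := mB s.+1 t.+1.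
have mXE := measurableI _ _ mX mE; have mYE := measurableI _ _ mY mE'.
have mZE := measurableI _ _ mZ mE; have mZE' := measurableI _ _ mZ mE'.
have mZ1 := measurableD mZ mE; have mZ2 := measurableD mZ1 mE'.
have WB : Pr W <= Pr (B s t.+1 `&` edge k i j) + Pr (B s.+1 t `&` edge k i' j) +
    Pr ((B s.+1 t.+1 `\` edge k i j) `\` edge k i' j).
  rewrite -[leRHS]addr0 -(disjA j (mem_head _ _)).
  apply: (@le_trans _ _ (Pr (((B s t.+1 `&` edge k i j) `|` (B s.+1 t `&` edge k i' j)) `|`
    ((B s.+1 t.+1 `\` edge k i j) `\` edge k i' j) `|` (A `&` (edge k i j `&` edge k i' j))))).
    apply: le_prob => //; first by do 3 (apply: measurableU => //).
    move=> w; rewrite /W !deg_ge_cons => -[Aw [h h']].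
    have [e|e] := pselect (edge k i j w); have [e'|e'] := pselect (edge k i' j w).
    - by right.
    - do 3 left; split=> //; split=> //; split.
        by case: h => [[]|]// /subd.
      by case: h' => [[]|].
    - left; left; right; split=> //; split=> //; split.
        by case: h => [[]|].
      by case: h' => [[]|]// /subd.
    - left; right; split=> //; split=> //; split=> //; split.
        by case: h => [[]|].
      by case: h' => [[]|].
  have mU1 := measurableU _ _ mXE mYE; have mU2 := measurableU _ _ mU1 mZ2.
  apply: (le_trans (probU_le mU2 mN)); rewrite lerD2r.
  apply: (le_trans (probU_le mU1 mZ2)); rewrite lerD2r.
  exact: probU_le.
have ZE : Pr ((B s.+1 t.+1 `\` edge k i j) `\` edge k i' j) =
    (1 - 2 * mean_kernel d k) * Pr (B s.+1 t.+1).
  have h1 := prob_split (P := P) mZ mE; have h2 := prob_split (P := P) mZ1 mE'.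
  have h3 := prob_split (P := P) mZE' mE.
  have h4 : Pr (B s.+1 t.+1 `&` edge k i' j `&` edge k i j) = 0.
    apply: (@prob_eq0_sub _ _ _ P _ (A `&` (edge k i j `&` edge k i' j))) => //.
    - exact: measurableI.
    - by move=> w [[[Aw _] e'] e].
    - by apply: disjA; exact: mem_head.
  have h5 : (B s.+1 t.+1 `\` edge k i j) `&` edge k i' j =
      (B s.+1 t.+1 `&` edge k i' j) `\` edge k i j.
    by apply/seteqP; split=> w [[? ?] ?].
  have := pe s.+1 t.+1; have := pe' s.+1 t.+1.
  rewrite h5 in h2; move: h1 h2 h3; rewrite h4; lra.
rewrite pe pe' ZE in WB.
have i1 : Pr (B s t.+1) <= _ := IH s t.+1 uJ' hJ' disjA'.
have i2 : Pr (B s.+1 t) <= _ := IH s.+1 t uJ' hJ' disjA'.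
have i3 : Pr (B s.+1 t.+1) <= _ := IH s.+1 t.+1 uJ' hJ' disjA'.
have n1 := btail_nonincr (size J) s p01; have n2 := btail_nonincr (size J) t p01.
apply: (le_trans WB) => /=.
move: p01 p2 i1 i2 i3 n1 n2; set p := mean_kernel d k.
set a' := btail p (size J) s; set a := btail p (size J) s.+1.
set b' := btail p (size J) t; set b := btail p (size J) t.+1.
move=> /andP[p0 p1] p2 i1 i2 i3 n1 n2.
apply: (@le_trans _ _ (p * (a' * b * Pr A) + p * (a * b' * Pr A) +
   (1 - 2 * p) * (a * b * Pr A))).
  by rewrite !lerD// ler_wpM2l// subr_ge0.
rewrite -subr_ge0.
have -> : (p * a' + (1 - p) * a) * (p * b' + (1 - p) * b) * Pr A -
  (p * (a' * b * Pr A) + p * (a * b' * Pr A) + (1 - 2 * p) * (a * b * Pr A)) =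
  p ^+ 2 * (a' - a) * (b' - b) * Pr A by ring.
by rewrite !mulr_ge0 ?subr_ge0 ?sqr_ge0// prob_ge0.
Qed.

Lemma prob_mark_le0 i j : i <> j -> Pr [set w | U (minn i j) (maxn i j) w <= 0] = 0.
Proof.
move=> ij.
have -> : [set w | U (minn i j) (maxn i j) w <= 0] =
    U (minn i j) (maxn i j) @^-1` `]-oo, 0].
  by apply/seteqP; split=> w; rewrite /= in_itv.
rewrite /prob -[P _]/(distribution P (U (minn i j) (maxn i j)) `]-oo, 0]%classic).
rewrite U_unif//; last by lia.
by rewrite uniform_prob_itv0//= lexx ler01.
Qed.

Definition close c i i' : set Omega := [set w | torus_dist (X i w) (X i' w) <= c].

Lemma close_block C1 C2 c i i' : C1 i -> C1 i' -> <<s block C1 C2 >> (close c i i').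
Proof.
move=> Ci Ci'.
have mD : measurable_fun (setT : set (g_sigma_algebraType (block C1 C2)))
  (fun w : g_sigma_algebraType (block C1 C2) => torus_dist (X i w) (X i' w)).
  by apply: measurable_torus_dist; exact: measurable_block_X.
have := mD measurableT `]-oo, c]%classic (measurable_itv _); rewrite setTI.
by congr <<s _ >>; apply/seteqP; split=> w; rewrite /= in_itv.
Qed.

(** For [ball_kernel c], closeness and adjacency differ by a null event of the
    mark. *)
Lemma prob_close c i i' : i <> i' -> Pr (close c i i') <= mean_kernel d (ball_kernel c).
Proof.
move=> ii'.
have mC : measurable (close c i i').
  by apply: (@block_sub_measurable setT setT); exact: close_block.
have kk := ball_kernel_like c.
have mE := measurable_edge i i' kk.
have <- : Pr (edge (ball_kernel c) i i') = mean_kernel d (ball_kernel c).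
  have := @prob_edge [set i] set0 _ i i' setT kk; rewrite setTI -!/(Pr _) prob_setT mulr1.
  apply => //; first by move=> /esym.
  exact: (@measurableT _ (g_sigma_algebraType (block _ _))).
rewrite (prob_split mC mE).
have -> : Pr (close c i i' `\` edge (ball_kernel c) i i') = 0.
  pose V : set Omega := U (minn i i') (maxn i i') @^-1` `]-oo, 1].
  have mV : measurable V by rewrite -[V]setTI; exact: measurable_funPT.
  have V1 : Pr V = 1.
    rewrite /prob -[P _]/(distribution P (U (minn i i') (maxn i i')) `]-oo, 1]%classic).
    rewrite U_unif//; last by lia.
    by rewrite uniform_prob_itv0//= lexx ler01.
  apply: (@prob_eq0_sub _ _ _ P _ (~` V)); [exact: measurableD|exact: measurableC| |].
    move=> w [Cw nE] Vw; apply: nE; rewrite /edge /= /ball_kernel Cw.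
    by move: Vw; rewrite /V /= in_itv.
  have := prob_split (P := P) measurableT mV; rewrite setTI setTD V1 prob_setT; lra.
by rewrite addr0 le_prob//; exact: measurableI.
Qed.

(** Second moment over the centres [0], ..., [q - 1], whose degrees are counted
    among the [M] next vertices.  For two centres far apart the counts are
    negatively correlated; two close centres contribute at most [pi] times the
    probability of being close, because that event only constrains their
    positions.  The weak triangle inequality gives the distance beyond which
    centres have no common neighbour. *)
Lemma prob_no_large_deg k q M s (c : R) :
  let pi := btail (mean_kernel d k) M s in
  kernel_like k -> 2 * mean_kernel d k <= 1 ->
  (forall u, c < u -> k u <= 0) -> (0 < q)%N -> 0 < pi ->
  Pr (\bigcap_(i : 'I_q) ~` deg_ge k i (iota q M) s) <=
  (q%:R * pi)^-1 + mean_kernel d (ball_kernel (Num.sqrt d%:R * (2 * c))) / pi.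
Proof.
move=> pi kk p2 kc q0 pi0.
set pc := mean_kernel d _.
have pc0 : 0 <= pc by case/andP: (mean_kernel_itv (ball_kernel_like (Num.sqrt d%:R * (2 * c)))).
pose E (i : 'I_q) := deg_ge k i (iota q M) s.
have mE i : measurable (E i) by exact: measurable_deg_ge.
have sT G : <<s G >> [set: Omega] := @measurableT _ (g_sigma_algebraType G).
have pE i : Pr (E i) = pi.
  have := @prob_deg_ge [set nat_of_ord i] set0 k i (iota q M) setT s kk.
  rewrite setTI prob_setT mulr1 size_iota; apply => //.
  - exact: iota_uniq.
  - move=> j; rewrite mem_iota => /andP[qj _]; split=> // /= ji.
    by have := ltn_ord i; rewrite -ji; lia.
have := second_moment (P := P) mE (ltW pi0) pE.
set F := \bigcap_i _ => H.
have pair i j : Pr (E i `&` E j) <= (i == j)%:R * pi + (pc * pi + pi ^+ 2).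
  have [->|ij] := eqVneq i j.
    by rewrite setIid pE mul1r lerDl addr_ge0 ?sqr_ge0 ?mulr_ge0// ltW.
  rewrite mul0r add0r.
  have ij' : (i : nat) <> j by move=> /ord_inj/eqP; apply/negP.
  pose C := close (Num.sqrt d%:R * (2 * c)) i j.
  have C1 : <<s block [set (i : nat); (j : nat)] set0 >> C.
    by apply: close_block; [left|right].
  have C1' : <<s block [set (i : nat); (j : nat)] set0 >> (~` C).
    exact: (@measurableC _ (g_sigma_algebraType _)).
  have mC := block_sub_measurable C1.
  have mEE := measurableI _ _ (mE i) (mE j).
  rewrite (prob_split mEE mC).
  have fresh l : l \in iota q M -> ~ [set (i : nat); (j : nat)] l.
    rewrite mem_iota => /andP[ql _] [] /= li; subst l.
      by have := ltn_ord i; lia.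
    by have := ltn_ord j; lia.
  apply: lerD.
    apply: (@le_trans _ _ (Pr (C `&` E i))).
      apply: le_prob; [exact: measurableI|exact: measurableI|].
      by move=> w [[Ei _] Cw].
    rewrite (@prob_deg_ge [set (i : nat); (j : nat)] set0)//.
    - by rewrite size_iota mulrC ler_wpM2r ?(ltW pi0)// prob_close.
    - by left.
    - exact: iota_uniq.
    - by move=> l /fresh ?; split=> // -[].
  rewrite setDE setIC.
  apply: (le_trans (@prob_deg_ge_pair [set (i : nat); (j : nat)] set0 k i j _ _ s s
    kk p2 _ _ _ _ _ _ C1' _)) => //.
  - by left.
  - by right.
  - exact: iota_uniq.
  - by move=> l /fresh ?; split=> // -[].
  - move=> l lJ; have fl := fresh l lJ.
    have il : (i : nat) <> l by move=> il; apply: fl; left.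
    have jl : (j : nat) <> l by move=> jl; apply: fl; right.
    pose V u : set Omega := [set w | U (minn u l) (maxn u l) w <= 0].
    have mV u : measurable (V u).
      have -> : V u = U (minn u l) (maxn u l) @^-1` `]-oo, 0].
        by apply/seteqP; split=> w; rewrite /= in_itv.
      by rewrite -[X in measurable X]setTI; exact: measurable_funPT.
    apply: (@prob_eq0_sub _ _ _ P _ (V i `|` V j)).
    + by apply: measurableI; [exact: measurableC|apply: measurableI; exact: measurable_edge].
    + exact: measurableU.
    + move=> w [nC [ei ej]].
      have [h|h] := leP (torus_dist (X i w) (X l w)) c; last first.
        by left; rewrite /V/=; apply: (le_trans ei); exact: kc.
      have [h'|h'] := leP (torus_dist (X j w) (X l w)) c; last first.
        by right; rewrite /V/=; apply: (le_trans ej); exact: kc.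
      by exfalso; apply: nC; exact: torus_dist_common h h'.
    + apply/eqP; rewrite eq_le prob_ge0 andbT.
      by rewrite (le_trans (probU_le (mV i) (mV j)))// !prob_mark_le0// addr0.
  - by rewrite size_iota -/pi -expr2 ler_piMr ?sqr_ge0// prob_le1//; exact: measurableC.
have sumle : \sum_i \sum_j Pr (E i `&` E j) <=
    q%:R * pi + q%:R ^+ 2 * (pc * pi + pi ^+ 2).
  apply: (@le_trans _ _ (\sum_(i < q) (pi + q%:R * (pc * pi + pi ^+ 2)))).
    apply: ler_sum => i _.
    apply: (le_trans (ler_sum _ (fun j _ => pair i j))).
    rewrite big_split/= sumr_const card_ord -[X in _ + X]mulr_natl lerD2r.
    rewrite (bigD1 i)//= eqxx mul1r big1 ?addr0// => j ji.
    by rewrite eq_sym (negbTE ji) mul0r.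
  rewrite sumr_const card_ord -[leLHS]mulr_natl.
  by rewrite le_eqVlt; apply/orP; left; apply/eqP; ring.
have q0' : 0 < q%:R :> R by rewrite ltr0n.
have qpi : 0 < (q%:R * pi) ^+ 2 by rewrite exprn_gt0// mulr_gt0.
rewrite -(ler_pM2l qpi).
have -> : (q%:R * pi) ^+ 2 * ((q%:R * pi)^-1 + pc / pi) =
    q%:R * pi + q%:R ^+ 2 * (pc * pi).
  by field; rewrite !gt_eqF.
rewrite -/F in H *; move: (le_trans H sumle); rewrite exprMn; lra.
Qed.

Lemma prob_some_large_deg k m s : kernel_like k ->
  Pr (\bigcup_(i < m) deg_ge k i [seq j <- iota 0 m | j != i] s) <=
  m%:R * btail (mean_kernel d k) m.-1 s.
Proof.
move=> kk; apply: prob_bigcup_le => [i|i im]; first exact: measurable_deg_ge.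
have := @prob_deg_ge [set i] set0 k i [seq j <- iota 0 m | j != i] setT s kk.
rewrite setTI prob_setT mulr1 size_filter.
have -> : count (fun j => j != i) (iota 0 m) = m.-1.
  have := count_predC (pred1 i) (iota 0 m); rewrite size_iota.
  rewrite count_uniq_mem ?iota_uniq// mem_iota add0n im /= add1n.
  by move=> h; rewrite -[in RHS]h; exact: eq_count.
move=> -> //.
- by rewrite filter_uniq// iota_uniq.
- by move=> j; rewrite mem_filter => /andP[/eqP ji _]; split.
- exact: (@measurableT _ (g_sigma_algebraType (block [set i] set0))).
Qed.

(** * The maximum degree *)

Section connection_function.
Context (g : R -> R) (alpha : R).
Hypothesis g_range : forall r : R, 0 <= r -> 0 <= g r <= 1.
Hypothesis g_noninc : forall r s : R, 0 <= r -> r <= s -> g s <= g r.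
Hypothesis alpha_gt0 : 0 < alpha.
Hypothesis alphaE : (\int[lebesgue_tuple R d]_x (g (enorm x))%:E)%E = alpha%:E.
Hypothesis d_gt0 : (0 < d)%N.

(** All degrees in [max_degree] for [n] between [b] and [b'] are dominated when
    the most vertices, the largest radius and the smallest threshold of the
    interval are taken together. *)
Definition upper_event (gamma y eps : R) (b b' : nat) : set Omega :=
  let m := Num.truncn ((1 + eps) * b'%:R) in
  \bigcup_(i < m) deg_ge
    (fun u => clamp g (u / radius d (gamma * ln b'%:R / (alpha * b%:R)))) i
    [seq j <- iota 0 m | j != i] (Num.truncn (gamma * y * ln b%:R)).+1.

(** In the opposite direction: the fewest vertices, the smallest radius and the
    largest threshold.  The first [eps * b] vertices serve as centres, and their
    degrees are counted among the following ones. *)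
Definition lower_event (gamma y eps K : R) (b b' : nat) : set Omega :=
  let q := Num.truncn (eps * b%:R) in
  \bigcap_(i : 'I_q) ~` deg_ge
    (fun u => cut g K (u / radius d (gamma * ln b%:R / (alpha * b'%:R)))) i
    (iota q (Num.truncn ((1 - 2 * eps) * b%:R))) (Num.truncn (gamma * y * ln b'%:R)).+1.

Lemma measurable_upper_event gamma y eps b b' : measurable (upper_event gamma y eps b b').
Proof.
apply: bigcup_measurable => i _; apply: measurable_deg_ge.
exact: kernel_like_rescale (radius_ge0 _ _) (kernel_like_clamp g_range g_noninc).
Qed.

Lemma measurable_lower_event gamma y eps K b b' : measurable (lower_event gamma y eps K b b').
Proof.
apply: fin_bigcap_measurable => // i _; apply: measurableC; apply: measurable_deg_ge.
exact: kernel_like_rescale (radius_ge0 _ _) (kernel_like_cut g_range g_noninc K).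
Qed.

Lemma prob_upper_event gamma y : 0 < gamma -> 1 < y -> 1 < gamma * rateH y ->
  exists delta eps b0, [/\ 0 < delta, 0 < eps, eps < 1, (2 <= b0)%N &
    forall b b', (b0 <= b)%N -> (b <= b')%N -> b'%:R <= (1 + eps) * b%:R ->
    (P (upper_event gamma y eps b b') <= (4 * expR (- (delta * ln b%:R)))%:E)%E].
Proof.
move=> g0 y1 gH.
have [delta [eps [b0 [d0 e0 e1 H]]]] := upper_tail_estimate g0 y1 gH.
exists delta, eps, (maxn 2 b0); split=> //; first by rewrite leq_maxl.
move=> b b'; rewrite geq_max => /andP[b2 bb0] bb' b'b.
have bR : 0 < b%:R :> R by rewrite ltr0n (leq_trans _ b2).
have lb' : 0 < ln (b'%:R : R) by rewrite ln_gt0// ltr1n (leq_trans b2).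
set r := radius d (gamma * ln b'%:R / (alpha * b%:R)).
have z0 : 0 < gamma * ln b'%:R / (alpha * b%:R) by rewrite divr_gt0 ?mulr_gt0.
have r0 : 0 < r by rewrite radius_gt0.
have kk := kernel_like_rescale (ltW r0) (kernel_like_clamp g_range g_noninc).
rewrite probE ?lee_fin; last exact: measurable_upper_event.
apply: (le_trans (prob_some_large_deg _ _ kk)).
apply: (H b b') => //.
- by rewrite truncn_le mulr_ge0// addr_ge0// ltW.
- exact: mean_kernel_itv.
- apply: (le_trans (mean_kernel_rescale_le r0
    (kernel_like_clamp g_range g_noninc) (integral_clamp alphaE))).
  rewrite radiusX ?(ltW z0)// le_eqVlt; apply/orP; left; apply/eqP.
  by field; rewrite (gt_eqF alpha_gt0) (gt_eqF bR).
- by rewrite ltW// truncnS_gt.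
Qed.

(** Each centre succeeds with probability at least [b ^ (2 * delta - 1)]; there
    are about [eps * b] of them, and two are close with probability of order
    [ln b / b].  Both terms of [prob_no_large_deg] are then of order at most
    [b ^ (- delta)]. *)
Lemma prob_lower_event gamma y : 0 < gamma -> 1 < y -> gamma * rateH y < 1 ->
  exists delta eps K C b0, [/\ 0 < delta, 0 < eps, eps < 1 / 2, 0 <= C /\ (2 <= b0)%N &
    forall b b', (b0 <= b)%N -> (b <= b')%N -> b'%:R <= (1 + eps) * b%:R ->
    (P (lower_event gamma y eps K b b') <= (C * expR (- (delta * ln b%:R)))%:E)%E].
Proof.
move=> g0 y1 gH.
have [delta [eps [b1 [d0 e0 e1 H]]]] := lower_tail_estimate g0 y1 gH.
have [K [I [K0 cI I1 I2]]] := integral_cut g_range g_noninc alpha_gt0 alphaE e0.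
have [V [V0 cV]] := ball_kernel_integral d (Num.sqrt d%:R * (2 * K)).
have y0 : 0 < y by lra.
have Ipos : 0 < I by apply: lt_trans I1; rewrite mulr_gt0//; lra.
(* The radius tends to 0, so that eventually balls of radius [K * r] fit in
   the torus and the mean kernel is small. *)
have [eta [eta0 eta1 eta2]] : exists eta, [/\ 0 < eta, eta <= 4^-1 / gamma &
    eta <= (2 * (K + 1)) ^- d * alpha / (2 * gamma)].
  exists (Num.min (4^-1 / gamma) ((2 * (K + 1)) ^- d * alpha / (2 * gamma))).
  split; [|by rewrite ge_min lexx|by rewrite ge_min lexx orbT].
  rewrite lt_min; apply/andP; split; first by rewrite divr_gt0.
  by rewrite divr_gt0 ?mulr_gt0 ?invr_gt0 ?exprn_gt0//; lra.
have [L L1 hL] := @ln_le_linear R 0 eta eta0.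
exists delta, eps, K, (2 / eps + gamma * V / (alpha * delta)),
  (maxn (maxn 2 b1) (maxn (Num.truncn L).+1 (Num.truncn (2 / eps)).+1)); split=> //.
- by lra.
- split; last by rewrite !leq_max.
  by apply: addr_ge0; rewrite divr_ge0 ?mulr_ge0 ?(ltW g0) ?(ltW alpha_gt0) ?(ltW d0) ?(ltW e0).
move=> b b'; rewrite !geq_max => /andP[/andP[b2 bb1] /andP[bL be]] bb' b'b.
have bR : 0 < b%:R :> R by rewrite ltr0n (leq_trans _ b2).
have b'R : 0 < b'%:R :> R by rewrite ltr0n (leq_trans _ (leq_trans b2 bb')).
have bb'R : b%:R <= b'%:R :> R by rewrite ler_nat.
have lb : 0 < ln (b%:R : R) by rewrite ln_gt0// ltr1n.
have lb' : 0 < ln (b'%:R : R) by rewrite ln_gt0// ltr1n (leq_trans b2).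
have hlb : ln b%:R <= eta * b%:R.
  have := hL b%:R; rewrite addr0; apply; apply/ltW/(lt_le_trans (truncnS_gt _)).
  by rewrite ler_nat.
have heb : 2 <= eps * b%:R.
  rewrite mulrC -ler_pdivrMr//; apply/ltW/(lt_le_trans (truncnS_gt _)).
  by rewrite ler_nat.
set z := gamma * ln b%:R / (alpha * b'%:R).
have z0 : 0 < z by rewrite divr_gt0 ?mulr_gt0.
set r := radius d z.
have r0 : 0 < r by rewrite radius_gt0.
have rX : r ^+ d = z by rewrite radiusX// ltW.
have zle : z <= gamma * eta / alpha.
  rewrite /z ler_pdivrMr ?mulr_gt0//.
  have -> : gamma * eta / alpha * (alpha * b'%:R) = gamma * (eta * b'%:R).
    by field; rewrite gt_eqF.
  by rewrite ler_pM2l// (le_trans hlb)// ler_pM2l.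
have Kr : K * r < 2^-1.
  have K1 : 0 < K + 1 by lra.
  have rho0 : 0 < (2 * (K + 1))^-1 by rewrite invr_gt0 mulr_gt0.
  have rlt : r < (2 * (K + 1))^-1.
    rewrite -(ltr_pXn2r d_gt0) ?nnegrE ?(ltW r0) ?(ltW rho0)//.
    rewrite rX (le_lt_trans zle)// exprVn.
    apply: (@le_lt_trans _ _ (2^-1 * (2 * (K + 1)) ^- d)); last first.
      by rewrite gtr_pMl ?invr_gt0 ?exprn_gt0 ?mulr_gt0// invf_lt1// ltr1n.
    rewrite ler_pdivrMr// -ler_pdivlMl//.
    have -> : gamma^-1 * (2^-1 * (2 * (K + 1)) ^- d * alpha) =
      (2 * (K + 1)) ^- d * alpha / (2 * gamma).
      by rewrite invfM; ring.
    exact: eta2.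
  have h1 : (K + 1) * r < (K + 1) * (2 * (K + 1))^-1 by rewrite ltr_pM2l.
  have h2 : (K + 1) * (2 * (K + 1))^-1 = 2^-1 by field; rewrite gt_eqF.
  by rewrite h2 in h1; apply: lt_trans h1; rewrite ltr_pM2r// ltrDl.
set k := fun u => cut g K (u / r).
have kk : kernel_like k := kernel_like_rescale (ltW r0) (kernel_like_cut g_range g_noninc K).
have cutK u : K < u -> cut g K u = 0 by move=> Ku; rewrite /cut leNgt Ku.
have pE : mean_kernel d k = gamma * ln b%:R / b'%:R * (I / alpha).
  rewrite (@mean_kernel_rescale _ d (cut g K) r K I)//; last first.
    exact: (kernel_like_cut g_range g_noninc).
  by rewrite rX /z; field; rewrite (gt_eqF alpha_gt0) (gt_eqF b'R).
have gl0 : 0 < gamma * ln b%:R / b'%:R by rewrite divr_gt0 ?mulr_gt0.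
have p2 : mean_kernel d k <= gamma * ln b%:R / b'%:R.
  by rewrite pE ger_pMr// ler_pdivrMr// mul1r.
have p1 : (1 - eps) * (gamma * ln b%:R / b'%:R) <= mean_kernel d k.
  by rewrite pE mulrC ler_pM2l// ler_pdivlMr// ltW.
have p12 : 2 * mean_kernel d k <= 1.
  suff : mean_kernel d k <= 4^-1 by lra.
  apply: (le_trans p2); rewrite ler_pdivrMr// -ler_pdivlMl//.
  apply: (le_trans hlb); apply: (@le_trans _ _ (4^-1 / gamma * b'%:R)).
    by apply: ler_pM => //; exact: ltW.
  by rewrite le_eqVlt; apply/orP; left; apply/eqP; ring.
pose q := Num.truncn (eps * b%:R).
pose M := Num.truncn ((1 - 2 * eps) * b%:R).
pose s := (Num.truncn (gamma * y * ln b'%:R)).+1.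
have eb0 : 0 <= eps * b%:R by rewrite mulr_ge0 ?ltW.
have eb2 : 0 <= (1 - 2 * eps) * b%:R by rewrite mulr_ge0 ?(ltW bR)//; lra.
have x0 : 0 <= gamma * y * ln b'%:R by rewrite !mulr_ge0// ltW.
have hq : eps * b%:R / 2 <= q%:R.
  by have := truncnS_gt (eps * b%:R); rewrite -natr1 -/q; lra.
have hM1 : (1 - 2 * eps) * b%:R - 1 <= M%:R.
  by have := truncnS_gt ((1 - 2 * eps) * b%:R); rewrite -natr1 -/M; lra.
have hM2 : M%:R <= b%:R :> R.
  have : M%:R <= (1 - 2 * eps) * b%:R by rewrite truncn_le.
  by move=> /le_trans; apply; rewrite ger_pMl//; lra.
have hs1 : gamma * y * ln b'%:R <= s%:R by rewrite ltW// truncnS_gt.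
have hs2 : s%:R <= gamma * y * ln b'%:R + 1 by rewrite -natr1 lerD2r truncn_le.
have hpi := H b b' M s _ bb1 bb' b'b hM1 hM2 p1 p2 hs1 hs2.
have q0 : (0 < q)%N by rewrite truncn_gt0; lra.
have pi0 : 0 < btail (mean_kernel d k) M s by apply: lt_le_trans hpi; exact: expR_gt0.
rewrite probE ?lee_fin; last exact: measurable_lower_event.
have kz u : K * r < u -> k u <= 0.
  by move=> h; rewrite /k cutK// ltr_pdivlMr.
apply: (le_trans (prob_no_large_deg kk p12 kz q0 pi0)).
have -> : mean_kernel d (ball_kernel (Num.sqrt d%:R * (2 * (K * r)))) =
    mean_kernel d (fun u => ball_kernel (Num.sqrt d%:R * (2 * K)) (u / r)).
  congr (mean_kernel d _); apply/funext => u; rewrite /ball_kernel ler_pdivrMr//.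
  by have -> : Num.sqrt d%:R * (2 * (K * r)) = Num.sqrt d%:R * (2 * K) * r by ring.
have hV := mean_kernel_rescale_le r0 (ball_kernel_like (Num.sqrt d%:R * (2 * K))) cV.
rewrite rX in hV.
set pi := btail _ _ _ in hpi pi0 *.
set l : R := ln b%:R in hlb lb hpi *.
set E := expR (- (delta * l)).
have E0 : 0 < E by exact: expR_gt0.
have E1 : E <= 1 by rewrite expR_le1 oppr_le0 mulr_ge0 ?ltW.
have piE : pi^-1 <= b%:R * E ^+ 2.
  apply: (@le_trans _ _ (expR ((1 - 2 * delta) * l))).
    rewrite -[leRHS]invrK lef_pV2 ?posrE ?invr_gt0 ?expR_gt0//.
    by rewrite -expRN.
  rewrite -[b%:R]lnK ?posrE// -/l /E -expRM_natl -expRD ler_expR.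
  by rewrite le_eqVlt; apply/orP; left; apply/eqP; ring.
have lE : l * E <= delta^-1.
  rewrite -[leRHS]mul1r ler_pdivlMr// mulrAC mulrC /E.
  apply: (@le_trans _ _ (expR (- (delta * l)) * expR (delta * l))).
    rewrite ler_pM2l//; apply: le_trans (expR_ge1Dx _); rewrite mulrC; lra.
  by rewrite -expRD addNr expR0.
rewrite [leRHS]mulrDl; apply: lerD.
  rewrite invfM; apply: (@le_trans _ _ ((eps * b%:R / 2)^-1 * (b%:R * E ^+ 2))).
    apply: ler_pM => //; rewrite ?invr_ge0 ?ler0n ?(ltW pi0)//.
    rewrite lef_pV2 ?posrE ?ltr0n// divr_gt0// mulr_gt0//.
  have -> : (eps * b%:R / 2)^-1 * (b%:R * E ^+ 2) = 2 / eps * E ^+ 2.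
    by field; rewrite (gt_eqF e0) (gt_eqF bR).
  rewrite ler_pM2l ?divr_gt0// expr2 -[leRHS]mulr1 ler_pM2l//.
apply: (@le_trans _ _ ((gamma * l / (alpha * b%:R) * V) * (b%:R * E ^+ 2))).
  apply: ler_pM => //; rewrite ?invr_ge0 ?(ltW pi0)//.
    by case/andP: (mean_kernel_itv (kernel_like_rescale (ltW r0)
      (ball_kernel_like (Num.sqrt d%:R * (2 * K))))).
  apply: (le_trans hV); rewrite ler_wpM2r// /z ler_pM2l ?mulr_gt0//.
  by rewrite lef_pV2 ?posrE ?mulr_gt0// ler_pM2l.
have -> : gamma * l / (alpha * b%:R) * V * (b%:R * E ^+ 2) = gamma * V / alpha * (l * E) * E.
  by field; rewrite (gt_eqF alpha_gt0) (gt_eqF bR).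
rewrite ler_pM2r//.
have -> : gamma * V / (alpha * delta) = gamma * V / alpha * delta^-1 by rewrite invfM mulrA.
by rewrite ler_wpM2l// divr_ge0 ?mulr_ge0 ?(ltW g0) ?(ltW alpha_gt0).
Qed.

Context (N : nat -> {RV P >-> nat}).
Hypothesis N_poisson : forall n k, (0 < n)%N ->
  distribution P (N n) [set k] = (poisson_pmf n%:R k)%:E.
Context (gamma : R) (rhat : nat -> R) (Delta : nat -> Omega -> nat).
Hypothesis gamma_gt0 : 0 < gamma.
Hypothesis rhat_ge0 : forall n, (0 < n)%N -> 0 <= rhat n.
Hypothesis rhatE : forall n, (0 < n)%N ->
  rhat n ^+ d = gamma * ln n%:R / (alpha * n%:R).
Hypothesis DeltaE : forall n w, (0 < n)%N ->
  Delta n w = max_degree (random_graph X N U g n (rhat n) w).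

Definition neighbour (r : R) (w : Omega) (i j : nat) : bool :=
  (i != j) && (U (minn i j) (maxn i j) w <= g (torus_dist (X i w) (X j w) / r)).

Lemma card_neighbour r w m (i : 'I_m) :
  #|[pred j | connection_graph (X ^~ w) (fun i j => U i j w) g r i j]| =
  count (neighbour r w i) (iota 0 m).
Proof.
rewrite -val_enum_ord count_map cardE size_filter -enumT.
by apply: eq_count => j.
Qed.

Lemma rhat_gt0 n : (1 < n)%N -> 0 < rhat n.
Proof.
move=> n1; have n0 : (0 < n)%N by exact: ltnW.
rewrite lt0r rhat_ge0// andbT; apply/eqP => rh.
have := rhatE n0; rewrite rh expr0n gtn_eqF//= => /esym/eqP.
by rewrite gt_eqF// divr_gt0 ?mulr_gt0// ?ltr0n// ln_gt0// ltr1n.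
Qed.

(** The degrees increase with the number of vertices and, the connection function
    being non-increasing, with the radius. *)
Lemma max_degree_upper_event y eps b b' n w : (1 < b)%N -> (b <= n <= b')%N ->
  0 <= eps -> 0 < y -> (N n w)%:R <= (1 + eps) * n%:R ->
  ~ upper_event gamma y eps b b' w -> (Delta n w)%:R <= gamma * y * ln n%:R.
Proof.
move=> b1 /andP[bn nb'] e0 y0 Nn; apply: contra_notP => /negP; rewrite -ltNge => Dn.
have n1 : (1 < n)%N by exact: leq_trans bn.
have n0 : (0 < n)%N by exact: ltnW.
have b0 : (0 < b)%N by exact: ltnW.
have bR : 0 < b%:R :> R by rewrite ltr0n.
have nR : 0 < n%:R :> R by rewrite ltr0n.
have b'0 : (0 < b')%N by exact: leq_trans nb'.
have lnb : ln b%:R <= ln n%:R :> R by rewrite ler_ln ?posrE ?ltr0n// ler_nat.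
have lnb' : ln n%:R <= ln b'%:R :> R by rewrite ler_ln ?posrE ?ltr0n// ler_nat.
have lnn : 0 < ln n%:R :> R by rewrite ln_gt0// ltr1n.
have lbb : 0 < ln b%:R :> R by rewrite ln_gt0// ltr1n.
set s := (Num.truncn (gamma * y * ln b%:R)).+1.
have sD : (s <= Delta n w)%N.
  rewrite /s truncn_lt_nat ?mulr_ge0 ?(ltW gamma_gt0) ?(ltW y0) ?(ltW lbb)//.
  apply: le_lt_trans Dn; rewrite ler_wpM2l// mulr_ge0 ?(ltW gamma_gt0) ?(ltW y0)//.
set m := Num.truncn ((1 + eps) * b'%:R).
have Nm : (N n w <= m)%N.
  rewrite /m truncn_ge_nat; last by rewrite mulr_ge0// addr_ge0.
  apply: (le_trans Nn); rewrite ler_wpM2l ?addr_ge0// ler_nat//.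
set r := radius d (gamma * ln b'%:R / (alpha * b%:R)).
have rr : rhat n <= r.
  rewrite -(ler_pXn2r d_gt0) ?nnegrE ?rhat_ge0 ?radius_ge0// rhatE// radiusX//; last first.
    by rewrite divr_ge0 ?mulr_ge0 ?(ltW gamma_gt0) ?(ltW alpha_gt0) ?(le_trans (ltW lnn) lnb').
  apply: ler_pM; rewrite ?invr_ge0 ?mulr_ge0 ?(ltW gamma_gt0) ?(ltW alpha_gt0) ?(ltW lnn)//.
    by rewrite ler_pM2l.
  by rewrite lef_pV2 ?posrE ?mulr_gt0// ler_pM2l// ler_nat.
have r0 := rhat_gt0 n1.
have rpos : 0 < r by exact: lt_le_trans rr.
have [i hi] : exists i : 'I_(N n w), (s <= count (neighbour (rhat n) w i) (iota 0 (N n w)))%N.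
  apply: contrapT => /forallNP h.
  have : (Delta n w <= s.-1)%N.
    rewrite DeltaE// /max_degree; apply/bigmax_leqP => i _.
    by have /negP := h i; rewrite -ltnNge ltnS card_neighbour.
  by rewrite leqNgt (leq_trans _ sD).
exists (i : nat); first by exact: leq_trans (ltn_ord i) Nm.
rewrite /deg_ge /=; apply: (leq_trans hi); rewrite /deg count_filter.
apply: (@leq_trans (count (neighbour (rhat n) w i) (iota 0 m))).
  by rewrite -(subnKC Nm) iotaD count_cat leq_addr.
apply: sub_count => j /andP[ij Ue] /=; rewrite eq_sym ij andbT.
apply: (le_trans Ue); rewrite /clamp.
have D0 := torus_dist_ge0 (X i w) (X j w).
have /max_idPl -> : 0 <= torus_dist (X i w) (X j w) / r by rewrite divr_ge0// ltW.
apply: g_noninc; first by rewrite divr_ge0// ltW.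
by rewrite ler_wpM2l// lef_pV2 ?posrE.
Qed.

Lemma max_degree_lower_event y eps K b b' n w : (1 < b)%N -> (b <= n <= b')%N ->
  0 < eps < 1 / 2 -> 0 < y -> (1 - eps) * n%:R <= (N n w)%:R ->
  ~ lower_event gamma y eps K b b' w -> gamma * y * ln n%:R <= (Delta n w)%:R.
Proof.
move=> b1 /andP[bn nb'] /andP[e0 e1] y0 Nn; apply: contra_notP => /negP; rewrite -ltNge => Dn.
have n1 : (1 < n)%N by exact: leq_trans bn.
have n0 : (0 < n)%N by exact: ltnW.
have b0 : (0 < b)%N by exact: ltnW.
have bR : 0 < b%:R :> R by rewrite ltr0n.
have nR : 0 < n%:R :> R by rewrite ltr0n.
have b'0 : (0 < b')%N by exact: leq_trans nb'.
have b'R : 0 < b'%:R :> R by rewrite ltr0n.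
have lnb : ln b%:R <= ln n%:R :> R by rewrite ler_ln ?posrE ?ltr0n// ler_nat.
have lnb' : ln n%:R <= ln b'%:R :> R by rewrite ler_ln ?posrE ?ltr0n// ler_nat.
have lnn : 0 < ln n%:R :> R by rewrite ln_gt0// ltr1n.
have lbb : 0 < ln b%:R :> R by rewrite ln_gt0// ltr1n.
have z0 : 0 < gamma * ln b%:R / (alpha * b'%:R) by rewrite divr_gt0 ?mulr_gt0.
move=> i _ /=; rewrite /deg_ge /= => hi.
set q := Num.truncn (eps * b%:R) in i hi.
set M := Num.truncn ((1 - 2 * eps) * b%:R) in hi.
set r := radius d _ in hi.
have rpos : 0 < r by exact: radius_gt0.
have rr : r <= rhat n.
  rewrite -(ler_pXn2r d_gt0) ?nnegrE ?rhat_ge0 ?radius_ge0// rhatE// radiusX ?(ltW z0)//.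
  apply: ler_pM; rewrite ?invr_ge0 ?mulr_ge0 ?(ltW gamma_gt0) ?(ltW alpha_gt0) ?(ltW lbb)//.
    by rewrite ler_pM2l.
  by rewrite lef_pV2 ?posrE ?mulr_gt0// ler_pM2l// ler_nat.
have qM : (q + M <= N n w)%N.
  rewrite -(ler_nat R) natrD; apply: le_trans Nn.
  have hq : q%:R <= eps * b%:R by rewrite /q truncn_le mulr_ge0// ltW.
  have hM : M%:R <= (1 - 2 * eps) * b%:R.
    by rewrite /M truncn_le mulr_ge0 ?(ltW bR)//; lra.
  apply: (@le_trans _ _ ((1 - eps) * b%:R)); first lra.
  by rewrite ler_pM2l ?ler_nat//; lra.
have iN : (i < N n w)%N.
  by apply: leq_trans (ltn_ord i) _; apply: leq_trans (leq_addr _ _) qM.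
have : (Num.truncn (gamma * y * ln b'%:R) < Delta n w)%N.
  apply: (leq_trans hi).
  apply: (@leq_trans (count (neighbour (rhat n) w i) (iota q M))).
    rewrite /deg -!size_filter.
    apply: uniq_leq_size; first by rewrite filter_uniq// iota_uniq.
    move=> j; rewrite !mem_filter => /andP[Ue jq]; rewrite jq andbT.
    have ij : (i : nat) != j.
      move: jq; rewrite mem_iota => /andP[qj _].
      by rewrite ltn_eqF// (leq_trans (ltn_ord i)).
    rewrite /neighbour ij /=; apply: (le_trans Ue); rewrite /cut /clamp.
    have D0 := torus_dist_ge0 (X i w) (X j w).
    have rn := lt_le_trans rpos rr.
    have D1 : 0 <= torus_dist (X i w) (X j w) / rhat n by rewrite divr_ge0// ltW.
    case: ifP => _; last by case/andP: (g_range D1).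
    have /max_idPl -> : 0 <= torus_dist (X i w) (X j w) / r by rewrite divr_ge0// ltW.
    by apply: g_noninc => //; rewrite ler_wpM2l// lef_pV2 ?posrE.
  rewrite DeltaE// /max_degree.
  apply: (leq_trans _ (@leq_bigmax _ (fun i : 'I_(N n w) =>
    #|[pred j | random_graph X N U g n (rhat n) w i j]|) (Ordinal iN))).
  rewrite card_neighbour /=.
  rewrite -(subnKC qM) -addnA iotaD count_cat add0n iotaD count_cat.
  by rewrite addnCA leq_addr.
rewrite truncn_lt_nat; last first.
  by rewrite !mulr_ge0 ?(ltW gamma_gt0) ?(ltW y0) ?(le_trans (ltW lnn) lnb').
apply/negP; rewrite -leNgt; apply: (le_trans (ltW Dn)).
by rewrite ler_pM2l// mulr_gt0.
Qed.

Lemma ae_degree_upper y : 1 < y -> 1 < gamma * rateH y ->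
  {ae P, forall w, \forall n \near \oo, (Delta n w)%:R <= gamma * y * ln n%:R}.
Proof.
move=> y1 gH.
have [delta [eps [b0 [d0 e0 e1 b02 H]]]] := prob_upper_event gamma_gt0 y1 gH.
have h1 := @ae_good_bracket _ _ _ P (upper_event gamma y eps) delta 4 eps b0 d0
  (ler0n _ 4) e0 (measurable_upper_event gamma y eps) H.
have h2 := ae_poisson_count N_poisson e0 e1.
move: h1 h2; apply: filterS2 => w h1 h2.
move: h1 h2; apply: filterS2 => n [b [b' [b0b nbb _ nB]]] /andP[_ Nn].
apply: (max_degree_upper_event _ nbb (ltW e0) _ Nn nB); last by lra.
exact: leq_trans b02 b0b.
Qed.

Lemma ae_degree_lower y : 1 < y -> gamma * rateH y < 1 ->
  {ae P, forall w, \forall n \near \oo, gamma * y * ln n%:R <= (Delta n w)%:R}.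
Proof.
move=> y1 gH.
have [delta [eps [K [C [b0 [d0 e0 e1 [C0 b02] H]]]]]] := prob_lower_event gamma_gt0 y1 gH.
have h1 := @ae_good_bracket _ _ _ P (lower_event gamma y eps K) delta C eps b0 d0
  C0 e0 (measurable_lower_event gamma y eps K) H.
have e01 : eps < 1 by lra.
have h2 := ae_poisson_count N_poisson e0 e01.
move: h1 h2; apply: filterS2 => w h1 h2.
move: h1 h2; apply: filterS2 => n [b [b' [b0b nbb _ nB]]] /andP[Nn _].
have e02 : 0 < eps < 1 / 2 by rewrite e0.
apply: (max_degree_lower_event _ nbb e02 _ Nn nB); last by lra.
exact: leq_trans b02 b0b.
Qed.

(** The critical level [ys] solves [gamma * rateH ys = 1].  Levels of a countable
    family approaching [ys] from both sides squeeze the maximum degree, almost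
    surely at once for the whole family. *)
Lemma ae_degree_cvg :
  {ae P, forall w, (Delta n w)%:R / ln n%:R @[n --> \oo] --> gamma * rateH_inv gamma^-1}.
Proof.
have gi : 0 < gamma^-1 by rewrite invr_gt0.
have [ys1 ysE] := rateH_invP (ltW gi).
set ys := rateH_inv _ in ys1 ysE *.
have {}ys1 : 1 < ys.
  rewrite lt_neqAle ys1 andbT; apply/eqP => ys1E.
  by move: ysE; rewrite -ys1E rateH1 => /eqP; rewrite lt_eqF.
have gHys : gamma * rateH ys = 1 by rewrite ysE divff// gt_eqF.
have k1 k : 0 < k.+1%:R^-1 :> R by rewrite invr_gt0 ltr0n.
pose up k := ys + k.+1%:R^-1.
pose lo k := ys - (ys - 1) * k.+2%:R^-1.
have hup k : {ae P, forall w, \forall n \near \oo, (Delta n w)%:R <= gamma * up k * ln n%:R}.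
  have upk : ys < up k by rewrite ltrDl.
  apply: ae_degree_upper; first exact: lt_trans upk.
  by rewrite -gHys ltr_pM2l// rateH_increasing// ltW.
have hlo k : {ae P, forall w, \forall n \near \oo, gamma * lo k * ln n%:R <= (Delta n w)%:R}.
  have kl1 : k.+2%:R^-1 < 1 :> R by rewrite invf_lt1 ?ltr0n// ltr1n.
  have lo1 : 1 < lo k.
    have : (ys - 1) * k.+2%:R^-1 < ys - 1 by rewrite gtr_pMr// subr_gt0.
    by rewrite /lo ltrBrDr -ltrBrDl.
  have lok : lo k < ys by rewrite /lo gtrBl mulr_gt0// subr_gt0.
  apply: ae_degree_lower => //.
  by rewrite -gHys ltr_pM2l// rateH_increasing// ltW.
have := ae_foralln hlo; have := ae_foralln hup; apply: filterS2 => w hU hL.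
apply/cvgrPdist_le => e e0.
pose k := Num.truncn (gamma * ys / e).
have ke : gamma * ys < e * k.+1%:R.
  by rewrite [ltRHS]mulrC -ltr_pdivrMr// truncnS_gt.
have kR : 0 < k.+1%:R :> R by rewrite ltr0n.
have h1 : gamma * k.+1%:R^-1 <= e.
  rewrite ler_pdivrMr//; apply: le_trans (ltW ke).
  by rewrite ler_peMr// ltW.
have h2 : gamma * ((ys - 1) * k.+2%:R^-1) <= e.
  rewrite mulrA ler_pdivrMr ?ltr0n//; apply: (@le_trans _ _ (gamma * ys)).
    by rewrite ler_pM2l// gerBl.
  by apply: (le_trans (ltW ke)); rewrite ler_pM2l// ler_nat.
have hn : \forall n \near \oo, 0 < ln (n%:R : R).
  by exists 2%N => // n /= n2; rewrite ln_gt0// ltr1n.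
move: (hU k) (hL k) hn; apply: filterS3 => n nU nL ln0.
rewrite -ler_pdivrMr// in nU; rewrite -ler_pdivlMr// in nL.
rewrite ler_distlC; apply/andP; split.
- by apply: le_trans nL; rewrite /lo [leRHS]mulrBr lerD2l lerN2.
- by apply: (le_trans nU); rewrite /up [leLHS]mulrDr lerD2l.
Qed.

End connection_function.

End connection_model.

Theorem theorem2p5 (R : realType) (d : nat) (d_ge2 : (2 <= d)%N)
  (g : R -> R)
  (g_range : forall r : R, 0 <= r -> 0 <= g r <= 1)
  (g_noninc : forall r s : R, 0 <= r -> r <= s -> g s <= g r)
  (alpha : R) (alpha_gt0 : 0 < alpha)
  (alphaE : (\int[lebesgue_tuple R d]_x (g (enorm x))%:E)%E = alpha%:E)
  (dO : measure_display) (Omega : measurableType dO) (P : probability Omega R)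
  (X : nat -> {RV P >-> d.-tuple R})
  (N : nat -> {RV P >-> nat})
  (U : nat -> nat -> {RV P >-> R})
  (X_unif : forall i (A : set (d.-tuple R)), measurable A ->
     distribution P (X i) A = lebesgue_tuple R d (A `&` torus_cell R d))
  (X_indep : mutually_independent P [set: nat] (fun i => sigma_of (X i)))
  (N_poisson : forall n k, (0 < n)%N ->
     distribution P (N n) [set k] = (poisson_pmf n%:R k)%:E)
  (N_nondec : forall w m n, (0 < m)%N -> (m <= n)%N -> (N m w <= N n w)%N)
  (U_unif : forall i j, (i < j)%N -> forall A : set R, measurable A ->
     distribution P (U i j) A = uniform_prob (@ltr01 R) A)
  (U_indep : mutually_independent P [set ij : nat * nat | (ij.1 < ij.2)%N]
     (fun ij => sigma_of (U ij.1 ij.2)))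
  (XNU_indep : mutually_independent P [set: 'I_3] (fun k => nth set0
     [:: sigma_of_family [set: nat] X;
         sigma_of_family [set n | (0 < n)%N] N;
         sigma_of_family [set ij | (ij.1 < ij.2)%N]
           (fun ij : nat * nat => U ij.1 ij.2)] k))
  (gamma : R) (gamma_gt0 : 0 < gamma)
  (rhat : nat -> R)
  (rhat_ge0 : forall n, (0 < n)%N -> 0 <= rhat n)
  (rhatE : forall n, (0 < n)%N ->
     rhat n ^+ d = gamma * ln n%:R / (alpha * n%:R))
  (Delta : nat -> Omega -> nat)
  (DeltaE : forall n w, (0 < n)%N ->
     Delta n w = max_degree (random_graph X N U g n (rhat n) w)) :
  [/\ (forall c : R, d%:R < c -> g =o_+oo (fun r => r `^ (- c)) ->
        {ae P, forall w,
          (limn_esup (fun n => ((Delta n w)%:R / ln n%:R)%:E) <=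
             (gamma * rateH_inv gamma^-1)%:E)%E}),
      ((exists2 c : R, 0 < c & g =o_+oo (fun r => expR (- (c * r)))) ->
        {ae P, forall w,
          (Delta n w)%:R / ln n%:R @[n --> \oo] -->
            gamma * rateH_inv gamma^-1}) &
      (forall c : R, 3 * d%:R < c -> g =o_+oo (fun r => r `^ (- c)) ->
        {ae P, forall w,
          ((gamma * rateH_inv ((c - 3 * d%:R) / (gamma * (c - d%:R))))%:E <=
             limn_einf (fun n => ((Delta n w)%:R / ln n%:R)%:E))%E})].
Proof.
have d_gt0 : (0 < d)%N by exact: leq_trans d_ge2.
have XU_indep A B : sigma_of_family [set: nat] X A ->
    sigma_of_family [set ij | (ij.1 < ij.2)%N] (fun ij : nat * nat => U ij.1 ij.2) B ->
    indep_events P A B.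
  move=> sA sB; pose J : {fset 'I_3} := [fset ord0; ord_max]%fset.
  have := XNU_indep J (fun k => if k == ord0 then A else B).
  have -> : \bigcap_(i in [set` J]) (if i == ord0 then A else B) = A `&` B.
    apply/seteqP; split=> [w h|w [Aw Bw] i _]; last by case: ifP.
    split.
      by have := h ord0; rewrite eqxx; apply; rewrite /= !inE.
    by have := h ord_max; apply; rewrite /= !inE.
  rewrite /indep_events big_fsetU1 ?inE//= big_seq_fset1 => -> //.
  by move=> i; rewrite !inE => /orP[/eqP->|/eqP->].
have H := ae_degree_cvg X_unif X_indep U_unif U_indep XU_indep g_range g_noninc
  alpha_gt0 alphaE d_gt0 N_poisson gamma_gt0 rhat_ge0 rhatE DeltaE.
have HE : {ae P, forall w,
    ((Delta n w)%:R / ln n%:R)%:E @[n --> \oo] --> (gamma * rateH_inv gamma^-1)%:E}.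
  by apply: filterS H => w h; apply: cvg_EFin => //; exact: nearW.
split.
- by move=> c _ _; apply: filterS HE => w /cvg_limn_einf_sup[_ ->].
- by move=> _; exact: H.
- move=> c c3d _; apply: filterS HE => w /cvg_limn_einf_sup[-> _].
  rewrite lee_fin ler_pM2l//.
  have d0 : 0 < d%:R :> R by rewrite ltr0n.
  have cd : 0 < c - d%:R by lra.
  apply: rateH_inv_le; first by rewrite divr_ge0 ?mulr_ge0 ?(ltW gamma_gt0)//; lra.
  rewrite ler_pdivrMr ?mulr_gt0// mulrA mulVf ?gt_eqF// mul1r; lra.
Qed.
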